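(* Let $k$ be a field of arbitrary characteristic, let $Q$ be a quiver of finite representation type (over $k$), and let $M$ be a finitely generated indecomposable left $kQ$-module. Then $M$ has a universal deformation ring $R(kQ,M)$ over $kQ$, and $R(kQ,M)$ is isomorphic to $k$.
   Context: **Quivers.** A quiver is a quadruple $Q=(Q_0,Q_1,s,t)$, where $Q_0$ is a finite set of vertices, $Q_1$ is a finite set of arrows, and $s,t:Q_1\to Q_0$ assign to each arrow its source and its target. A (finite-dimensional) representation of $Q$ over $k$ consists of finite-dimensional $k$-vector spaces $V_i$ ($i\in Q_0$) and $k$-linear maps $f_\alpha:V_{s(\alpha)}\to V_{t(\alpha)}$ ($\alpha\in Q_1$). A morphism $(V_i,f_\alpha)\to(W_i,g_\alpha)$ is a family of linear maps $u_i:V_i\to W_i$ with $u_{t(\alpha)}\circ f_\alpha=g_\alpha\circ u_{s(\alpha)}$ for all $\alpha\in Q_1$; it is an isomorphism if every $u_i$ is invertible. Direct sums are formed vertexwise and arrowwise. A nonzero representation is indecomposable if it is not isomorphic to a direct sum of two nonzero representations. $Q$ is of finite representation type if it has only finitely many indecomposable representations up to isomorphism. **Path algebra.** The algebra $kQ$ is the associative unital $k$-algebra generated by elements $e_i$ ($i\in Q_0$) and $\alpha$ ($\alpha\in Q_1$), with relations $e_i^2=e_i$, $e_ie_j=0$ for $i\ne j$, $e_{t(\alpha)}\alpha=\alpha e_{s(\alpha)}=\alpha$, and identity $1=\sum_{i\in Q_0}e_i$. Representations of $Q$ correspond to left $kQ$-modules. When $Q$ is of finite representation type, $kQ$ is finite-dimensional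 over $k$. **Universal deformation rings.** Let $\hat{\mathcal{C}}$ be the category whose objects are the complete local commutative Noetherian $k$-algebras with residue field $k$, and whose morphisms are the continuous $k$-algebra homomorphisms inducing the identity map on the residue field $k$. Let $\Lambda$ be a finite-dimensional $k$-algebra, $V$ a finitely generated left $\Lambda$-module and $R$ an object of $\hat{\mathcal{C}}$. A lift of $V$ over $R$ is a pair $(N,\phi)$, where $N$ is a finitely generated $R\otimes_k\Lambda$-module that is free over $R$, and $\phi:k\otimes_R N\to V$ is an isomorphism of $\Lambda$-modules. Two lifts $(N,\phi)$, $(N',\phi')$ over $R$ are isomorphic if there is an $R\otimes_k\Lambda$-module isomorphism $f:N\to N'$ with $\phi'\circ(k\otimes_R f)=\phi$. A deformation $[N,\phi]$ of $V$ over $R$ is an isomorphism class of lifts, and $F_V(R)$ denotes the set of deformations of $V$ over $R$. This defines a covariant functor $F_V:\hat{\mathcal{C}}\to\mathrm{Sets}$: a morphism $\alpha:R\to R'$ sends $[N,\phi]$ to $[R'\otimes_{R,\alpha}N,\phi_\alpha]$, where $\phi_\alpha$ is the composition $k\otimes_{R'}(R'\otimes_{R,\alpha}N)\cong k\otimes_R N\xrightarrow{\phi}V$. One says that $V$ has a universal deformation ring $R(\Lambda,V)$ (over $\Lambda$) if $R(\Lambda,V)$ is an object of $\hat{\mathcal{C}}$ representing $F_V$, i.e. there is a lift $(U,\phi_U)$ of $V$ over $R(\Lambda,V)$ such that for every $R$ in $\hat{\mathcal{C}}$ the map $\mathrm{Hom}_{\hat{\mathcal{C}}}(R(\Lambda,V),R)\to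 F_V(R)$, $\alpha\mapsto F_V(\alpha)([U,\phi_U])$, is bijective. Here this is applied with $\Lambda=kQ$ and $V=M$. *)

(* Defs.v *)
From HB Require Import structures.
From mathcomp Require Import all_boot all_order all_algebra.
From mathcomp Require Import generic_quotient.
From mathcomp Require Import boolp classical_sets functions.

Set Implicit Arguments.
Unset Strict Implicit.
Unset Printing Implicit Defensive.

Import GRing.Theory.
Local Open Scope ring_scope.
Local Open Scope quotient_scope.
Local Open Scope classical_set_scope.

Section Modules.
Variable A : pzRingType.

Definition fin_gen (N : lmodType A) : Prop :=
  exists s : seq N, forall x, exists c : N -> A, x = \sum_(g <- s) c g *: g.

Definition is_basis (N : lmodType A) (B : set N) : Prop :=
  (forall x, exists2 s : seq N, {in s, forall b, B b} &
     exists c : N -> A, x = \sum_(b <- s) c b *: b) /\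
  (forall s : seq N, uniq s -> {in s, forall b, B b} ->
     forall c : N -> A, \sum_(b <- s) c b *: b = 0 -> {in s, forall b, c b = 0}).

Definition is_free (N : lmodType A) : Prop := exists B : set N, is_basis B.

Definition mod_nonzero (N : lmodType A) : Prop := exists x : N, x <> 0.

Definition mod_iso (N N' : lmodType A) : Prop :=
  exists f : {linear N -> N'}, bijective f.

Definition indecomposable (N : lmodType A) : Prop :=
  mod_nonzero N /\
  ~ exists N1 N2 : lmodType A,
      [/\ mod_nonzero N1, mod_nonzero N2 & mod_iso N (N1 * N2)%type].

End Modules.

(* Restriction of scalars along f. *)
Definition restr (A B : pzRingType) (f : {rmorphism A -> B}) (N : lmodType B)
  : Type := N.

Section Restr.
Variables (A B : pzRingType) (f : {rmorphism A -> B}) (N : lmodType B).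
HB.instance Definition _ := GRing.Zmodule.copy (restr f N) N.

Definition restr_scale (a : A) (x : restr f N) : restr f N := f a *: (x : N).

Fact restr_scaleA a b x :
  restr_scale a (restr_scale b x) = restr_scale (a * b) x.
Proof. by rewrite /restr_scale rmorphM scalerA. Qed.
Fact restr_scale1 : left_id 1 restr_scale.
Proof. by move=> x; rewrite /restr_scale rmorph1 scale1r. Qed.
Fact restr_scaleDr : right_distributive restr_scale +%R.
Proof. by move=> a x y; rewrite /restr_scale scalerDr. Qed.
Fact restr_scaleDl x : {morph restr_scale^~ x : a b / a + b}.
Proof. by move=> a b; rewrite /restr_scale rmorphD scalerDl. Qed.

HB.instance Definition _ := GRing.Zmodule_isLmodule.Build A (restr f N)
  restr_scaleA restr_scale1 restr_scaleDr restr_scaleDl.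
End Restr.

(* [algType] only contains nonzero algebras, but the path algebra of the empty
   quiver is zero: here the zero algebra is allowed. *)
Record kalg (k : fieldType) := KAlg {
  kalg_ring :> pzRingType;
  kscal : {rmorphism k -> kalg_ring};
  kscalC : forall c x, kscal c * x = x * kscal c }.
Arguments kscal {k} A : rename.

Section AlgOf.
Variables (k : fieldType) (A : comAlgType k).
Fact alg_of_subproof c (x : A) : in_alg A c * x = x * in_alg A c.
Proof. exact: mulrC. Qed.
Definition alg_of : kalg k := KAlg alg_of_subproof.
End AlgOf.

(* [presented_alg rel] is the quotient of the set of formal expressions in the
   generators [G] and the scalars by the smallest congruence [acong rel] that
   contains [rel] and makes it an associative unital k-algebra; 0 and 1 are the
   scalars [AScal 0] and [AScal 1]. *)

Section Presented.
Variables (k : fieldType) (G : Type).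

Inductive aterm :=
  AGen of G | AScal of k | AAdd of aterm & aterm | AMul of aterm & aterm.

Variable rel : aterm -> aterm -> Prop.

Inductive acong : aterm -> aterm -> Prop :=
| acong_rel x y : rel x y -> acong x y
| acong_refl x : acong x x
| acong_sym x y : acong x y -> acong y x
| acong_trans x y z : acong x y -> acong y z -> acong x z
| acong_add x x' y y' : acong x x' -> acong y y' -> acong (AAdd x y) (AAdd x' y')
| acong_mul x x' y y' : acong x x' -> acong y y' -> acong (AMul x y) (AMul x' y')
| acong_addA x y z : acong (AAdd x (AAdd y z)) (AAdd (AAdd x y) z)
| acong_addC x y : acong (AAdd x y) (AAdd y x)
| acong_add0 x : acong (AAdd (AScal 0) x) x
| acong_addN x : acong (AAdd (AMul (AScal (-1)) x) x) (AScal 0)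
| acong_mulA x y z : acong (AMul x (AMul y z)) (AMul (AMul x y) z)
| acong_mul1l x : acong (AMul (AScal 1) x) x
| acong_mul1r x : acong (AMul x (AScal 1)) x
| acong_mulDl x y z : acong (AMul (AAdd x y) z) (AAdd (AMul x z) (AMul y z))
| acong_mulDr x y z : acong (AMul x (AAdd y z)) (AAdd (AMul x y) (AMul x z))
| acong_scalD c d : acong (AScal (c + d)) (AAdd (AScal c) (AScal d))
| acong_scalM c d : acong (AScal (c * d)) (AMul (AScal c) (AScal d))
| acong_scalC c x : acong (AMul (AScal c) x) (AMul x (AScal c)).

Definition acongb : ssrbool.rel {classic aterm} := fun x y => `[< acong x y >].

Fact acongb_refl : reflexive acongb.
Proof. by move=> x; apply/asboolP; exact: acong_refl. Qed.
Fact acongb_sym : symmetric acongb.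
Proof.
by move=> x y; apply/asboolP/asboolP => ?; exact: acong_sym.
Qed.
Fact acongb_trans : transitive acongb.
Proof.
by move=> y x z /asboolP xy /asboolP yz; apply/asboolP; exact: acong_trans yz.
Qed.

Canonical acong_equiv := EquivRel acongb acongb_refl acongb_sym acongb_trans.

Definition presented : Type := {eq_quot acong_equiv}.

Definition acl (t : aterm) : presented := \pi_{eq_quot acong_equiv} t.
Definition arep (x : presented) : aterm :=
  @repr _ {eq_quot acong_equiv} x.

Lemma aclP t u : acl t = acl u <-> acong t u.
Proof.
split=> [/eqmodP/asboolP //|tu]; apply/eqmodP; exact/asboolP.
Qed.
Lemma arepK x : acl (arep x) = x.
Proof. exact: reprK. Qed.
Lemma aclK t : acong (arep (acl t)) t.
Proof. by apply/aclP; rewrite arepK. Qed.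

HB.instance Definition _ := gen_eqMixin presented.
HB.instance Definition _ := gen_choiceMixin presented.

Definition padd (x y : presented) := acl (AAdd (arep x) (arep y)).
Definition pmul (x y : presented) := acl (AMul (arep x) (arep y)).
Definition popp (x : presented) := acl (AMul (AScal (-1)) (arep x)).

Lemma aclD t u : acl (AAdd t u) = padd (acl t) (acl u).
Proof. by apply/aclP/acong_sym/acong_add; exact: aclK. Qed.
Lemma aclM t u : acl (AMul t u) = pmul (acl t) (acl u).
Proof. by apply/aclP/acong_sym/acong_mul; exact: aclK. Qed.

Fact paddA : associative padd.
Proof.
move=> x y z; rewrite -(arepK x) -(arepK y) -(arepK z) -!aclD.
exact/aclP/acong_addA.
Qed.
Fact paddC : commutative padd.
Proof.
by move=> x y; rewrite -(arepK x) -(arepK y) -!aclD; exact/aclP/acong_addC.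
Qed.
Fact padd0 : left_id (acl (AScal 0)) padd.
Proof. by move=> x; rewrite -(arepK x) -!aclD; exact/aclP/acong_add0. Qed.
Fact paddN : left_inverse (acl (AScal 0)) popp padd.
Proof.
by move=> x; rewrite -[x in padd _ x]arepK -aclD; exact/aclP/acong_addN.
Qed.

HB.instance Definition _ :=
  GRing.isZmodule.Build presented paddA paddC padd0 paddN.

Fact pmulA : associative pmul.
Proof.
move=> x y z; rewrite -(arepK x) -(arepK y) -(arepK z) -!aclM.
exact/aclP/acong_mulA.
Qed.
Fact pmul1l : left_id (acl (AScal 1)) pmul.
Proof. by move=> x; rewrite -(arepK x) -!aclM; exact/aclP/acong_mul1l. Qed.
Fact pmul1r : right_id (acl (AScal 1)) pmul.
Proof. by move=> x; rewrite -(arepK x) -!aclM; exact/aclP/acong_mul1r. Qed.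
Fact pmulDl : left_distributive pmul +%R.
Proof.
move=> x y z; rewrite /GRing.add /=.
rewrite -(arepK x) -(arepK y) -(arepK z) -!(aclM, aclD).
exact/aclP/acong_mulDl.
Qed.
Fact pmulDr : right_distributive pmul +%R.
Proof.
move=> x y z; rewrite /GRing.add /=.
rewrite -(arepK x) -(arepK y) -(arepK z) -!(aclM, aclD).
exact/aclP/acong_mulDr.
Qed.

HB.instance Definition _ :=
  GRing.Zmodule_isPzRing.Build presented pmulA pmul1l pmul1r pmulDl pmulDr.

Definition pscal (c : k) : presented := acl (AScal c).

Fact pscal_zmod : zmod_morphism pscal.
Proof.
move=> c d; apply/eqP; rewrite eq_sym subr_eq; apply/eqP.
by rewrite /pscal -[RHS]aclD -[in LHS](subrK d c); exact/aclP/acong_scalD.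
Qed.
Fact pscal_monoid : monoid_morphism pscal.
Proof.
by split=> // c d; rewrite /pscal -[RHS]aclM; exact/aclP/acong_scalM.
Qed.
HB.instance Definition _ :=
  GRing.isZmodMorphism.Build k presented pscal pscal_zmod.
HB.instance Definition _ :=
  GRing.isMonoidMorphism.Build k presented pscal pscal_monoid.

Fact pscalC c (x : presented) : pscal c * x = x * pscal c.
Proof.
by rewrite -(arepK x) /pscal -[LHS]aclM -[RHS]aclM; exact/aclP/acong_scalC.
Qed.

Definition presented_alg : kalg k := KAlg pscalC.

(* Modules over a presented algebra, from operators satisfying the relations. *)
Section Eval.
Variables (X : zmodType) (s : k -> X -> X) (u : G -> X -> X).

Fixpoint aeval (t : aterm) (x : X) : X :=
  match t with
  | AGen g => u g x
  | AScal c => s c x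
  | AAdd t1 t2 => aeval t1 x + aeval t2 x
  | AMul t1 t2 => aeval t1 (aeval t2 x)
  end.

Hypothesis sD : forall c x y, s c (x + y) = s c x + s c y.
Hypothesis uD : forall g x y, u g (x + y) = u g x + u g y.
Hypothesis s1 : forall x, s 1 x = x.
Hypothesis sDl : forall c d x, s (c + d) x = s c x + s d x.
Hypothesis sM : forall c d x, s (c * d) x = s c (s d x).
Hypothesis su : forall c g x, s c (u g x) = u g (s c x).
Hypothesis relP : forall t t', rel t t' -> aeval t =1 aeval t'.

Lemma aevalD t x y : aeval t (x + y) = aeval t x + aeval t y.
Proof.
elim: t x y => [g|c|t IHt v IHv|t IHt v IHv] x y /=; rewrite ?sD ?uD //.
  by rewrite IHt IHv addrACA.
by rewrite IHv IHt.
Qed.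

Lemma aeval_s t c x : s c (aeval t x) = aeval t (s c x).
Proof.
elim: t x => [g|d|t IHt v IHv|t IHt v IHv] x /=; rewrite ?su //.
- by rewrite -!sM mulrC.
- by rewrite sD IHt IHv.
- by rewrite IHt IHv.
Qed.

Lemma aeval_s0 x : s 0 x = 0.
Proof. by apply: (addrI (s 0 x)); rewrite -sDl !addr0. Qed.

Lemma aeval_cong t t' : acong t t' -> aeval t =1 aeval t'.
Proof.
elim=> {t t'} //=.
- by move=> x y _ xy z; rewrite xy.
- by move=> x y z _ xy _ yz w; rewrite xy yz.
- by move=> x x' y y' _ xx' _ yy' z; rewrite xx' yy'.
- by move=> x x' y y' _ xx' _ yy' z; rewrite yy' xx'.
- by move=> x y z w; rewrite addrA.
- by move=> x y w; rewrite addrC.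
- by move=> x w; rewrite aeval_s0 add0r.
- by move=> x w; rewrite -[X in _ + X]s1 -sDl addNr !aeval_s0.
- by move=> x w; rewrite s1.
- by move=> x w; rewrite s1.
- by move=> x y z w; rewrite aevalD.
- by move=> c x w; rewrite aeval_s.
Qed.

Definition paction (a : presented) (x : X) : X := aeval (arep a) x.

Lemma pactionE t x : paction (acl t) x = aeval t x.
Proof. exact/aeval_cong/aclK. Qed.

Lemma pactionA a b x : paction a (paction b x) = paction (a * b) x.
Proof.
by rewrite -(arepK a) -(arepK b) -[_ * _]aclM !pactionE.
Qed.
Lemma paction1 : left_id 1 paction.
Proof. by move=> x; rewrite pactionE /= s1. Qed.
Lemma pactionDr : right_distributive paction +%R.
Proof. by move=> a x y; rewrite -(arepK a) !pactionE aevalD. Qed.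
Lemma pactionDl x : {morph paction^~ x : a b / a + b}.
Proof.
by move=> a b /=; rewrite -(arepK a) -(arepK b) -[_ + _]aclD !pactionE.
Qed.
End Eval.

End Presented.

Section TensorAlg.
Variables (k : fieldType) (A B : kalg k).

(* [AGen (a, b)] is the pure tensor a (x) b. *)
Inductive tensor_alg_rel : aterm k (A * B) -> aterm k (A * B) -> Prop :=
| tar_addl a a' b : tensor_alg_rel
    (AGen k (a + a', b)) (AAdd (AGen k (a, b)) (AGen k (a', b)))
| tar_addr a b b' : tensor_alg_rel
    (AGen k (a, b + b')) (AAdd (AGen k (a, b)) (AGen k (a, b')))
| tar_scall c a b : tensor_alg_rel
    (AGen k (kscal A c * a, b)) (AMul (AScal _ c) (AGen k (a, b)))
| tar_scalr c a b : tensor_alg_rel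
    (AGen k (a, kscal B c * b)) (AMul (AScal _ c) (AGen k (a, b)))
| tar_mul a a' b b' : tensor_alg_rel
    (AMul (AGen k (a, b)) (AGen k (a', b'))) (AGen k (a * a', b * b'))
| tar_one : tensor_alg_rel (AGen k (1, 1)) (AScal _ 1).

Definition tensor_alg : kalg k := presented_alg tensor_alg_rel.

Definition tens (a : A) (b : B) : tensor_alg := acl tensor_alg_rel (AGen k (a, b)).

Lemma tensDl a a' b : tens (a + a') b = tens a b + tens a' b.
Proof. by rewrite -[RHS]aclD; exact/aclP/acong_rel/tar_addl. Qed.
Lemma tensDr a b b' : tens a (b + b') = tens a b + tens a b'.
Proof. by rewrite -[RHS]aclD; exact/aclP/acong_rel/tar_addr. Qed.
Lemma tensM a a' b b' : tens a b * tens a' b' = tens (a * a') (b * b').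
Proof. by rewrite -[LHS]aclM; exact/aclP/acong_rel/tar_mul. Qed.
Lemma tens1 : tens 1 1 = 1.
Proof. exact/aclP/acong_rel/tar_one. Qed.
Lemma tens_scall c a b : tens (kscal A c * a) b = kscal tensor_alg c * tens a b.
Proof. by rewrite -[RHS]aclM; exact/aclP/acong_rel/tar_scall. Qed.
Lemma tens_scalr c a b : tens a (kscal B c * b) = kscal tensor_alg c * tens a b.
Proof. by rewrite -[RHS]aclM; exact/aclP/acong_rel/tar_scalr. Qed.

Definition tens_inl (a : A) : tensor_alg := tens a 1.
Definition tens_inr (b : B) : tensor_alg := tens 1 b.

Fact tens_inl_zmod : zmod_morphism tens_inl.
Proof.
move=> a b; apply/eqP; rewrite eq_sym subr_eq; apply/eqP.
by rewrite /tens_inl -tensDl subrK.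
Qed.
Fact tens_inl_monoid : monoid_morphism tens_inl.
Proof. by split=> [|a b]; rewrite /tens_inl ?tens1 // tensM mulr1. Qed.
HB.instance Definition _ :=
  GRing.isZmodMorphism.Build A tensor_alg tens_inl tens_inl_zmod.
HB.instance Definition _ :=
  GRing.isMonoidMorphism.Build A tensor_alg tens_inl tens_inl_monoid.

Fact tens_inr_zmod : zmod_morphism tens_inr.
Proof.
move=> a b; apply/eqP; rewrite eq_sym subr_eq; apply/eqP.
by rewrite /tens_inr -tensDr subrK.
Qed.
Fact tens_inr_monoid : monoid_morphism tens_inr.
Proof. by split=> [|a b]; rewrite /tens_inr ?tens1 // tensM mulr1. Qed.
HB.instance Definition _ :=
  GRing.isZmodMorphism.Build B tensor_alg tens_inr tens_inr_zmod.
HB.instance Definition _ :=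
  GRing.isMonoidMorphism.Build B tensor_alg tens_inr tens_inr_monoid.
End TensorAlg.
Arguments tens_inl {k} A B a.
Arguments tens_inr {k} A B b.

Section Tensor.
Variables (R : comPzRingType) (M N : lmodType R).

(* M (x)_R N is the abelian group of formal sums of pure tensors modulo
   [tcong]. *)
Inductive tterm :=
  TPure of M & N | TZero | TAdd of tterm & tterm | TOpp of tterm.

Inductive tcong : tterm -> tterm -> Prop :=
| tcong_refl x : tcong x x
| tcong_sym x y : tcong x y -> tcong y x
| tcong_trans x y z : tcong x y -> tcong y z -> tcong x z
| tcong_add x x' y y' : tcong x x' -> tcong y y' -> tcong (TAdd x y) (TAdd x' y')
| tcong_opp x x' : tcong x x' -> tcong (TOpp x) (TOpp x')
| tcong_addA x y z : tcong (TAdd x (TAdd y z)) (TAdd (TAdd x y) z)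
| tcong_addC x y : tcong (TAdd x y) (TAdd y x)
| tcong_add0 x : tcong (TAdd TZero x) x
| tcong_addN x : tcong (TAdd (TOpp x) x) TZero
| tcong_Dl m m' n : tcong (TPure (m + m') n) (TAdd (TPure m n) (TPure m' n))
| tcong_Dr m n n' : tcong (TPure m (n + n')) (TAdd (TPure m n) (TPure m n'))
| tcong_Z r m n : tcong (TPure (r *: m) n) (TPure m (r *: n)).

Definition tcongb : ssrbool.rel {classic tterm} := fun x y => `[< tcong x y >].

Fact tcongb_refl : reflexive tcongb.
Proof. by move=> x; apply/asboolP; exact: tcong_refl. Qed.
Fact tcongb_sym : symmetric tcongb.
Proof. by move=> x y; apply/asboolP/asboolP => ?; exact: tcong_sym. Qed.
Fact tcongb_trans : transitive tcongb.
Proof.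
by move=> y x z /asboolP xy /asboolP yz; apply/asboolP; exact: tcong_trans yz.
Qed.

Canonical tcong_equiv := EquivRel tcongb tcongb_refl tcongb_sym tcongb_trans.

Definition tensor : Type := {eq_quot tcong_equiv}.

Definition tcl (t : tterm) : tensor := \pi_{eq_quot tcong_equiv} t.
Definition trep (x : tensor) : tterm := @repr _ {eq_quot tcong_equiv} x.

Lemma tclP t u : tcl t = tcl u <-> tcong t u.
Proof.
split=> [/eqmodP/asboolP //|tu]; apply/eqmodP; exact/asboolP.
Qed.
Lemma trepK x : tcl (trep x) = x.
Proof. exact: reprK. Qed.
Lemma tclK t : tcong (trep (tcl t)) t.
Proof. by apply/tclP; rewrite trepK. Qed.

HB.instance Definition _ := gen_eqMixin tensor.
HB.instance Definition _ := gen_choiceMixin tensor.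

Definition tadd (x y : tensor) := tcl (TAdd (trep x) (trep y)).
Definition topp (x : tensor) := tcl (TOpp (trep x)).

Lemma tclD t u : tcl (TAdd t u) = tadd (tcl t) (tcl u).
Proof. by apply/tclP/tcong_sym/tcong_add; exact: tclK. Qed.
Lemma tclN t : tcl (TOpp t) = topp (tcl t).
Proof. by apply/tclP/tcong_sym/tcong_opp; exact: tclK. Qed.

Fact taddA : associative tadd.
Proof.
move=> x y z; rewrite -(trepK x) -(trepK y) -(trepK z) -!tclD.
exact/tclP/tcong_addA.
Qed.
Fact taddC : commutative tadd.
Proof.
by move=> x y; rewrite -(trepK x) -(trepK y) -!tclD; exact/tclP/tcong_addC.
Qed.
Fact tadd0 : left_id (tcl TZero) tadd.
Proof. by move=> x; rewrite -(trepK x) -!tclD; exact/tclP/tcong_add0. Qed.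
Fact taddN : left_inverse (tcl TZero) topp tadd.
Proof.
by move=> x; rewrite -(trepK x) -tclN -tclD; exact/tclP/tcong_addN.
Qed.

HB.instance Definition _ :=
  GRing.isZmodule.Build tensor taddA taddC tadd0 taddN.

Definition tpure (m : M) (n : N) : tensor := tcl (TPure m n).

Lemma tpureDl m m' n : tpure (m + m') n = tpure m n + tpure m' n.
Proof. by rewrite -[RHS]tclD; exact/tclP/tcong_Dl. Qed.
Lemma tpureDr m n n' : tpure m (n + n') = tpure m n + tpure m n'.
Proof. by rewrite -[RHS]tclD; exact/tclP/tcong_Dr. Qed.
Lemma tpureZ r m n : tpure (r *: m) n = tpure m (r *: n).
Proof. exact/tclP/tcong_Z. Qed.

Lemma tensor_ind (P : tensor -> Prop) :
  (forall m n, P (tpure m n)) -> (forall x y, P x -> P y -> P (x + y)) ->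
  forall x, P x.
Proof.
move=> Pp PD x; rewrite -(trepK x).
have P0 : P 0.
  rewrite -[0](_ : tpure 0 0 = 0) //.
  by apply: (addrI (tpure 0 0)); rewrite -tpureDl !addr0.
have tpure0 m : tpure m 0 = 0.
  by apply: (addrI (tpure m 0)); rewrite -tpureDr !addr0.
have tpureN m n : - tpure m n = tpure m (- n).
  by apply/eqP; rewrite eq_sym -subr_eq0 opprK -tpureDr addNr tpure0.
suff: P (tcl (trep x)) /\ P (- tcl (trep x)) by case.
elim: (trep x) => [m n||t [Pt PNt] u [Pu PNu]|t [Pt PNt]].
- by split; [exact: Pp | rewrite tpureN; exact: Pp].
- by split; [exact: P0 | rewrite oppr0; exact: P0].
- have -> : tcl (TAdd t u) = tcl t + tcl u by exact: tclD.
  by rewrite opprD; split; exact: PD.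
- have -> : tcl (TOpp t) = - tcl t by exact: tclN.
  by rewrite opprK.
Qed.

Section Lift.
Variables (X : zmodType) (f : M -> N -> X).

Fixpoint teval (t : tterm) : X :=
  match t with
  | TPure m n => f m n
  | TZero => 0
  | TAdd t1 t2 => teval t1 + teval t2
  | TOpp t1 => - teval t1
  end.

(* The additive map m (x) n |-> f m n, when [f] is balanced. *)
Definition tlift (x : tensor) : X := teval (trep x).

Definition balanced :=
  [/\ forall m m' n, f (m + m') n = f m n + f m' n,
      forall m n n', f m (n + n') = f m n + f m n' &
      forall r m n, f (r *: m) n = f m (r *: n)].

Hypothesis f_bal : balanced.

Lemma teval_cong t u : tcong t u -> teval t = teval u.
Proof.
case: f_bal => fDl fDr fZ; elim=> {t u} //=.
- by move=> x y z _ -> _ ->.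
- by move=> x x' y y' _ -> _ ->.
- by move=> x x' _ ->.
- by move=> *; rewrite addrA.
- by move=> *; rewrite addrC.
- by move=> *; rewrite add0r.
- by move=> *; rewrite addNr.
Qed.

Lemma tlift_pure m n : tlift (tpure m n) = f m n.
Proof. exact: teval_cong (tclK _). Qed.
Lemma tliftD x y : tlift (x + y) = tlift x + tlift y.
Proof. exact: teval_cong (tclK _). Qed.
End Lift.
End Tensor.

(* For R, A commutative k-algebras, alpha : R -> A a morphism and N an
   (R (x)_k Lam)-module, [bchange alpha N] is A (x)_{R, alpha} N with its
   (A (x)_k Lam)-module structure
     (a (x) l) . (a' (x) n) = (a a') (x) ((1 (x) l) . n). *)
Section BaseChange.
Variables (k : fieldType) (Lam : kalg k) (R A : comAlgType k).
Variables (alpha : {lrmorphism R -> A}).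
Variable N : lmodType (tensor_alg (alg_of R) Lam).

Definition bchange : Type :=
  tensor (restr alpha A^o) (restr (tens_inl (alg_of R) Lam) N).

HB.instance Definition _ := GRing.Zmodule.on bchange.

Definition bpure (a : A) (n : N) : bchange :=
  tpure (a : restr alpha A^o) (n : restr (tens_inl (alg_of R) Lam) N).

Lemma bpureDl a a' n : bpure (a + a') n = bpure a n + bpure a' n.
Proof. exact: tpureDl. Qed.
Lemma bpureDr a n n' : bpure a (n + n') = bpure a n + bpure a n'.
Proof. exact: tpureDr. Qed.
Lemma bpureZ r a n :
  bpure (alpha r * a) n = bpure a (tens (r : alg_of R) 1 *: n).
Proof. exact: tpureZ. Qed.
Lemma bpure_ind (P : bchange -> Prop) :
  (forall a n, P (bpure a n)) -> (forall x y, P x -> P y -> P (x + y)) ->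
  forall x, P x.
Proof. exact: (@tensor_ind R _ _ P). Qed.

(* a (x) n |-> p.1 a (x) (1 (x) p.2) . n *)
Definition bop (p : alg_of A * Lam) : bchange -> bchange :=
  tlift (fun (a : restr alpha A^o) (n : restr (tens_inl (alg_of R) Lam) N) =>
    bpure ((p.1 : A) * (a : A)) (tens (1 : alg_of R) p.2 *: (n : N))).

Lemma bop_bal p : balanced
  (fun (a : restr alpha A^o) (n : restr (tens_inl (alg_of R) Lam) N) =>
    bpure ((p.1 : A) * (a : A)) (tens (1 : alg_of R) p.2 *: (n : N))).
Proof.
split=> [a a' n|a n n'|r a n].
- by rewrite -bpureDl -mulrDr.
- by rewrite -bpureDr -scalerDr.
- have -> : ((r *: a : restr alpha A^o) : A) = alpha r * (a : A) by [].
  rewrite mulrCA bpureZ; congr (bpure _ _).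
  have -> : ((r *: n : restr (tens_inl (alg_of R) Lam) N) : N)
          = tens (r : alg_of R) (1 : Lam) *: (n : N) by [].
  by rewrite !scalerA !tensM !mul1r !mulr1.
Qed.

Lemma bop_pure p a n :
  bop p (bpure a n) = bpure ((p.1 : A) * a) (tens (1 : alg_of R) p.2 *: n).
Proof. exact: tlift_pure (bop_bal p) _ _. Qed.
Lemma bopD p x y : bop p (x + y) = bop p x + bop p y.
Proof. exact: tliftD (bop_bal p) _ _. Qed.

Definition bscal (c : k) : bchange -> bchange := bop (kscal (alg_of A) c, 1).

Definition bscale : tensor_alg (alg_of A) Lam -> bchange -> bchange :=
  paction bscal bop.

Lemma bscalE c a n : bscal c (bpure a n) = bpure (c *: a) n.
Proof. by rewrite /bscal bop_pure /= tens1 scale1r mulr_algl. Qed.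

Let sD c x y : bscal c (x + y) = bscal c x + bscal c y.
Proof. exact: bopD. Qed.
Let s1 x : bscal 1 x = x.
Proof.
elim/bpure_ind: x => [a n|x y IHx IHy]; first by rewrite bscalE scale1r.
by rewrite sD IHx IHy.
Qed.
Let sDl c d x : bscal (c + d) x = bscal c x + bscal d x.
Proof.
elim/bpure_ind: x => [a n|x y IHx IHy].
  by rewrite !bscalE scalerDl bpureDl.
by rewrite !sD IHx IHy addrACA.
Qed.
Let sM c d x : bscal (c * d) x = bscal c (bscal d x).
Proof.
elim/bpure_ind: x => [a n|x y IHx IHy]; first by rewrite !bscalE scalerA.
by rewrite !sD IHx IHy.
Qed.
Let su c g x : bscal c (bop g x) = bop g (bscal c x).
Proof.
elim/bpure_ind: x => [a n|x y IHx IHy].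
  by rewrite bop_pure !bscalE bop_pure scalerAr.
by rewrite !(sD, bopD) IHx IHy.
Qed.
Let relP t t' : tensor_alg_rel t t' ->
  aeval bscal bop t =1 aeval bscal bop t'.
Proof.
case=> [a a' b|a b b'|c a b|c a b|a a' b b'|] x; cbn [aeval];
  (elim/bpure_ind: x => [d n|x y IHx IHy];
   last by rewrite !(sD, bopD) IHx IHy // addrACA);
  rewrite !(bop_pure, bscalE) /fst /snd.
- by rewrite mulrDl bpureDl.
- by rewrite tensDr scalerDl bpureDr.
- by rewrite mulr_algl scalerAl.
- have -> : tens (1 : alg_of R) (kscal Lam c * b)
          = tens (kscal (alg_of R) c) 1 * tens (1 : alg_of R) b.
    by rewrite tensM mulr1 mul1r tens_scalr -tens_scall mulr1.
  rewrite -scalerA -bpureZ; congr (bpure _ _).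
  have -> : alpha (kscal (alg_of R) c) = c%:A by rewrite /= linearZ rmorph1.
  by rewrite mulr_algl.
- by rewrite mulrA scalerA tensM mulr1.
- by rewrite mul1r tens1 !scale1r.
Qed.

HB.instance Definition _ :=
  GRing.Zmodule_isLmodule.Build (tensor_alg (alg_of A) Lam) bchange
    (pactionA sD bopD s1 sDl sM su relP) (paction1 sD bopD s1 sDl sM su relP)
    (pactionDr sD bopD s1 sDl sM su relP) (pactionDl sD bopD s1 sDl sM su relP).

Lemma bscale_pure a l a' n :
  tens (a : alg_of A) l *: bpure a' n
  = bpure (a * a') (tens (1 : alg_of R) l *: n).
Proof.
rewrite -[LHS]/(paction _ _ _ _).
by rewrite (pactionE sD bopD s1 sDl sM su relP) /= bop_pure.
Qed.
End BaseChange.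

Lemma tens_scalable (k : fieldType) (A B : kalg k)
    (N N' : lmodType (tensor_alg A B)) (f : N -> N') :
  (forall x y, f (x + y) = f x + f y) ->
  (forall a b x, f (tens a b *: x) = tens a b *: f x) -> scalable f.
Proof.
move=> fD fT t x; rewrite -(arepK t).
elim: (arep t) x => [[a b]|c|u IHu v IHv|u IHu v IHv] x.
- exact: fT.
- have -> : acl (tensor_alg_rel (B:=B)) (AScal _ c) = tens (kscal A c) (1 : B).
    by rewrite -[kscal A c]mulr1 tens_scall tens1 mulr1.
  exact: fT.
- by rewrite aclD !scalerDl fD IHu IHv.
- by rewrite aclM -!scalerA IHu IHv.
Qed.

Lemma additive_zmod (U V : zmodType) (f : U -> V) :
  (forall x y, f (x + y) = f x + f y) -> zmod_morphism f.
Proof.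
by move=> fD x y; apply/eqP; rewrite eq_sym subr_eq -fD subrK.
Qed.

(* A (x)_R f : A (x)_R N -> A (x)_R N'. *)
Section BaseChangeMap.
Variables (k : fieldType) (Lam : kalg k) (R A : comAlgType k).
Variables (alpha : {lrmorphism R -> A}).
Variables (N N' : lmodType (tensor_alg (alg_of R) Lam)).
Variable f : {linear N -> N'}.

Definition bmap : bchange alpha N -> bchange alpha N' :=
  tlift (fun (a : restr alpha A^o) (n : restr (tens_inl (alg_of R) Lam) N) =>
    bpure alpha (a : A) (f n)).

Let bal : balanced
  (fun (a : restr alpha A^o) (n : restr (tens_inl (alg_of R) Lam) N) =>
    bpure alpha (a : A) (f n)).
Proof.
split=> [a a' n|a n n'|r a n].
- exact: bpureDl.
- by rewrite raddfD bpureDr.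
- by rewrite [LHS]bpureZ -linearZ_LR.
Qed.

Lemma bmap_pure a n : bmap (bpure alpha a n) = bpure alpha a (f n).
Proof. exact: tlift_pure bal _ _. Qed.

Let bmapD x y : bmap (x + y) = bmap x + bmap y.
Proof. exact: tliftD bal _ _. Qed.

HB.instance Definition _ :=
  GRing.isZmodMorphism.Build _ _ bmap (additive_zmod bmapD).

Fact bmap_scalable : scalable bmap.
Proof.
apply: tens_scalable => // a l x.
elim/bpure_ind: x => [a' n|x y IHx IHy].
  by rewrite bscale_pure !bmap_pure bscale_pure linearZ_LR.
by rewrite scalerDr !bmapD scalerDr IHx IHy.
Qed.
HB.instance Definition _ := GRing.isScalable.Build _ _ _ _ bmap bmap_scalable.
End BaseChangeMap.
Arguments bmap {k Lam R A} alpha {N N'} f _.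

(* B (x)_A (A (x)_R N) -> B (x)_R N,  b (x) (a (x) n) |-> b beta(a) (x) n. *)
Section BaseChangeComp.
Variables (k : fieldType) (Lam : kalg k) (R A B : comAlgType k).
Variables (alpha : {lrmorphism R -> A}) (beta : {lrmorphism A -> B}).
Variables (gamma : {lrmorphism R -> B}).
Hypothesis gammaE : forall r, beta (alpha r) = gamma r.
Variable N : lmodType (tensor_alg (alg_of R) Lam).

Definition bcomp_in (b : B) : bchange alpha N -> bchange gamma N :=
  tlift (fun (a : restr alpha A^o) (n : restr (tens_inl (alg_of R) Lam) N) =>
    bpure gamma (b * beta (a : A)) (n : N)).

Let betaM x y : beta (x * y) = beta x * beta y.
Proof. exact: rmorphM. Qed.

Let bal_in b : balanced
  (fun (a : restr alpha A^o) (n : restr (tens_inl (alg_of R) Lam) N) =>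
    bpure gamma (b * beta (a : A)) (n : N)).
Proof.
split=> [a a' n|a n n'|r a n].
- by rewrite -bpureDl -mulrDr -raddfD.
- exact: bpureDr.
- have -> : ((r *: a : restr alpha A^o) : A) = alpha r * (a : A) by [].
  by rewrite betaM gammaE mulrCA bpureZ.
Qed.

(* The unused argument makes the instances below, which need [gammaE],
   instances for [bcomp] itself. *)
Definition bcomp_with (_ : forall r, beta (alpha r) = gamma r) :
    bchange beta (bchange alpha N) -> bchange gamma N :=
  tlift (fun (b : restr beta B^o)
             (x : restr (tens_inl (alg_of A) Lam) (bchange alpha N)) =>
    bcomp_in (b : B) (x : bchange alpha N)).

Definition bcomp := bcomp_with gammaE.

Let bcomp_in_pure b a n :
  bcomp_in b (bpure alpha a n) = bpure gamma (b * beta a) n.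
Proof. exact: tlift_pure (bal_in b) _ _. Qed.
Let bcomp_inD b x y : bcomp_in b (x + y) = bcomp_in b x + bcomp_in b y.
Proof. exact: tliftD (bal_in b) _ _. Qed.

Let bal : balanced
  (fun (b : restr beta B^o)
       (x : restr (tens_inl (alg_of A) Lam) (bchange alpha N)) =>
    bcomp_in (b : B) (x : bchange alpha N)).
Proof.
split=> [b b' x|b x y|a b x].
- elim/bpure_ind: x => [a n|x y IHx IHy].
    by rewrite !bcomp_in_pure mulrDl bpureDl.
  by rewrite !bcomp_inD IHx IHy addrACA.
- exact: bcomp_inD.
- have -> : ((a *: b : restr beta B^o) : B) = beta a * (b : B) by [].
  have -> : ((a *: x : restr (tens_inl (alg_of A) Lam) (bchange alpha N))
             : bchange alpha N) = tens (a : alg_of A) 1 *: (x : bchange alpha N).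
    by [].
  elim/bpure_ind: x => [a' n|x y IHx IHy].
    by rewrite bscale_pure !bcomp_in_pure tens1 scale1r betaM mulrA
      [b * beta a]mulrC.
  by rewrite scalerDr !bcomp_inD IHx IHy.
Qed.

Lemma bcomp_pure b a n :
  bcomp (bpure beta b (bpure alpha a n)) = bpure gamma (b * beta a) n.
Proof. by rewrite [LHS](tlift_pure bal) bcomp_in_pure. Qed.

Let bcompD x y : bcomp (x + y) = bcomp x + bcomp y.
Proof. exact: tliftD bal _ _. Qed.

HB.instance Definition _ :=
  GRing.isZmodMorphism.Build _ _ bcomp (additive_zmod bcompD).

Fact bcomp_scalable : scalable bcomp.
Proof.
apply: tens_scalable => // b l x.
elim/bpure_ind: x => [b' y|x y IHx IHy]; last first.
  by rewrite scalerDr !bcompD scalerDr IHx IHy.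
elim/bpure_ind: y => [a n|x y IHx IHy]; last first.
  by rewrite !bpureDr scalerDr !bcompD scalerDr IHx IHy.
by rewrite bscale_pure bscale_pure mul1r !bcomp_pure bscale_pure mulrA.
Qed.
HB.instance Definition _ :=
  GRing.isScalable.Build _ _ _ _ bcomp bcomp_scalable.
End BaseChangeComp.
Arguments bcomp {k Lam R A B alpha beta gamma} gammaE N _.

Section RestrMap.
Variables (A B : pzRingType) (f : {rmorphism A -> B}) (N N' : lmodType B).
Variable g : {linear N -> N'}.
Definition restr_map : restr f N -> restr f N' := g.
Fact restr_map_linear : linear restr_map.
Proof. by move=> a x y; rewrite /restr_map [LHS]linearP. Qed.
HB.instance Definition _ :=
  GRing.isLinear.Build A (restr f N) (restr f N') _ restr_map restr_map_linear.
End RestrMap.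
Arguments restr_map {A B} f {N N'} g _.

Section Ideals.
Variable R : comPzRingType.

Definition ideal (I : set R) : Prop :=
  [/\ I 0, forall x y, I x -> I y -> I (x + y) & forall a x, I x -> I (a * x)].

Definition maximal_ideal (I : set R) : Prop :=
  [/\ ideal I, I <> setT &
      forall J : set R, ideal J -> I `<=` J -> J = I \/ J = setT].

Definition noetherian : Prop :=
  forall I : set R, ideal I -> exists s : seq R,
    I = [set x | exists c : R -> R, x = \sum_(g <- s) c g * g].

Definition ideal_mul (I J : set R) : set R :=
  [set x | exists2 s : seq (R * R), {in s, forall p, I p.1 /\ J p.2} &
           x = \sum_(p <- s) p.1 * p.2].

Definition ideal_pow (I : set R) (n : nat) : set R := iter n (ideal_mul I) setT.

(* R -> lim R / I^n is injective and surjective. *)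
Definition adically_complete (I : set R) : Prop :=
  (forall x, (forall n, ideal_pow I n x) -> x = 0) /\
  (forall u : nat -> R, (forall n, ideal_pow I n (u n.+1 - u n)) ->
     exists x, forall n, ideal_pow I n (x - u n)).

End Ideals.

(* [chat_aug] is the projection onto the residue field. *)
Record chat (k : fieldType) := Chat {
  chat_alg :> comAlgType k;
  chat_aug : {lrmorphism chat_alg -> k^o};
  chat_local : forall I : set chat_alg,
    maximal_ideal I <-> I = chat_aug @^-1` [set 0];
  chat_noetherian : noetherian chat_alg;
  chat_complete : adically_complete (chat_aug @^-1` [set 0]) }.

Section Chat.
Variable k : fieldType.

Definition max_ideal (R : chat k) : set R := chat_aug R @^-1` [set 0].

Definition adic_continuous (R S : chat k) (f : R -> S) : Prop :=
  forall x n, exists m, forall y,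
    ideal_pow (max_ideal (R := R)) m (y - x) ->
    ideal_pow (max_ideal (R := S)) n (f y - f x).

Record chat_hom (R S : chat k) := ChatHom {
  chat_fun :> {lrmorphism R -> S};
  chat_hom_aug : forall r, chat_aug S (chat_fun r) = chat_aug R r;
  chat_hom_cont : adic_continuous chat_fun }.

Definition chat_iso (R S : chat k) : Prop :=
  exists (f : chat_hom R S) (g : chat_hom S R), cancel f g /\ cancel g f.

Fact field_ideal (I : set k^o) : ideal I -> I = [set 0] \/ I = setT.
Proof.
case=> I0 ID IM; case: (pselect (exists2 x, I x & x != 0)) => [[x Ix x0]|nI].
  right; apply/seteqP; split=> // y _.
  by rewrite -[y](mulfVK x0); exact: IM.
left; apply/seteqP; split=> [x Ix|x -> //] /=.
by apply/eqP/negPn/negP => x0; apply: nI; exists x.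
Qed.

Fact field_zero_ideal : ideal [set (0 : k^o)].
Proof.
split=> //= [x y -> ->|a x ->]; first by rewrite addr0.
by rewrite mulr0.
Qed.

Fact field_local (I : set k^o) :
  maximal_ideal I <-> I = (idfun : {lrmorphism k^o -> k^o}) @^-1` [set 0].
Proof.
rewrite preimage_id; split=> [[Ii IT _]|->].
  by case: (field_ideal Ii).
split=> [||J /field_ideal//]; first exact: field_zero_ideal.
move=> E; have : [set (0 : k^o)] 1 by rewrite E.
by move=> /eqP; rewrite oner_eq0.
Qed.

Fact field_noetherian : noetherian (k^o : comAlgType k).
Proof.
move=> I /field_ideal[->|->].
  exists [::]; apply/seteqP; split=> [x ->|x [c ->]] /=; last by rewrite big_nil.
  by exists id; rewrite big_nil.
exists [:: 1]; apply/seteqP; split=> // x _.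
by exists (fun=> x); rewrite big_seq1 mulr1.
Qed.

Fact field_complete :
  adically_complete ((idfun : {lrmorphism k^o -> k^o}) @^-1` [set 0]).
Proof.
have pow1 x :
    ideal_pow ((idfun : {lrmorphism k^o -> k^o}) @^-1` [set 0]) 1 x -> x = 0.
  case=> s sP ->; rewrite big_seq big1 // => p /sP[/= -> _].
  by rewrite mul0r.
have powS n x : x = 0 ->
    ideal_pow ((idfun : {lrmorphism k^o -> k^o}) @^-1` [set 0]) n x.
  by case: n => [//|n] ->; exists [::]; rewrite ?big_nil.
split=> [x /(_ 1%N)/pow1 //|u uP].
have uE n : u n.+1 = u 1%N.
  elim: n => // n <-; apply/eqP; rewrite -subr_eq0; apply/eqP/pow1.
  case: (uP n.+1) => s sP ->; exists s => // p /sP[p1 _]; split=> //.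
by exists (u 1%N) => -[//|n]; apply: powS; rewrite uE subrr.
Qed.

Definition chat_field : chat k :=
  Chat field_local field_noetherian field_complete.

End Chat.

Section Deformations.
Variables (k : fieldType) (Lam : kalg k) (V : lmodType Lam).

(* k (x)_R N as a Lam-module. *)
Definition reduction (R : chat k) (N : lmodType (tensor_alg (alg_of R) Lam)) :
    lmodType Lam :=
  restr (tens_inr (alg_of (k^o : comAlgType k)) Lam) (bchange (chat_aug R) N).

Definition reduction_map (R : chat k)
    (N N' : lmodType (tensor_alg (alg_of R) Lam)) (f : {linear N -> N'}) :
    {linear reduction N -> reduction N'} :=
  restr_map (tens_inr (alg_of (k^o : comAlgType k)) Lam)
    (bmap (chat_aug R) f).

(* A pair (N, phi) that need not be a lift. *)
Record prelift (R : chat k) := Prelift {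
  lift_mod : lmodType (tensor_alg (alg_of R) Lam);
  lift_map : {linear reduction lift_mod -> V} }.

Definition is_lift (R : chat k) (L : prelift R) : Prop :=
  [/\ fin_gen (lift_mod L),
      is_free (restr (tens_inl (alg_of R) Lam) (lift_mod L)) &
      bijective (lift_map L)].

Definition lift_iso (R : chat k) (L L' : prelift R) : Prop :=
  exists2 f : {linear lift_mod L -> lift_mod L'}, bijective f &
    forall x, lift_map L' (reduction_map f x) = lift_map L x.

(* (S (x)_{R, alpha} N, phi_alpha) *)
Definition lift_change (R S : chat k) (alpha : chat_hom R S) (L : prelift R) :
    prelift S :=
  @Prelift S (bchange alpha (lift_mod L))
    (lift_map L \o
       restr_map (tens_inr (alg_of (k^o : comAlgType k)) Lam)
         (bcomp (chat_hom_aug alpha) (lift_mod L))).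

(* Predicates on [prelift R] are used instead of classical sets because
   [prelift R], which contains a module, is too large a type for [set]. *)
Definition deformation_class (R : chat k) (L : prelift R) : prelift R -> Prop :=
  fun L' => is_lift L' /\ lift_iso L L'.

(* F_V(R), as the predicate of being an isomorphism class of lifts. *)
Definition deformations (R : chat k) (D : prelift R -> Prop) : Prop :=
  exists2 L : prelift R, is_lift L & D = deformation_class L.

(* F_V(alpha) sends the class of L to the class of its base change. *)
Definition deformation_map (R S : chat k) (alpha : chat_hom R S)
    (D : prelift R -> Prop) : prelift S -> Prop :=
  fun L' => exists2 L, D L & deformation_class (lift_change alpha L) L'.

Definition is_universal_deformation_ring (R : chat k) : Prop :=
  exists2 U : prelift R, is_lift U &
    forall S : chat k,
      let ev (alpha : chat_hom R S) :=
        deformation_map alpha (deformation_class U) in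
      [/\ forall alpha, deformations (ev alpha),
          forall alpha beta, ev alpha = ev beta -> alpha = beta &
          forall D, deformations D -> exists alpha, ev alpha = D].

End Deformations.

Record quiver := Quiver {
  vertex : finType;
  arrow : finType;
  source : arrow -> vertex;
  target : arrow -> vertex }.

Section Representations.
Variables (k : fieldType) (Q : quiver).

Record rep := Rep {
  rep_space : vertex Q -> vectType k;
  rep_map : forall a : arrow Q,
    {linear rep_space (source a) -> rep_space (target a)} }.

Definition rep_iso (V W : rep) : Prop :=
  exists u : forall i, {linear rep_space V i -> rep_space W i},
    (forall i, bijective (u i)) /\
    (forall a x, u (target a) (rep_map V a x) = rep_map W a (u (source a) x)).

Section DirectSumMap.
Variables (U U' W W' : vectType k) (f : {linear U -> W}) (g : {linear U' -> W'}).
Definition dsum_map (x : U * U') : W * W' := (f x.1, g x.2).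
Fact dsum_map_linear : linear dsum_map.
Proof. by move=> c x y; rewrite /dsum_map !linearP. Qed.
HB.instance Definition _ :=
  GRing.isLinear.Build k (U * U')%type (W * W')%type _ dsum_map dsum_map_linear.
End DirectSumMap.

Definition rep_dsum (V W : rep) : rep :=
  @Rep (fun i => (rep_space V i * rep_space W i)%type : vectType k)
    (fun a => dsum_map (rep_map V a) (rep_map W a)).

Definition rep_nonzero (V : rep) : Prop :=
  exists (i : vertex Q) (x : rep_space V i), x <> 0.

Definition rep_indecomposable (V : rep) : Prop :=
  rep_nonzero V /\
  ~ exists V1 V2, [/\ rep_nonzero V1, rep_nonzero V2 & rep_iso V (rep_dsum V1 V2)].

Definition finite_rep_type : Prop :=
  exists (n : nat) (X : 'I_n -> rep),
    forall V, rep_indecomposable V -> exists i, rep_iso V (X i).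

End Representations.

Section PathAlgebra.
Variables (k : fieldType) (Q : quiver).

Definition path_gen : Type := (vertex Q + arrow Q)%type.
Definition path_term : Type := aterm k path_gen.
Definition gen_e (i : vertex Q) : path_term := AGen k (inl i : path_gen).
Definition gen_a (a : arrow Q) : path_term := AGen k (inr a : path_gen).

Inductive path_alg_rel : path_term -> path_term -> Prop :=
| par_idem i : path_alg_rel (AMul (gen_e i) (gen_e i)) (gen_e i)
| par_orth i j : i <> j ->
    path_alg_rel (AMul (gen_e i) (gen_e j)) (AScal path_gen 0)
| par_target a :
    path_alg_rel (AMul (gen_e (target a)) (gen_a a)) (gen_a a)
| par_source a :
    path_alg_rel (AMul (gen_a a) (gen_e (source a))) (gen_a a)
| par_one :
    path_alg_rel (\big[@AAdd k path_gen/AScal path_gen 0]_(i : vertex Q) gen_e i)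
                 (AScal path_gen 1).

Definition path_alg : kalg k := presented_alg path_alg_rel.

End PathAlgebra.

(* Main.v *)
Require Import Defs.
From HB Require Import structures.
From mathcomp Require Import all_boot all_order all_algebra.
From mathcomp Require Import boolp classical_sets.
From mathcomp Require Import zify.

Set Implicit Arguments.
Unset Strict Implicit.
Unset Printing Implicit Defensive.

Import GRing.Theory.
Local Open Scope ring_scope.

(* Since kQ is hereditary, every non-split self-extension of a module X extends
   to modules X[t]/(t^n) for all n; these are indecomposable when X is a brick.
   Hence, in finite representation type, bricks have no self-extensions, and by
   Ringel's argument (a minimal indecomposable with self-extensions is a brick)
   no indecomposable does. A long walk in Q would also give an indecomposable of
   large dimension, so paths have bounded length and finitely generated modules
   are finite-dimensional. In particular Ext^1(M, M) = 0.
   For a lift N over S, k (x)_S N = M forces N to have an S-basis reducing to a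
   given k-basis of M. The operator comparing two lifts, u |-> A u - u A', is
   surjective modulo the maximal ideal because Ext^1(M, M) = 0, hence surjective
   by Nakayama's lemma, and its kernel contains an element reducing to 1: all
   lifts over S are isomorphic. So the deformation functor is a point, and it is
   represented by k. *)

(** * Modules over a quiver and vanishing of self-extensions *)

(** Heredity enters through one explicit complex: graded maps [u] are sent to the families
    [u f_a - g_a u] indexed by the arrows, and the cokernel is Ext^1. There is no third term,
    because the arrows satisfy no relations. Hence any cocycle [g] deforms a module by letting [a]
    act as [a + t g_a] to every order in [t], and cocycles extend along injections without
    obstruction. The field is arbitrary, so a brick has a division ring of endomorphisms rather than
    the scalars alone; the arguments invert endomorphisms where one might divide by a scalar. Over
    [S] two difficulties shape the proof. A lift is free on an arbitrary set, whose finiteness has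
    to be read off from the reduction. And the vertex idempotents of two lifts agree only modulo the
    maximal ideal, so they are compared together with the arrows, by the same complex taken between
    two different families of matrices. *)

Lemma ex_argmin (T : Type) (P : T -> Prop) (m : T -> nat) :
  (exists x, P x) -> exists2 x, P x & forall y, P y -> (m x <= m y)%N.
Proof.
move=> [x0 Px0].
have ex : exists n, `[< exists2 x, P x & m x = n >].
  by exists (m x0); apply/asboolP; exists x0.
case: (ex_minnP ex) => n /asboolP[x Px <-] min.
by exists x => // y Py; apply: min; apply/asboolP; exists y.
Qed.

Section QuiverModules.
Variables (k : fieldType) (Q : quiver).

(* The total space of a representation, with the vertex idempotents and the
   arrows as endomorphisms. *)
Record qmod := QMod {
  qsp :> vectType k;
  qe : vertex Q -> 'End(qsp);
  qa : arrow Q -> 'End(qsp);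
  qeE : forall i j x, qe i (qe j x) = if i == j then qe j x else 0;
  qe_sum : forall x, \sum_i qe i x = x;
  qe_t : forall a x, qe (target a) (qa a x) = qa a x;
  qa_s : forall a x, qa a (qe (source a) x) = qa a x }.
Arguments qe : clear implicits.
Arguments qa : clear implicits.

Definition graded (V W : qmod) (f : 'Hom(V, W)) :=
  forall i x, f (qe V i x) = qe W i (f x).

Definition qhom (V W : qmod) (f : 'Hom(V, W)) :=
  graded f /\ forall a x, f (qa V a x) = qa W a (f x).

(** An element of the product over [a] of Hom(V_{s(a)}, W_{t(a)}), each factor extended by zero to
    the total spaces. This support condition is the only one. *)
Definition cocycle (V W : qmod) (g : arrow Q -> 'Hom(V, W)) :=
  forall a x, qe W (target a) (g a x) = g a x /\ g a (qe V (source a) x) = g a x.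

(* Ext^1(V, W) = 0 *)
Definition ext0 (V W : qmod) := forall g : arrow Q -> 'Hom(V, W), cocycle g ->
  exists2 u : 'Hom(V, W), graded u &
    forall a x, u (qa V a x) - qa W a (u x) = g a x.

(** Idempotent endomorphisms stand for direct sum decompositions, so that no complement has to be
    constructed. *)
Definition qindec (V : qmod) := (exists x : V, x != 0) /\
  forall e : 'End(V), qhom e -> (forall x, e (e x) = e x) ->
    e = 0 \/ e = \1%VF.

(** In finite dimension injective endomorphisms are invertible, so this says that the endomorphism
    ring is a division ring. *)
Definition brick (V : qmod) := (exists x : V, x != 0) /\
  forall f : 'End(V), qhom f -> f != 0 -> injective f.

Lemma qhom_comp (U V W : qmod) (f : 'Hom(V, W)) (g : 'Hom(U, V)) :
  qhom f -> qhom g -> qhom (f \o g)%VF.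
Proof.
by move=> [fe fa] [ge ga]; split=> i x; rewrite !comp_lfunE ?ge ?fe ?ga ?fa.
Qed.

Lemma qhom_id (V : qmod) : qhom (\1%VF : 'End(V)).
Proof. by split=> i x; rewrite !id_lfunE. Qed.

Lemma qhom_sub (V W : qmod) (f g : 'Hom(V, W)) :
  qhom f -> qhom g -> qhom (f - g).
Proof.
move=> [fe fa] [ge ga]; split=> i x.
  by rewrite !add_lfunE !opp_lfunE fe ge linearB.
by rewrite !add_lfunE !opp_lfunE fa ga linearB.
Qed.

Section GradedPart.
Variables (V W : qmod) (f : 'Hom(V, W)).

(** The projection of all linear maps onto the graded ones. A one-sided inverse supplied by linear
    algebra need not be graded; its graded part is, and is still a one-sided inverse of a graded
    map. *)
Definition gpart : 'Hom(V, W) := \sum_i (qe W i \o f \o qe V i)%VF.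

Lemma gpartE x : gpart x = \sum_i qe W i (f (qe V i x)).
Proof. by rewrite sum_lfunE; apply: eq_bigr => i _; rewrite !comp_lfunE. Qed.

Lemma gpart_graded : graded gpart.
Proof.
move=> i x; rewrite !gpartE linear_sum; apply: eq_bigr => j _.
rewrite [qe V j _]qeE [RHS]qeE; case: eqVneq => [->//|_].
by rewrite !linear0.
Qed.
End GradedPart.

Lemma gpart_retract (V W : qmod) (f : 'Hom(V, W)) (g : 'Hom(W, V)) :
  graded f -> cancel f g -> cancel f (gpart g).
Proof.
move=> fe fg x; rewrite gpartE -[RHS]qe_sum; apply: eq_bigr => i _.
by rewrite -fe fg qeE eqxx.
Qed.

Lemma gpart_section (V W : qmod) (f : 'Hom(V, W)) (g : 'Hom(W, V)) :
  graded f -> cancel g f -> cancel (gpart g) f.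
Proof.
move=> fe fg x; rewrite gpartE linear_sum -[RHS]qe_sum; apply: eq_bigr => i _.
by rewrite /= fe fg qeE eqxx.
Qed.

Definition qstable (V : qmod) (U : {vspace V}) :=
  (forall i x, x \in U -> qe V i x \in U) /\
  (forall a x, x \in U -> qa V a x \in U).

Section Submodule.
Variables (V : qmod) (U : {vspace V}).
Hypothesis stU : qstable U.

Let res (f : 'End(V)) : 'End(subvs_of U) := linfun (vsproj U \o f \o vsval).
Let resE (f : 'End(V)) x : (forall y, y \in U -> f y \in U) ->
  vsval (res f x) = f (vsval x).
Proof. by move=> fU; rewrite lfunE /= vsprojK // fU ?subvsP. Qed.
Let eE i x : vsval (res (qe V i) x) = qe V i (vsval x).
Proof. by apply: resE; apply: stU.1. Qed.
Let aE a x : vsval (res (qa V a) x) = qa V a (vsval x).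
Proof. by apply: resE; apply: stU.2. Qed.

Definition qsub : qmod.
Proof.
refine (@QMod (subvs_of U) (fun i => res (qe V i)) (fun a => res (qa V a))
  _ _ _ _).
- move=> i j x; apply: subvs_inj; rewrite !eE qeE.
  by case: eqP; rewrite ?eE ?linear0.
- move=> x; apply: subvs_inj; rewrite linear_sum -[RHS]qe_sum.
  by apply: eq_bigr => i _; exact: eE.
- by move=> a x; apply: subvs_inj; rewrite !(eE, aE) qe_t.
- by move=> a x; apply: subvs_inj; rewrite !(eE, aE) qa_s.
Defined.

Definition qsub_inc : 'Hom(qsub, V) := linfun (vsval : subvs_of U -> V).

Lemma qsub_incE x : qsub_inc x = vsval (x : subvs_of U).
Proof. by rewrite lfunE. Qed.

Lemma qsub_inc_hom : qhom qsub_inc.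
Proof. by split=> i x; rewrite !qsub_incE ?eE ?aE. Qed.

Lemma qsub_inc_inj : injective qsub_inc.
Proof. by move=> x y; rewrite !qsub_incE => /subvs_inj. Qed.
End Submodule.

Lemma submodule_exists (V : qmod) (U : {vspace V}) : qstable U ->
  exists (K : qmod) (j : 'Hom(K, V)),
    [/\ qhom j, injective j & forall x, (x \in U) <-> exists y, j y = x].
Proof.
move=> st; exists (qsub st), (qsub_inc st).
split; [exact: qsub_inc_hom|exact: qsub_inc_inj|] => x; split.
  by move=> xU; exists (Subvs xU); rewrite qsub_incE.
by case=> y <-; rewrite qsub_incE subvsP.
Qed.

Lemma inj_cancel (U W : vectType k) (f : 'Hom(U, W)) :
  injective f -> cancel f (f^-1)%VF.
Proof. by move=> /lker0P; apply: lker0_lfunK. Qed.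

Lemma surj_cancel (U W : vectType k) (f : 'Hom(U, W)) :
  (forall y, exists x, f x = y) -> cancel (f^-1)%VF f.
Proof.
by move=> fs y; apply: limg_lfunVK; case: (fs y) => x <-; rewrite memv_img ?memvf.
Qed.

Lemma factor_inj (U V W : qmod) (j : 'Hom(U, V)) (f : 'Hom(W, V)) :
  qhom j -> injective j -> qhom f -> (forall x, exists y, j y = f x) ->
  exists2 g : 'Hom(W, U), qhom g & forall x, j (g x) = f x.
Proof.
move=> [je ja] jinj [fe fa] fj; exists (j^-1 \o f)%VF; last first.
  by move=> x; rewrite comp_lfunE; case: (fj x) => y <-; rewrite inj_cancel.
have gE x : j ((j^-1 \o f)%VF x) = f x.
  by rewrite comp_lfunE; case: (fj x) => y <-; rewrite inj_cancel.
by split=> i x; apply: jinj; rewrite gE ?fe ?fa ?je ?ja gE.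
Qed.

Lemma lker_stable (V W : qmod) (f : 'Hom(V, W)) : qhom f -> qstable (lker f).
Proof.
move=> [fe fa]; split=> i x; rewrite !memv_ker ?fe ?fa => /eqP->;
by rewrite linear0.
Qed.

Lemma limg_stable (V W : qmod) (f : 'Hom(V, W)) : qhom f -> qstable (limg f).
Proof.
move=> [fe fa]; split=> i x /memv_imgP[y _ ->].
  by rewrite -fe memv_img ?memvf.
by rewrite -fa memv_img ?memvf.
Qed.

Lemma dim_inj (U W : vectType k) (f : 'Hom(U, W)) :
  injective f -> \dim (limg f) = \dim {:U}.
Proof. by move=> /lker0P/eqP E; rewrite limg_dim_eq // E capv0. Qed.

Lemma inj_dim (U W : vectType k) (f : 'Hom(U, W)) :
  (\dim {:U} <= \dim (limg f))%N -> injective f.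
Proof.
move=> le; apply/lker0P; rewrite -dimv_eq0 -leqn0.
by rewrite -(leq_add2r (\dim (limg f))) -[X in (X + _)%N]/(\dim (lker f)) add0n
  -{1}[lker f]capfv limg_ker_dim.
Qed.


(** * Endomorphisms of minimal rank and Ringel's argument *)

Section MinimalRank.
Variables (X : qmod) (th : 'End(X)).
Hypotheses (Xid : qindec X) (thh : qhom th).

(** By dimension the module is the direct sum of image and kernel, both submodules, so the
    projection [p] onto the image is an idempotent endomorphism, hence 0 or 1. *)
Lemma qindec_fitting : (limg th :&: lker th = 0)%VS -> th = 0 \/ injective th.
Proof.
move=> kI; have [Xn0 Xi] := Xid.
have kS : (limg th + lker th = fullv)%VS.
  apply/eqP; rewrite eqEdim subvf /= dimv_disjoint_sum //.
  by rewrite -{1}(limg_ker_dim th fullv) capfv addnC.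
pose p := daddv_pi (limg th) (lker th).
have pE u v : u \in limg th -> v \in lker th -> p (u + v) = u.
  move=> uI vK; rewrite linearD /= [p u]daddv_pi_id //.
  have kI' : (lker th :&: limg th = 0)%VS by rewrite capvC.
  have := daddv_pi_add kI (memv_add (mem0v (limg th)) vK).
  rewrite add0r [X in _ + X]daddv_pi_id // => /(canRL (addrK _)).
  by rewrite subrr => ->; rewrite addr0.
have dec x : exists2 u, u \in limg th & exists2 v, v \in lker th & x = u + v.
  by apply/memv_addP; rewrite kS memvf.
have [sK1 sK2] := lker_stable thh; have [sI1 sI2] := limg_stable thh.
have ph : qhom p.
  split=> i x; have [u uI [v vK ->]] := dec x.
    by rewrite [qe _ _ _]linearD /= !pE ?sI1 ?sK1.
  by rewrite [qa _ _ _]linearD /= !pE ?sI2 ?sK2.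
have pp x : p (p x) = p x.
  by have [u uI [v vK ->]] := dec x; rewrite pE // -[X in p X]addr0 pE ?mem0v.
have pI y : p (th y) = th y.
  by rewrite -[X in p X]addr0 pE ?mem0v ?memv_img ?memvf.
have [p0|p1] := Xi p ph pp.
  by left; apply/lfunP => y; rewrite -pI p0 !zero_lfunE.
right; apply: inj_dim; apply/dimvS/subvP => y _.
by rewrite -[y]id_lfunE -p1; exact: memv_pi.
Qed.

Hypothesis thn : th != 0.
Hypothesis thni : ~ injective th.
Hypothesis thmin : forall f : 'End(X), qhom f -> f != 0 ->
  (\dim (limg th) <= \dim (limg f))%N.

(** If the square were nonzero, it would have at least the rank of [th], so [th] would be injective
    on its image. Then image and kernel meet in 0, and [qindec_fitting] makes [th] zero or
    injective. *)
Lemma min_rank_square_zero x : th (th x) = 0.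
Proof.
have [/eqP/lfunP E|n0] := boolP ((th \o th)%VF == 0).
  by have := E x; rewrite comp_lfunE zero_lfunE.
have := thmin (qhom_comp thh thh) n0; rewrite limg_comp => le.
have kI : (limg th :&: lker th = 0)%VS.
  apply/eqP; rewrite -dimv_eq0 -leqn0.
  by rewrite -(leq_add2r (\dim (th @: limg th))) limg_ker_dim add0n.
by case: (qindec_fitting kI) => // /eqP; rewrite (negPf thn).
Qed.
End MinimalRank.

(* Y has minimal dimension among the summands of K on which j does not vanish. *)
Lemma indec_summand (I K : qmod) (j : 'Hom(I, K)) : j != 0 ->
  exists (Y : qmod) (y : 'Hom(Y, K)) (q : 'Hom(K, Y)),
    [/\ qindec Y, qhom y, qhom q, cancel y q & (q \o j)%VF != 0].
Proof.
move=> j0.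
pose P (f : 'End(K)) := [/\ qhom f, forall x, f (f x) = f x & (f \o j)%VF != 0].
have P1 : P \1%VF.
  by split; [exact: qhom_id|move=> x; rewrite id_lfunE|rewrite comp_lfun1l].
have [pi [pih pipi pij] pimin] :=
  @ex_argmin _ P (fun f => \dim (limg f)) (ex_intro _ _ P1).
have [Y [y [yh yinj yP]]] := submodule_exists (limg_stable pih).
have [q qh qE] : exists2 q : 'Hom(K, Y), qhom q & forall x, y (q x) = pi x.
  by apply: factor_inj => // x; apply/yP; rewrite memv_img ?memvf.
have qy : cancel y q.
  move=> x; apply: yinj; rewrite qE.
  by have /yP/memv_imgP[z _ ->] : exists z, y z = y x by exists x.
have dimY : \dim (limg pi) = \dim {:Y}.
  rewrite -(dim_inj yinj); congr (\dim _); apply/vspaceP => x.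
  apply/idP/idP => [/yP[z <-]|/memv_imgP[z _ ->]]; first by rewrite memv_img ?memvf.
  by apply/yP; exists z.
have qj0 : (q \o j)%VF != 0.
  apply: contraNneq pij => /lfunP E; apply/eqP/lfunP => x.
  by have := E x; rewrite !comp_lfunE !zero_lfunE -qE => ->; rewrite linear0.
exists Y, y, q; split=> //.
(* Such an [e] gives the competitor [y e q] of [pi]; minimality of the rank makes [e] injective, and
   an injective idempotent is the identity. *)
have half e : qhom e -> (forall x, e (e x) = e x) -> (e \o q \o j)%VF != 0 ->
    e = \1%VF :> 'End(Y).
  move=> eh ee ne0.
  have Pe : P (y \o (e \o q))%VF.
    split; first by do ?apply: qhom_comp.
      by move=> x; rewrite !comp_lfunE qy ee.
    apply: contraNneq ne0 => /lfunP E; apply/eqP/lfunP => x; apply: yinj.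
    by have := E x; rewrite !comp_lfunE !zero_lfunE linear0.
  have le := pimin _ Pe; rewrite dimY in le.
  have einj : injective e.
    apply: inj_dim; apply: (leq_trans le); rewrite limg_comp.
    apply: (@leq_trans (\dim (limg (e \o q)%VF))).
      by rewrite -[leqRHS](limg_ker_dim y) leq_addl.
    by rewrite limg_comp dimvS // limgS ?subvf.
  by apply/lfunP => x; apply: einj; rewrite id_lfunE ee.
split.
  apply: contrapT => nY; case/eqP: qj0; apply/lfunP => x.
  rewrite zero_lfunE; apply: contrapT => /eqP ne.
  by apply: nY; exists ((q \o j)%VF x).
(* As [q j] is nonzero, [e] and [1 - e] cannot both kill it, so [half] applies to one of them. *)
move=> e eh ee; have [e0|] := eqVneq (e \o q \o j)%VF 0; last first.
  by right; apply: half.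
left; suff E : \1%VF - e = \1%VF :> 'End(Y) by rewrite -[e](subKr \1%VF) E subrr.
apply: half; first exact: qhom_sub (qhom_id Y) eh.
  by move=> x; rewrite !add_lfunE !opp_lfunE !id_lfunE linearB /= ee subrr subr0.
by rewrite -comp_lfunA comp_lfunDl comp_lfun1l comp_lfunNl comp_lfunA e0 subr0.
Qed.

(** Right exactness of Ext^1: a cocycle on [U] extends to [V] by composing with a graded retraction
    [P] of [f], and a solution on [V] restricts to [U]. *)
Lemma ext0_sub (U V W : qmod) (f : 'Hom(U, V)) :
  qhom f -> injective f -> ext0 V W -> ext0 U W.
Proof.
move=> [fe fa] finj extV g gP.
pose P := gpart (f^-1)%VF.
have Pf : cancel f P by apply: gpart_retract => //; exact: inj_cancel.
have [|u ue uE] := extV (fun a => g a \o P)%VF.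
  move=> a x; rewrite !comp_lfunE gpart_graded; have [-> _] := gP a (P x).
  by have [_ ->] := gP a (P x).
exists (u \o f)%VF => [i x|a x]; first by rewrite !comp_lfunE fe ue.
by rewrite !comp_lfunE fa uE comp_lfunE Pf.
Qed.

(* Pushing the extension 0 -> K -> X -> I -> 0 out along q : K -> Y. *)
Lemma ext0_extend (K X I Y : qmod) (i : 'Hom(K, X)) (p : 'Hom(X, I))
    (q : 'Hom(K, Y)) :
  qhom i -> injective i -> qhom p -> (forall y, exists x, p x = y) ->
  (forall x, p x = 0 <-> exists y, i y = x) -> qhom q -> ext0 I Y ->
  exists2 r : 'Hom(X, Y), qhom r & forall x, r (i x) = q x.
Proof.
move=> [ie ia] iinj [pe pa] psurj ker [qe' qa'] extIY.
pose P := gpart (i^-1)%VF.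
have Pi : cancel i P by apply: gpart_retract => //; exact: inj_cancel.
pose s := gpart (p^-1)%VF.
have ps : cancel s p by apply: gpart_section => //; exact: surj_cancel.
pose rho := (q \o P)%VF.
have rhoe : graded rho by move=> l x; rewrite !comp_lfunE gpart_graded qe'.
(* The graded map [rho] extends [q], and [d] is its failure to commute with the arrows. It vanishes
   on [K], so it descends to a cocycle on [I]; a solution [u] there corrects [rho] without changing
   it on [K]. *)
pose d a : 'Hom(X, Y) := (rho \o qa X a)%VF - (qa Y a \o rho)%VF.
have dE a x : d a x = rho (qa X a x) - qa Y a (rho x).
  by rewrite add_lfunE opp_lfunE !comp_lfunE.
have dker a x : p x = 0 -> d a x = 0.
  case/ker => y <-; rewrite dE -ia !comp_lfunE !Pi qa' subrr //.
have ds a x : d a (s (p x)) = d a x.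
  apply/eqP; rewrite -subr_eq0 -linearB; apply/eqP/dker.
  by rewrite linearB /= ps subrr.
have [|u ue uE] := extIY (fun a => d a \o s)%VF.
  move=> a x; rewrite !comp_lfunE gpart_graded -/s !dE; split.
    by rewrite linearB /= qe_t -rhoe qe_t.
  by rewrite qa_s rhoe qa_s.
exists (rho - (u \o p)%VF).
  split=> [l x|a x]; rewrite !add_lfunE !opp_lfunE !(comp_lfunE u).
    by rewrite rhoe pe ue linearB.
  have := uE a (p x); rewrite comp_lfunE ds dE -pa => /(canRL (subrK _)) ->.
  by rewrite [RHS]linearB /= opprD opprB addrA [X in X - _]addrC subrK.
move=> x; rewrite add_lfunE opp_lfunE !comp_lfunE Pi.
have -> : p (i x) = 0 by apply/ker; exists x.
by rewrite linear0 subr0.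
Qed.

(* Ringel: a nonzero endomorphism of minimal rank has square zero, so its image
   I lies in its kernel K; if Y is an indecomposable summand of K that I maps to
   nontrivially, then Ext^1(Y, Y) maps onto Ext^1(I, Y), and the latter is not
   zero because Y is not a summand of the whole module. *)
Lemma non_brick (X : qmod) : qindec X -> ~ brick X ->
  exists Y : qmod, [/\ qindec Y, ~ ext0 Y Y & (\dim {:Y} < \dim {:X})%N].
Proof.
move=> Xid nb; have [Xn0 Xi] := Xid.
have [th0 [th0h th0n th0i]] :
    exists f : 'End(X), [/\ qhom f, f != 0 & ~ injective f].
  apply: contrapT => nex; apply: nb; split=> // f fh f0.
  by apply: contrapT => ni; apply: nex; exists f.
have [th [thh thn] thmin'] := @ex_argmin _
  (fun f : 'End(X) => qhom f /\ f != 0) (fun f => \dim (limg f))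
  (ex_intro _ th0 (conj th0h th0n)).
have thmin (f : 'End(X)) : qhom f -> f != 0 -> (\dim (limg th) <= \dim (limg f))%N.
  by move=> fh f0; exact: thmin' (conj fh f0).
have thni : ~ injective th.
  move=> /dim_inj E; apply: th0i; apply: inj_dim; rewrite -E; exact: thmin.
have th2 := min_rank_square_zero Xid thh thn thni thmin.
have [K [i [ih iinj iP]]] := submodule_exists (lker_stable thh).
have [I [i' [i'h i'inj i'P]]] := submodule_exists (limg_stable thh).
have [p ph pE] : exists2 p : 'Hom(X, I), qhom p & forall x, i' (p x) = th x.
  by apply: factor_inj => // x; apply/i'P; rewrite memv_img ?memvf.
have [j jh jE] : exists2 j : 'Hom(I, K), qhom j & forall x, i (j x) = i' x.
  apply: factor_inj => // x; apply/iP; rewrite memv_ker.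
  have /i'P/memv_imgP[y _ ->] : exists y, i' y = i' x by exists x.
  by rewrite th2.
have psurj y : exists x, p x = y.
  have /i'P/memv_imgP[x _ E] : exists z, i' z = i' y by exists y.
  by exists x; apply: i'inj; rewrite pE E.
have j0 : j != 0.
  apply: contraNneq thn => j0; apply/eqP/lfunP => x.
  by rewrite zero_lfunE -pE -jE j0 zero_lfunE linear0.
have [Y [y [q [Yid yh qh qy qj0]]]] := indec_summand j0.
have yinj := can_inj qy.
have ker x : p x = 0 <-> exists z, i z = x.
  rewrite -iP memv_ker -pE; split=> [->|/eqP px]; first by rewrite linear0.
  by apply: i'inj; rewrite px linear0.
(* The composite [X -> I -> K -> Y -> K -> X] is a nonzero endomorphism, so its rank is at least
   that of [th], which is the dimension of [I]. Nothing can be lost along [q j]. *)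
have qjinj : injective (q \o j)%VF.
  apply: inj_dim; pose f := (i \o (y \o ((q \o j) \o p)))%VF.
  have fh : qhom f by do ?apply: qhom_comp.
  have f0 : f != 0.
    apply: contraNneq qj0 => E; apply/eqP/lfunP => x.
    have [z <-] := psurj x; apply: yinj; apply: iinj.
    by rewrite zero_lfunE !linear0 -(zero_lfunE X z) -E !comp_lfunE.
  have := thmin _ fh f0; rewrite -[limg f]/(limg (i \o _)%VF) !limg_comp.
  rewrite (_ : limg p = fullv); last first.
    by apply/vspaceP => x; have [z <-] := psurj x; rewrite memvf memv_img ?memvf.
  move=> le; rewrite -(dim_inj i'inj).
  apply: (@leq_trans (\dim (limg th))); first apply/dimvS/subvP => x.
    by case/memv_imgP=> z _ ->; apply/i'P; exists z.
  apply: (leq_trans le); apply: (@leq_trans (\dim (y @: (q @: (j @: fullv))))).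
    by rewrite -[leqRHS](limg_ker_dim i) leq_addl.
  by rewrite -[leqRHS](limg_ker_dim y) leq_addl.
exists Y; split=> //; last first.
  apply: (@leq_ltn_trans (\dim (limg i))).
    rewrite (dim_inj iinj) -(dim_inj yinj); exact/dimvS/subvf.
  rewrite ltn_neqAle dimvS ?subvf // andbT.
  apply: contraNneq thn => E; apply/eqP/lfunP => x; rewrite zero_lfunE.
  have /memv_imgP[z _ ->] : x \in limg i.
    by have/eqP-> : (limg i == fullv)%VS; rewrite ?memvf // eqEdim subvf E leqnn.
  by rewrite -pE; have/ker-> : exists w, i w = i z; [exists z|rewrite linear0].
(* If Ext^1(Y, Y) vanished, so would Ext^1(I, Y), and [q] would extend to [r] on [X]. Then [i y r]
   is an idempotent of [X]: it is not 0 because [Y] is nonzero, and not 1 because its image lies in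
   the kernel of [th]. *)
move=> extY; have extIY := ext0_sub (qhom_comp qh jh) qjinj extY.
have [r rh rE] := ext0_extend ih iinj ph psurj ker qh extIY.
pose e := (i \o (y \o r))%VF.
have eE x : e x = i (y (r x)) by rewrite !comp_lfunE.
have eh : qhom e by do ?apply: qhom_comp.
have ee x : e (e x) = e x by rewrite !eE rE qy.
case: (Xi e eh ee) => E.
  have [[z /eqP z0] _] := Yid; apply: z0.
  apply: yinj; apply: iinj; rewrite !linear0 -(zero_lfunE X (i (y z))) -E eE.
  by rewrite rE qy.
case/eqP: thn; apply/lfunP => x; rewrite zero_lfunE -pE.
suff /ker-> : exists w, i w = x by rewrite linear0.
by exists (y (r x)); rewrite -eE E id_lfunE.
Qed.
End QuiverModules.
Arguments qe {k Q} q.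
Arguments qa {k Q} q.

(** * Iterated self-extensions of a brick *)

Section Tower.
Variables (k : fieldType) (Q : quiver) (X : qmod k Q).
Variable g : arrow Q -> 'End(X).
Hypothesis gP : cocycle g.
Variable n : nat.

(* The iterated self-extension of X by g: X[t]/(t^n.+1), with every arrow a
   acting by a + t g_a. *)
Local Notation T := {ffun 'I_n.+1 -> X}.

Definition tower_e i (x : T) : T := [ffun l => qe X i (x l)].
Fact tower_e_linear i : linear (tower_e i).
Proof. by move=> c x y; apply/ffunP=> l; rewrite !ffunE linearP. Qed.
HB.instance Definition _ i :=
  GRing.isLinear.Build k T T _ (tower_e i) (tower_e_linear i).

(** The sum has a single term, for [m = l - 1], and is empty for [l = 0]: this is multiplication by
    [t], truncated at the top. *)
Definition tower_a a (x : T) : T :=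
  [ffun l : 'I_n.+1 => qa X a (x l) +
     \sum_(m < n.+1 | m.+1 == l :> nat) g a (x m)].
Fact tower_a_linear a : linear (tower_a a).
Proof.
move=> c x y; apply/ffunP=> l; rewrite !ffunE linearP scalerDr addrACA.
congr (_ + _); rewrite scaler_sumr -big_split /=; apply: eq_bigr => m _.
by rewrite !ffunE linearP.
Qed.
HB.instance Definition _ a :=
  GRing.isLinear.Build k T T _ (tower_a a) (tower_a_linear a).

Definition tower : qmod k Q.
Proof.
refine (@QMod k Q T (fun i => linfun (tower_e i)) (fun a => linfun (tower_a a))
  _ _ _ _).
- move=> i j x; rewrite !lfunE; apply/ffunP=> l; rewrite !ffunE qeE.
  by case: eqP => _; rewrite !ffunE.
- move=> x; apply/ffunP=> l; rewrite sum_ffunE -[RHS]qe_sum.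
  by apply: eq_bigr => i _; rewrite lfunE ffunE.
- move=> a x; rewrite !lfunE; apply/ffunP=> l; rewrite !ffunE linearD /= qe_t.
  rewrite linear_sum; congr (_ + _); apply: eq_bigr => m _.
  by have [] := gP a (x m).
- move=> a x; rewrite !lfunE; apply/ffunP=> l; rewrite !ffunE qa_s.
  congr (_ + _); apply: eq_bigr => m _; rewrite ffunE.
  by have [] := gP a (x m).
Defined.

Lemma tower_eE i (x : tower) l : qe tower i x l = qe X i (x l).
Proof. by rewrite lfunE ffunE. Qed.

Lemma tower_aE a (x : tower) (l : 'I_n.+1) : qa tower a x l =
  qa X a (x l) + \sum_(m < n.+1 | m.+1 == l :> nat) g a (x m).
Proof. by rewrite lfunE ffunE. Qed.

Definition tower_in (l : 'I_n.+1) (y : X) : tower :=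
  [ffun m => if m == l then y else 0].
Fact tower_in_linear l : linear (tower_in l).
Proof.
move=> c x y; apply/ffunP=> m; rewrite !ffunE; case: eqP => // _.
by rewrite scaler0 addr0.
Qed.
HB.instance Definition _ l :=
  GRing.isLinear.Build k X tower _ (tower_in l) (tower_in_linear l).

Lemma tower_inE (x : tower) : x = \sum_l tower_in l (x l).
Proof.
apply/ffunP => m; rewrite sum_ffunE (bigD1 m) //= ffunE eqxx big1 ?addr0 // => l.
by rewrite ffunE eq_sym => /negPf->.
Qed.

Lemma qe_tower_in i l y : qe tower i (tower_in l y) = tower_in l (qe X i y).
Proof.
apply/ffunP=> m; rewrite tower_eE !ffunE; case: eqP => // _.
by rewrite linear0.
Qed.

Lemma qa_tower_in a (l : 'I_n.+1) y : qa tower a (tower_in l y) =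
  tower_in l (qa X a y) +
    \sum_(m < n.+1 | l.+1 == m :> nat) tower_in m (g a y).
Proof.
apply/ffunP=> m; rewrite tower_aE !ffunE sum_ffunE; congr (_ + _).
  by case: eqP => // _; rewrite linear0.
under [RHS]eq_bigr do rewrite ffunE.
rewrite big_mkcond [RHS]big_mkcond /= (bigD1 l) //= [RHS](bigD1 m) //=.
rewrite !ffunE !eqxx [X in _ + X]big1 ?[X in _ = _ + X]big1 // => j jne.
  by rewrite [m == j]eq_sym (negPf jne) if_same.
by rewrite ffunE (negPf jne) linear0 if_same.
Qed.

Hypothesis Xbrick : brick X.
Hypothesis gN : ~ exists2 u : 'End(X), graded u &
  forall a x, u (qa X a x) - qa X a (u x) = g a x.

(** The restriction of [h] to the highest layer on which it does not vanish is an endomorphism of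
    the brick. If this layer is not layer 0, inverting that endomorphism makes [g] a coboundary. *)
Lemma tower_hom (h : 'Hom(tower, X)) : qhom h ->
  exists2 c : 'End(X), qhom c & forall x : tower, h x = c (x ord0).
Proof.
move=> [he ha]; pose hl (l : 'I_n.+1) : 'End(X) := linfun (h \o tower_in l).
have hlE l y : hl l y = h (tower_in l y) by rewrite lfunE.
have hle l : graded (hl l) by move=> i y; rewrite !hlE -qe_tower_in he.
have hla l a y : hl l (qa X a y) + \sum_(m < n.+1 | l.+1 == m :> nat) hl m (g a y)
    = qa X a (hl l y).
  rewrite !hlE -ha qa_tower_in linearD linear_sum; congr (_ + _).
  by apply: eq_bigr => m _; rewrite hlE.
have hl_hom (l : 'I_n.+1) : (forall m : 'I_n.+1, (l < m)%N -> hl m = 0) -> qhom (hl l).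
  move=> hl0; split=> // a y; rewrite -hla big1 ?addr0 // => m /eqP lm.
  by rewrite hl0 ?zero_lfunE // -lm.
have hl0 (l : 'I_n.+1) : (0 < l)%N -> hl l = 0.
  have [d] := ubnP (n - l)%N; elim: d l => // d IHd l ld l0.
  have [hh ah] : qhom (hl l).
    apply: hl_hom => m lm; apply: IHd; last exact: leq_trans lm.
    by have := ltn_ord m; lia.
  apply: contrapT => /eqP ne0; apply: gN.
  have inj := Xbrick.2 _ (conj hh ah) ne0.
  have iK := inj_cancel inj.
  have Ki : cancel (hl l)^-1%VF (hl l) by apply: lker0_lfunVK; apply/lker0P.
  have lt : (l.-1 < n.+1)%N by rewrite (leq_ltn_trans (leq_pred l)).
  pose l' := Ordinal lt.
  (* The relation [hla] at layer [l - 1], which exists because [l > 0], contains [hl l (g a y)] and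
     can be solved for [g]. *)
  exists (- ((hl l)^-1 \o hl l')%VF) => [i x|a x].
    rewrite !opp_lfunE !comp_lfunE hle linearN /=; congr (- _).
    by apply: inj; rewrite hh !Ki.
  rewrite !opp_lfunE !comp_lfunE linearN /= opprK; apply: inj.
  rewrite linearD linearN /= ah !Ki -hla addKr (big_pred1 l) // => m /=.
  by rewrite prednK // eq_sym.
have c0 : qhom (hl ord0) by apply: hl_hom => m; exact: hl0.
exists (hl ord0) => // x; rewrite {1}[x]tower_inE linear_sum /= (bigD1 ord0) //=.
rewrite big1 ?addr0 -?hlE // => l; rewrite -hlE -val_eqE /= -lt0n => l0.
by rewrite hl0 ?zero_lfunE.
Qed.

(** An arrow mixes component [l] only with component [l - 1], so the first component of [e] that may
    be nonzero is a homomorphism to [X], to which [tower_hom] applies. *)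
Lemma tower_proj_hom (e : 'End(tower)) (l : 'I_n.+1) : qhom e ->
    (forall m : 'I_n.+1, (m < l)%N -> forall x, (e x : tower) m = 0) ->
  exists2 c : 'End(X), qhom c & forall x : tower, e x l = c (x ord0).
Proof.
move=> [ee ea] el.
have plin : linear (fun x : tower => e x l).
  by move=> c x y; rewrite linearP !ffunE.
pose p : {linear tower -> X} :=
  HB.pack (fun x : tower => e x l) (GRing.isLinear.Build _ _ _ _ _ plin).
have pE x : linfun p x = e x l by rewrite lfunE.
have ph : qhom (linfun p).
  split=> [i x|a x]; rewrite !pE ?ee ?tower_eE // ea tower_aE big1 ?addr0 //.
  by move=> m /eqP ml; rewrite el ?linear0 // -ml.
have [c ch cE] := tower_hom ph.
by exists c => // x; rewrite -cE pE.
Qed.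

(** By induction on [l], component [l] of [e x = e (e x)] depends only on component 0 of [e x],
    which is 0. *)
Lemma tower_idem0 (e : 'End(tower)) : qhom e -> (forall x, e (e x) = e x) ->
  (forall x, (e x : tower) ord0 = 0) -> e = 0.
Proof.
move=> eh ee e0.
suff el d (l : 'I_n.+1) : (l <= d)%N -> forall x, (e x : tower) l = 0.
  by apply/lfunP => x; apply/ffunP => l; rewrite (el n) ?leq_ord // zero_lfunE ffunE.
elim: d l => [|d IHd] l ld x.
  by rewrite (_ : l = ord0) //; apply/val_inj/eqP; rewrite -leqn0.
have [|c ch cE] := @tower_proj_hom e l eh.
  by move=> m ml y; apply: IHd; rewrite -ltnS (leq_trans ml).
by rewrite -ee cE e0 linear0.
Qed.

(** On component 0 an idempotent acts by an idempotent [c] of the brick, so [c] is 0 or 1, and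
    [tower_idem0] applies to [e] or to [1 - e]. *)
Lemma tower_indec : qindec tower.
Proof.
split.
  have [x x0] := Xbrick.1; exists (tower_in ord0 x).
  by apply: contraNneq x0 => /ffunP/(_ ord0); rewrite !ffunE eqxx => ->.
move=> e eh ee; have [//|c ch cE] := @tower_proj_hom e ord0 eh.
have cc (y : X) : c (c y) = c y.
  have := cE (e (tower_in ord0 y)); by rewrite ee !cE ffunE eqxx.
have [c0|c0] := eqVneq c 0.
  by left; apply: tower_idem0 => // x; rewrite cE c0 zero_lfunE.
right; have c1 (y : X) : c y = y by apply: (Xbrick.2 c ch c0); rewrite cc.
suff E : \1%VF - e = 0 by rewrite -[e](subKr \1%VF) E subr0.
apply: tower_idem0; first exact: qhom_sub (qhom_id _) eh.
  by move=> x; rewrite !add_lfunE !opp_lfunE !id_lfunE linearB /= ee subrr subr0.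
by move=> x; rewrite add_lfunE opp_lfunE id_lfunE !ffunE cE c1 subrr.
Qed.

Lemma tower_dim : (n < \dim {:tower})%N.
Proof.
rewrite dimvf [dim _](_ : _ = #|'I_n.+1| * dim X)%N // card_ord.
rewrite -{1}[n.+1]muln1 leq_mul2l /= lt0n -dimvf dimv_eq0; have [x x0] := Xbrick.1.
by apply: contraNneq x0 => E; rewrite -memv0 -E memvf.
Qed.
End Tower.

Section BoundedDimension.
Variables (k : fieldType) (Q : quiver).

Lemma bounded_ext0 (D : nat) :
  (forall V : qmod k Q, qindec V -> (\dim {:V} <= D)%N) ->
  forall V : qmod k Q, qindec V -> ext0 V V.
Proof.
move=> bd V Vid; apply: contrapT => Vext.
have [X [Xid Xext] Xmin] := @ex_argmin _
  (fun W : qmod k Q => qindec W /\ ~ ext0 W W) (fun W => \dim {:W})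
  (ex_intro _ V (conj Vid Vext)).
have [Xb|nb] := pselect (brick X); last first.
  have [Y [Yid Yext]] := non_brick Xid nb.
  by rewrite ltnNge Xmin.
apply: Xext => g gP; apply: contrapT => gN.
(* The tower over the brick [X] with [D + 1] layers exceeds the bound. *)
by have := bd _ (tower_indec gP D Xb gN); rewrite leqNgt tower_dim.
Qed.
End BoundedDimension.

(** * Bounded dimension in finite representation type *)

Section RepOf.
Variables (k : fieldType) (Q : quiver) (V : qmod k Q).

Definition qmod_rep : rep k Q := @Rep k Q
  (fun i => subvs_of (limg (qe V i)) : vectType k)
  (fun a => vsproj (limg (qe V (target a))) \o
    (qa V a \o (vsval : subvs_of (limg (qe V (source a))) -> V))).

Local Notation val i x := (vsval (x : subvs_of (limg (qe V i)))).

Lemma mem_limg_qe i x : qe V i x \in limg (qe V i).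
Proof. by rewrite memv_img ?memvf. Qed.

Lemma qe_val i j (x : rep_space qmod_rep j) :
  qe V i (val j x) = if i == j then val j x else 0.
Proof.
have /memv_imgP[y _ ->] := subvsP (x : subvs_of (limg (qe V j))).
by rewrite qeE.
Qed.

Lemma qmod_rep_mapE a x :
  val (target a) (rep_map qmod_rep a x) = qa V a (val (source a) x).
Proof. by rewrite /= vsprojK // -qe_t mem_limg_qe. Qed.

Definition vertex_comp i (x : V) : rep_space qmod_rep i :=
  vsproj (limg (qe V i)) (qe V i x).

Lemma vertex_compE i x : val i (vertex_comp i x) = qe V i x.
Proof. by rewrite vsprojK ?mem_limg_qe. Qed.

Lemma vertex_comp_val i x : vertex_comp i (val i x) = x.
Proof. by apply: subvs_inj; rewrite vertex_compE qe_val eqxx. Qed.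

Lemma vertex_comp_arrow a x :
  vertex_comp (target a) (qa V a x) = rep_map qmod_rep a (vertex_comp (source a) x).
Proof. by apply: subvs_inj; rewrite vertex_compE qmod_rep_mapE vertex_compE qe_t qa_s. Qed.

Lemma qmod_rep_dim : (\dim {:V} <= \sum_i \dim {:rep_space qmod_rep i})%N.
Proof.
have -> : (\sum_i \dim {:rep_space qmod_rep i} = \sum_i \dim (limg (qe V i)))%N.
  by apply: eq_bigr => i _; rewrite dimvf.
apply: leq_trans (dimv_leq_sum _ _ _); apply/dimvS/subvP => x _.
rewrite -[x]qe_sum; apply: memv_sumr => i _; exact: mem_limg_qe.
Qed.

Lemma qmod_rep_indec : qindec V -> rep_indecomposable qmod_rep.
Proof.
move=> [[x x0] Vid]; split.
  apply: contrapT => nz; case/eqP: x0; rewrite -[x]qe_sum big1 // => i _.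
  rewrite -vertex_compE; apply: contrapT => ne; apply: nz.
  by exists i, (vertex_comp i x) => E; apply: ne; rewrite E.
move=> [V1 [V2 [[i1 [y1 n1]] [i2 [y2 n2]] [u [ubij ua]]]]].
pose v i := ((linfun (u i))^-1)%VF.
have ui i : injective (linfun (u i)).
  by move=> y z; rewrite !lfunE; exact: bij_inj (ubij i) _ _.
have vu i y : v i (u i y) = y.
  by rewrite -[u i y]lfunE; exact: inj_cancel (ui i) _.
have uv i y : u i (v i y) = y.
  by have [w uw wu] := ubij i; rewrite -[y]wu vu.
have va a y : v (target a) (rep_map (rep_dsum V1 V2) a y) =
    rep_map qmod_rep a (v (source a) y).
  by rewrite -{1}[y]uv -ua vu.
(* The projection onto the first summand, carried over to the total space by [u] and its inverse
   [v]. It kills the copy of [y2] and fixes that of [y1], so it is neither 1 nor 0. *)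
pose c1 i (y : rep_space (rep_dsum V1 V2) i) : rep_space (rep_dsum V1 V2) i :=
  (y.1, 0).
pose f (x : V) : V := \sum_i val i (v i (c1 i (u i (vertex_comp i x)))).
have flin : linear f.
  move=> c x' y; rewrite /f scaler_sumr -big_split; apply: eq_bigr => i _ /=.
  rewrite -!linearP /=; congr (vsval (v i _)).
  rewrite /vertex_comp !linearP /c1; congr pair; rewrite /= ?scaler0 ?addr0 //.
pose e' : {linear V -> V} :=
  HB.pack f (GRing.isLinear.Build _ _ _ _ _ flin).
have eE x' : linfun e' x' = f x' by rewrite lfunE.
have fe j x' : f (qe V j x') = val j (v j (c1 j (u j (vertex_comp j x')))).
  rewrite /f (bigD1 j) //= big1 ?addr0.
    by rewrite /vertex_comp qeE eqxx.
  by move=> i ij; rewrite /vertex_comp qeE (negPf ij) !linear0.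
have ef j x' : qe V j (f x') = val j (v j (c1 j (u j (vertex_comp j x')))).
  rewrite /f linear_sum (bigD1 j) //= big1 ?addr0 ?qe_val ?eqxx //.
  by move=> i ij; rewrite qe_val eq_sym (negPf ij).
have fval i y : f (val i (v i y)) = val i (v i (c1 i y)).
  have -> : val i (v i y) = qe V i (val i (v i y)) by rewrite qe_val eqxx.
  by rewrite fe vertex_comp_val uv.
have eh : qhom (linfun e').
  split=> i x'; rewrite !eE ?fe ?ef //.
  rewrite -[qa V i x']qe_t fe vertex_comp_arrow ua.
  rewrite -[RHS]qa_s ef -qmod_rep_mapE -va; congr (val _ (v _ _)).
  by rewrite /c1 /= /dsum_map /= linear0.
have ee x' : linfun e' (linfun e' x') = linfun e' x'.
  rewrite !eE {2 3}/f [X in X = _](_ : _ = \sum_i f (val i (v i (c1 i (u i (vertex_comp i x')))))).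
    by apply: eq_bigr => i _; rewrite fval.
  exact: (linear_sum e').
case: (Vid _ eh ee) => E.
  apply: n1; have := fval i1 (y1, 0); rewrite -eE E zero_lfunE => /esym.
  have -> : 0 = val i1 0 by rewrite linear0.
  move=> /subvs_inj/(congr1 (u i1)); rewrite uv linear0.
  by case.
apply: n2; have := fval i2 (0, y2); rewrite -eE E id_lfunE /c1.
by move=> /subvs_inj/(congr1 (u i2)); rewrite !uv => -[].
Qed.
End RepOf.

Lemma finite_type_bounded (k : fieldType) (Q : quiver) : finite_rep_type k Q ->
  exists D, forall V : qmod k Q, qindec V -> (\dim {:V} <= D)%N.
Proof.
move=> [n [X XP]].
exists (\max_(j < n) \sum_i \dim {:rep_space (X j) i})%N => V Vid.
have [j [u [ubij _]]] := XP _ (qmod_rep_indec Vid).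
apply: leq_trans (leq_bigmax j); apply: (leq_trans (qmod_rep_dim V)).
apply: leq_sum => i _; rewrite -(dim_inj (f := linfun (u i))).
  exact/dimvS/subvf.
by move=> x y; rewrite !lfunE; exact: bij_inj (ubij i) _ _.
Qed.

(** * Uniserial modules attached to walks *)

Section Walk.
Variables (k : fieldType) (Q : quiver) (w : nat -> arrow Q) (n : nat).
Hypothesis wP : forall l, (l.+1 < n)%N -> source (w l.+1) = target (w l).

(* The uniserial module with basis the initial segments of the walk w. *)
Local Notation T := {ffun 'I_n.+1 -> k^o}.

Definition walk_vertex l := if l is m.+1 then target (w m) else source (w 0).

Lemma walk_source l : (l < n)%N -> walk_vertex l = source (w l).
Proof. by case: l => // l /wP. Qed.

Definition walk_e i (x : T) : T :=
  [ffun l : 'I_n.+1 => if i == walk_vertex l then x l else 0].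
Fact walk_e_linear i : linear (walk_e i).
Proof.
move=> c x y; apply/ffunP=> l; rewrite !ffunE; case: eqP => // _.
by rewrite scaler0 addr0.
Qed.
HB.instance Definition _ i :=
  GRing.isLinear.Build k T T _ (walk_e i) (walk_e_linear i).

Definition walk_a a (x : T) : T :=
  [ffun l : 'I_n.+1 => \sum_(m < n.+1 | (m.+1 == l :> nat) && (w m == a)) x m].
Fact walk_a_linear a : linear (walk_a a).
Proof.
move=> c x y; apply/ffunP=> l; rewrite !ffunE scaler_sumr -big_split /=.
by apply: eq_bigr => m _; rewrite !ffunE.
Qed.
HB.instance Definition _ a :=
  GRing.isLinear.Build k T T _ (walk_a a) (walk_a_linear a).

Definition walk : qmod k Q.
Proof.
refine (@QMod k Q T (fun i => linfun (walk_e i)) (fun a => linfun (walk_a a))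
  _ _ _ _).
- move=> i j x; rewrite !lfunE; apply/ffunP=> l; rewrite (fun_if (fun f : T => f l)) !ffunE.
  case: (eqVneq i j) => [->|ij]; first by case: eqP.
  by case: eqP => // iE; case: eqP => // jE; rewrite iE jE eqxx in ij.
- move=> x; apply/ffunP=> l; rewrite sum_ffunE (bigD1 (walk_vertex l)) //=.
  rewrite lfunE ffunE eqxx big1 ?addr0 // => i /negPf il.
  by rewrite lfunE ffunE il.
- move=> a x; rewrite !lfunE; apply/ffunP=> l; rewrite !ffunE.
  case: eqP => // ne; rewrite big1 // => m /andP[/eqP ml /eqP wa].
  by case: ne; rewrite -ml -wa.
- move=> a x; rewrite !lfunE; apply/ffunP=> l; rewrite !ffunE.
  apply: eq_bigr => m /andP[/eqP ml /eqP wa]; rewrite ffunE walk_source ?wa ?eqxx //.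
  by have := ltn_ord l; rewrite -ml.
Defined.

Lemma walk_aE a (x : walk) (l : 'I_n.+1) : (qa walk a x : T) l =
  \sum_(m < n.+1 | (m.+1 == l :> nat) && (w m == a)) (x : T) m.
Proof. by rewrite lfunE ffunE. Qed.

Definition walk_in (l : 'I_n.+1) : walk := [ffun m => (m == l)%:R] : T.

Lemma walk_inE (x : walk) : x = \sum_l (x : T) l *: walk_in l.
Proof.
apply/ffunP => m; rewrite sum_ffunE (bigD1 m) //= big1.
  by rewrite !ffunE eqxx addr0 [RHS]mulr1.
by move=> l; rewrite !ffunE eq_sym => /negPf->; exact: mulr0.
Qed.

Lemma walk_in_step (l m : 'I_n.+1) : l.+1 = m :> nat ->
  qa walk (w l) (walk_in l) = walk_in m.
Proof.
move=> lm; apply/ffunP=> j; rewrite walk_aE ffunE.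
rewrite big_mkcond (bigD1 l) //= big1.
  rewrite ffunE !eqxx andbT addr0 lm [_ == j :> nat]eq_sym -val_eqE.
  by case: eqP.
by move=> i il; rewrite ffunE (negPf il) if_same.
Qed.

(** The arrow [w l] takes basis vector [l] to basis vector [l + 1] and moves coordinates up by one,
    killing those whose arrow differs. As [e] commutes with it, the diagonal entry is passed on
    unchanged. The walk may repeat arrows, so entries beyond the diagonal are not controlled. *)
Lemma walk_triangular (e : 'End(walk)) : qhom e -> forall l : 'I_n.+1,
  (e (walk_in l) : T) l = (e (walk_in ord0) : T) ord0 /\
  forall j : 'I_n.+1, (j < l)%N -> (e (walk_in l) : T) j = 0.
Proof.
move=> [_ ea] [l lt]; elim: l lt => [|l IHl] lt.
  by rewrite (_ : Ordinal lt = ord0) //; exact: val_inj.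
have lt' : (l < n.+1)%N by exact: ltnW.
have [IH1 IH2] := IHl lt'.
rewrite -(@walk_in_step (Ordinal lt') (Ordinal lt)) // ea; split.
  rewrite walk_aE (big_pred1 (Ordinal lt')) // => m /=.
  by rewrite eqSS -val_eqE; case: eqP => // ->; rewrite eqxx.
move=> j jl; rewrite walk_aE big1 // => m /andP[/eqP mj _].
by apply: IH2; rewrite /= -ltnS mj.
Qed.

Lemma walk_idem0 (e : 'End(walk)) : qhom e -> (forall x, e (e x) = e x) ->
  (e (walk_in ord0) : T) ord0 = 0 -> e = 0.
Proof.
move=> eh ee e0; apply/lfunP => x; rewrite zero_lfunE; apply/ffunP => l.
rewrite [RHS]ffunE; have [d] := ubnP (l : nat).
elim: d l => // d IHd l ld; rewrite -ee [e x]walk_inE linear_sum sum_ffunE.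
rewrite big1 // => m _; rewrite linearZ ffunE /=.
have [El Ej] := walk_triangular eh m.
case: (ltngtP m l) => [ml|lm|/val_inj->].
- by rewrite IHd ?scale0r // (leq_trans ml).
- by rewrite Ej // scaler0.
- by have [-> _] := walk_triangular eh l; rewrite e0 scaler0.
Qed.

Lemma walk_indec : qindec walk.
Proof.
have in00 : (walk_in ord0 : T) ord0 = 1 by rewrite ffunE eqxx.
split.
  exists (walk_in ord0); apply/eqP => /ffunP/(_ ord0); rewrite in00 ffunE.
  by move/eqP; rewrite oner_eq0.
move=> e eh ee; set c := (e (walk_in ord0) : T) ord0.
have cc : c * c = c.
  rewrite {3}/c -ee [e (walk_in ord0)]walk_inE linear_sum sum_ffunE (bigD1 ord0) //=.
  rewrite linearZ ffunE big1 ?addr0 // => m m0; rewrite linearZ ffunE /=.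
  by have [_ ->] := walk_triangular eh m; rewrite ?scaler0 // lt0n.
have [c0|c0] := eqVneq c 0; first by left; apply: walk_idem0.
right; suff E : \1%VF - e = 0 by rewrite -[e](subKr \1%VF) E subr0.
apply: walk_idem0; first exact: qhom_sub (qhom_id _) eh.
  by move=> x; rewrite !add_lfunE !opp_lfunE !id_lfunE linearB /= ee subrr subr0.
rewrite add_lfunE opp_lfunE id_lfunE !ffunE -/c; apply/eqP; rewrite subr_eq0 eqxx eq_sym.
by apply/eqP/(mulfI c0); rewrite cc mulr1.
Qed.

Lemma walk_dim : \dim {:walk} = n.+1.
Proof.
by rewrite dimvf [dim _](_ : _ = #|'I_n.+1| * dim k^o)%N // card_ord muln1.
Qed.
End Walk.

(** * Intertwiners over a local ring *)

Section Intertwiner.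
Variables (k : fieldType) (S : comNzRingType).
Variables (aug : {rmorphism S -> k}) (iota : {rmorphism k -> S}).
Hypothesis augK : cancel iota aug.
Hypothesis aug_unit : forall x, aug x = 1 -> exists y, y * x = 1.

Local Notation red := (map_mx aug).

(** The determinant trick: [B = 1 - m] sends the family [d] into [P] and its determinant is a unit,
    so the adjugate of [B] recovers each [d i] inside [P]. *)
Lemma nakayama (V : lmodType S) (P : V -> Prop) r (d : 'I_r -> V) :
  P 0 -> (forall x y, P x -> P y -> P (x + y)) -> (forall c x, P x -> P (c *: x)) ->
  (forall i, exists2 m : 'I_r -> S, forall j, aug (m j) = 0 &
     P (d i - \sum_j m j *: d j)) ->
  forall i, P (d i).
Proof.
move=> P0 PD PZ H l.
have /choice[m mP] : forall i, exists m : 'I_r -> S,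
    (forall j, aug (m j) = 0) /\ P (d i - \sum_j m j *: d j).
  by move=> i; have [m] := H i; exists m.
have Psum (I : finType) (F : I -> V) : (forall i, P (F i)) -> P (\sum_i F i).
  by move=> PF; elim/big_ind: _ => //; exact: PF.
pose B : 'M[S]_r := 1%:M - \matrix_(i, j) m i j.
have BE i : \sum_j B i j *: d j = d i - \sum_j m i j *: d j.
  rewrite (bigD1 i) //= [X in _ = _ - X](bigD1 i) //= !mxE eqxx scalerBl scale1r.
  rewrite opprD addrA -sumrN; congr (_ + _); apply: eq_bigr => j ji.
  by rewrite !mxE eq_sym (negPf ji) sub0r scaleNr.
have detB : aug (\det B) = 1.
  rewrite -det_map_mx (_ : map_mx aug B = 1%:M) ?det1 //.
  apply/matrixP => i j; rewrite !mxE rmorphB rmorphMn rmorph1 /=.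
  by have [-> _] := mP i; rewrite subr0.
have [y yB] := aug_unit detB.
rewrite -[d l]scale1r -yB -scalerA; apply: (PZ).
have adjE j : \sum_i \adj B l i * B i j = \det B *+ (l == j).
  by have /matrixP/(_ l j) := mul_adj_mx B; rewrite [LHS]mxE [RHS]mxE.
have -> : \det B *: d l = \sum_i \adj B l i *: \sum_j B i j *: d j.
  under eq_bigr do rewrite scaler_sumr.
  rewrite exchange_big /= (bigD1 l) //= [X in _ + X]big1 ?addr0 => [|j jl].
    under [RHS]eq_bigr do rewrite scalerA.
    by rewrite -scaler_suml adjE eqxx.
  under eq_bigr do rewrite scalerA.
  by rewrite -scaler_suml adjE eq_sym (negPf jl) scale0r.
by apply: Psum => i; apply: PZ; rewrite BE; have [] := mP i.
Qed.

Variables (Q : quiver) (d : nat).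

(* Representations on S^d with all operators acting on row vectors. *)
Definition mxrep (R : pzRingType) (E : vertex Q -> 'M[R]_d) (A : arrow Q -> 'M[R]_d) :=
  [/\ forall i j, E i *m E j = if i == j then E i else 0,
      \sum_i E i = 1%:M,
      forall a, A a *m E (target a) = A a &
      forall a, E (source a) *m A a = A a].

Definition mxext0 (R : pzRingType) (E : vertex Q -> 'M[R]_d) (A : arrow Q -> 'M[R]_d) :=
  forall g : arrow Q -> 'M[R]_d,
    (forall a, E (source a) *m g a = g a /\ g a *m E (target a) = g a) ->
  exists2 u, forall i, E i *m u = u *m E i &
    forall a, A a *m u - u *m A a = g a.

Variables (E E' : vertex Q -> 'M[S]_d) (A A' : arrow Q -> 'M[S]_d).
Hypotheses (rE : mxrep E A) (rE' : mxrep E' A').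
Hypothesis redE : forall i, red (E i) = red (E' i).
Hypothesis redA : forall a, red (A a) = red (A' a).
Hypothesis ext : mxext0 (fun i => red (E i)) (fun a => red (A a)).

Local Notation V := {ffun arrow Q -> 'M[S]_d}.

(** The differential of the complex between the two lifts: [gr] is its source, [T] its target and
    [P] its image. *)
Let D (u : 'M[S]_d) : V := [ffun a => A a *m u - u *m A' a].
Let gr (u : 'M[S]_d) := forall i, E i *m u = u *m E' i.
Let T (g : V) := forall a, E (source a) *m g a = g a /\ g a *m E' (target a) = g a.
Let P (g : V) := exists2 u, gr u & g = D u.

Let D_lin c u v : D (c *: u + v) = c *: D u + D v.
Proof.
apply/ffunP => a; rewrite !ffunE mulmxDr mulmxDl -scalemxAr -scalemxAl.
by rewrite scalerBr opprD addrACA.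
Qed.
Let gr_lin c u v : gr u -> gr v -> gr (c *: u + v).
Proof.
by move=> gu gv i; rewrite mulmxDr mulmxDl -scalemxAr -scalemxAl gu gv.
Qed.
Let gr0 : gr 0. Proof. by move=> i; rewrite mulmx0 mul0mx. Qed.
Let D0 : D 0 = 0.
Proof. by have := D_lin (-1) 0 0; rewrite scaler0 addr0 scaleN1r addNr. Qed.
Let P0 : P 0. Proof. by exists 0. Qed.
Let P_lin c x y : P x -> P y -> P (c *: x + y).
Proof.
by move=> [u gu ->] [v gv ->]; exists (c *: u + v); [exact: gr_lin|rewrite D_lin].
Qed.
Let D_T u : gr u -> T (D u).
Proof.
have [_ _ At As] := rE; have [_ _ At' As'] := rE'.
move=> gu a; rewrite !ffunE mulmxBr mulmxBl !mulmxA As gu -!mulmxA As' At'.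
by rewrite -gu mulmxA At.
Qed.

(** The projection onto [gr]. It turns any matrix whose reduction is graded into one compatible with
    both families of idempotents, without changing the reduction. *)
Let avg (u : 'M[S]_d) := \sum_i E i *m u *m E' i.
Let avg_gr u : gr (avg u).
Proof.
have [EE _ _ _] := rE; have [EE' _ _ _] := rE'.
move=> i; rewrite /avg mulmx_sumr mulmx_suml (bigD1 i) //= [RHS](bigD1 i) //=.
rewrite !mulmxA EE eqxx -[in RHS]mulmxA EE' eqxx !big1 // => j ji.
  by rewrite -!mulmxA EE' (negPf ji) !mulmx0.
by rewrite !mulmxA EE eq_sym (negPf ji) !mul0mx.
Qed.
Let avg_red u : (forall i, red (E i) *m red u = red u *m red (E i)) ->
  red (avg u) = red u.
Proof.
have [EE E1 _ _] := rE.
move=> cu; rewrite /avg raddf_sum -[RHS]mulmx1 -(map_mx1 aug) -E1 raddf_sum.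
rewrite mulmx_sumr; apply: eq_bigr => i _; rewrite /= !map_mxM -redE cu -mulmxA.
by rewrite -map_mxM EE eqxx.
Qed.

Let nI : finType := (arrow Q * 'I_d * 'I_d)%type.
(** Elementary matrices cut down to the block of their arrow: a finite family generating [T], with
    the entries of an element as its coefficients ([T_delta]). *)
Let delta (t : nI) : V := [ffun b => if b == t.1.1 then
  E (source b) *m delta_mx t.1.2 t.2 *m E' (target b) else 0].

Let delta_T t : T (delta t).
Proof.
have [EE _ _ _] := rE; have [EE' _ _ _] := rE'.
move=> a; rewrite ffunE; case: eqP => _; last by rewrite mulmx0 mul0mx.
by rewrite !mulmxA EE eqxx -[_ *m _ *m E' _ *m E' _]mulmxA EE' eqxx.
Qed.

Let T_delta g : T g -> g = \sum_t (g t.1.1 t.1.2 t.2) *: delta t.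
Proof.
move=> Tg; apply/ffunP => a; rewrite sum_ffunE.
rewrite (eq_bigr (fun t => (fun b p q => (g b p q *: delta (b, p, q)) a)
  t.1.1 t.1.2 t.2)) /=; last by case=> [[]].
rewrite -(pair_bigA _ (fun bp q => (g bp.1 bp.2 q *: delta (bp, q)) a)) /=.
rewrite -(pair_bigA _ (fun b p => \sum_q (g b p q *: delta (b, p, q)) a)) /=.
rewrite (bigD1 a) //= [X in _ + X]big1 ?addr0; last first.
  move=> b ba; rewrite big1 // => p _; rewrite big1 // => q _.
  by rewrite !ffunE /= eq_sym (negPf ba) scaler0.
have [Es Et] := Tg a; rewrite -[LHS]Et -[g a in LHS]Es [in LHS](matrix_sum_delta (g a)).
rewrite mulmx_sumr mulmx_suml; apply: eq_bigr => p _.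
rewrite mulmx_sumr mulmx_suml; apply: eq_bigr => q _.
by rewrite !ffunE eqxx /= -scalemxAr -scalemxAl.
Qed.

Let T_lin c x y : T x -> T y -> T (c *: x + y).
Proof.
move=> Tx Ty a; have [x1 x2] := Tx a; have [y1 y2] := Ty a.
by rewrite !ffunE mulmxDr mulmxDl -scalemxAr -scalemxAl x1 x2 y1 y2.
Qed.

(** A solution over [k] is lifted entrywise by [iota], then made graded over [S] by [avg]. *)
Let solve g : T g -> exists2 u, gr u & forall a, red ((g - D u) a) = 0.
Proof.
move=> Tg; have [a|u0 gu0 u0E] := ext (g := fun a => red (g a)).
  have [Es Et] := Tg a.
  by split; [rewrite -map_mxM Es|rewrite redE -map_mxM Et].
have u0K : red (map_mx iota u0) = u0.
  by apply/matrixP => p q; rewrite !mxE augK.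
exists (avg (map_mx iota u0)) => // a; rewrite !ffunE map_mxB map_mxB !map_mxM.
rewrite avg_red; last by move=> i; rewrite u0K gu0.
by rewrite u0K -redA u0E subrr.
Qed.

Lemma intertwiner : exists F : 'M[S]_d, [/\ red F = 1%:M,
  forall i, E i *m F = F *m E' i & forall a, A a *m F = F *m A' a].
Proof.
have Pd t : P (delta t).
  rewrite -[t]enum_rankK.
  apply: (@nakayama V P _ (fun i : 'I_#|{: nI}| => delta (enum_val i))) => //.
  - by move=> x y Px Py; rewrite -[x]scale1r; apply: P_lin.
  - by move=> c x Px; rewrite -[_ *: _]addr0; apply: P_lin.
  move=> i; have [u gu uE] := solve (delta_T (enum_val i)).
  set h := delta _ - D u in uE.
  have Th : T h by rewrite /h -scaleN1r addrC; apply: T_lin (D_T gu) (delta_T _).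
  (* The remainder [h] lies in [T] and reduces to 0, so its own entries are coefficients in the
     maximal ideal that express it through the generators. *)
  exists (fun j => (h (enum_val j).1.1 (enum_val j).1.2 (enum_val j).2)).
    move=> j; set s := enum_val j.
    by have /matrixP/(_ s.1.2 s.2) := uE s.1.1; rewrite [LHS]mxE [RHS]mxE.
  rewrite (_ : \sum_j _ = h); first by exists u; rewrite // /h subKr.
  rewrite [RHS]T_delta //; rewrite [RHS](reindex (@enum_val nI {: nI})) //.
  exact: (onW_bij _ (@enum_val_bij _)).
(* Combinations with coefficients in the maximal ideal have a preimage that reduces to 0. Applied to
   [D u0], this gives a correction of [u0] that leaves its reduction 1 intact. *)
have Psum (I : finType) (c : I -> S) (f : I -> V) : (forall i, aug (c i) = 0) ->
    (forall i, P (f i)) ->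
    exists2 u, gr u & D u = \sum_i c i *: f i /\ red u = 0.
  move=> c0 Pf; elim/big_rec: _ => [|i x _ [u gu [uE u0]]].
    by exists 0 => //; rewrite D0 map_mx0.
  have [v gv vE] := Pf i; exists (c i *: v + u); first exact: gr_lin.
  rewrite D_lin -vE uE; split=> //.
  by rewrite map_mxD map_mxZ c0 scale0r u0 addr0.
pose u0 := avg 1%:M.
have u01 : red u0 = 1%:M.
  by rewrite avg_red map_mx1 // => i; rewrite mul1mx mulmx1.
have D0a a : red (D u0 a) = 0.
  by rewrite ffunE map_mxB !map_mxM u01 mul1mx mulmx1 redA subrr.
have [||u gu [uE u0E]] := Psum _ (fun t : nI => D u0 t.1.1 t.1.2 t.2) delta.
- by move=> t; have := congr1 (fun M : 'M_d => M t.1.2 t.2) (D0a t.1.1); rewrite !mxE.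
- by [].
exists (-1 *: u + u0); split.
- by rewrite map_mxD map_mxZ u0E scaler0 add0r.
- by apply: gr_lin => //; exact: avg_gr.
move=> a; have : D (-1 *: u + u0) a = 0.
  by rewrite D_lin uE -T_delta ?scaleN1r ?addNr ?ffunE //; exact/D_T/avg_gr.
by rewrite ffunE => /eqP; rewrite subr_eq0 => /eqP.
Qed.
End Intertwiner.

(** * Finitely generated modules over the path algebra *)

Section FixedPoints.
Variables (A : pzRingType) (N : lmodType A) (p : {linear N -> N}).

Definition fixp : {pred N} := [pred x | p x == x].
Fact fixp_submod : submod_closed fixp.
Proof.
split=> [|c x y]; rewrite !inE ?linear0 // => /eqP px /eqP py.
by rewrite linearP px py.
Qed.
HB.instance Definition _ := GRing.isSubmodClosed.Build A N fixp fixp_submod.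

Record fixpoints := FixPoint { fixp_val :> N; _ : fixp_val \in fixp }.
HB.instance Definition _ := [isSub for fixp_val].
HB.instance Definition _ := [Choice of fixpoints by <:].
HB.instance Definition _ := [SubChoice_isSubLmodule of fixpoints by <:].

Lemma fixpP (x : fixpoints) : p (val x) = val x.
Proof. by case: x => x /= /eqP. Qed.
End FixedPoints.

Lemma indecomposable_idem (A : pzRingType) (N : lmodType A) :
  indecomposable N -> forall p : {linear N -> N}, (forall x, p (p x) = p x) ->
  (forall x, p x = 0) \/ (forall x, p x = x).
Proof.
move=> [_ Nid] p pp; apply: contrapT => /not_orP[/existsNP[x px] /existsNP[y py]].
have q_lin : linear (fun x => x - p x).
  by move=> c u v; rewrite linearP opprD addrACA scalerBr.
pose q : {linear N -> N} := HB.pack (fun x => x - p x) (GRing.isLinear.Build _ _ _ _ _ q_lin).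
have qE z : q z = z - p z by [].
apply: Nid; exists (fixpoints p), (fixpoints q).
have pf z : p z \in fixp p by rewrite inE pp.
have qf z : q z \in fixp q by rewrite inE !qE linearB pp subrr subr0.
split.
- by exists (FixPoint (pf x)) => /(congr1 val)/px.
- exists (FixPoint (qf y)) => /(congr1 val) /= /eqP.
  by rewrite subr_eq0 => /eqP /esym.
pose f z : (fixpoints p * fixpoints q)%type := (FixPoint (pf z), FixPoint (qf z)).
have f_lin : linear f.
  move=> c u v; congr pair; apply: val_inj; first exact: (linearP p).
  exact: (linearP q).
pose f' : {linear N -> (fixpoints p * fixpoints q)%type} :=
  HB.pack f (GRing.isLinear.Build _ _ _ _ _ f_lin).
exists f'; exists (fun z => val z.1 + val z.2) => [z|[u v]] /=.
  by rewrite addrC subrK.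
have pv : p (val v) = 0.
  have := fixpP v; rewrite qE => /eqP; rewrite subr_eq addrC -subr_eq subrr.
  by move=> /eqP.
have pu := fixpP u.
congr pair; apply: val_inj; rewrite /= linearD pu pv addr0 //.
by rewrite addrC addKr.
Qed.

Section FiniteBasis.
Variables (k : fieldType) (V : lmodType k).

Definition spans r (f : 'I_r -> V) :=
  forall x, exists c : 'rV[k]_r, x = \sum_i c 0 i *: f i.

Lemma finite_basis r (f : 'I_r -> V) : spans f ->
  exists (d : nat) (b : 'I_d -> V) (co : V -> 'rV[k]_d),
    (forall x, x = \sum_i co x 0 i *: b i) /\
    (forall c : 'rV_d, co (\sum_i c 0 i *: b i) = c).
Proof.
move=> fs.
have [[d b] /= bs bmin] := @ex_argmin {r & 'I_r -> V} (fun f => spans (projT2 f))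
  (fun f => projT1 f) (ex_intro _ (existT _ r f) fs).
have free (c : 'rV[k]_d) : \sum_i c 0 i *: b i = 0 -> c = 0.
  move=> c0; apply/rowP => j; rewrite mxE; apply: contrapT => /eqP cj.
  case: d => [|d] in b bs bmin c c0 j cj *; first by case: j cj.
  suff : spans (fun i => b (lift j i)) by move=> /(bmin (existT _ d _)); rewrite ltnn.
  move=> x; have [e ->] := bs x.
  (* Subtracting the multiple [e_j / c_j] of the relation removes the [j]-th vector, against
     minimality of the spanning family. *)
  exists (\row_i (e 0 (lift j i) - e 0 j / c 0 j * c 0 (lift j i))).
  have {}c0 := congr1 (fun z => e 0 j / c 0 j *: z) c0; rewrite /= in c0.
  rewrite scaler0 (bigD1_ord j) //= scalerDr scalerA divfK // in c0.
  rewrite (bigD1_ord j) //=.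
  rewrite -[LHS]subr0 -[X in _ - X]c0 opprD addrACA subrr add0r scaler_sumr -sumrB.
  by apply: eq_bigr => i _; rewrite mxE scalerBl scalerA.
have /choice[co coP] := bs.
exists d, b, co; split=> // c; apply/eqP; rewrite -subr_eq0; apply/eqP/free.
have /eqP := coP (\sum_i c 0 i *: b i); rewrite eq_sym -subr_eq0 -sumrB => /eqP E.
by rewrite -[RHS]E; apply: eq_bigr => i _; rewrite !mxE scalerBl.
Qed.
End FiniteBasis.

Section PathAlgebra.
Variables (k : fieldType) (Q : quiver).
Local Notation Lam := (path_alg k Q).

Definition pe i : Lam := acl (@path_alg_rel k Q) (gen_e k i).
Definition pa a : Lam := acl (@path_alg_rel k Q) (gen_a k a).

Lemma pe_pe i j : pe i * pe j = if i == j then pe i else 0.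
Proof.
rewrite -[LHS]aclM; case: eqP => [->|ij]; first exact/aclP/acong_rel/par_idem.
exact/aclP/acong_rel/par_orth.
Qed.
Lemma pe_pa a : pe (target a) * pa a = pa a.
Proof. rewrite -[LHS]aclM; exact/aclP/acong_rel/par_target. Qed.
Lemma pa_pe a : pa a * pe (source a) = pa a.
Proof. rewrite -[LHS]aclM; exact/aclP/acong_rel/par_source. Qed.
Lemma pe_sum : \sum_i pe i = 1.
Proof.
transitivity (acl (@path_alg_rel k Q)
    (\big[@AAdd k _/AScal _ 0]_i gen_e k i)); last exact/aclP/acong_rel/par_one.
by elim/big_rec2: _ => // i x y _ ->; rewrite aclD.
Qed.

Lemma path_alg_ind (P : Lam -> Prop) :
  (forall i, P (pe i)) -> (forall a, P (pa a)) -> (forall c, P (kscal Lam c)) ->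
  (forall x y, P x -> P y -> P (x + y)) -> (forall x y, P x -> P y -> P (x * y)) ->
  forall x, P x.
Proof.
move=> Pe Pa Pk PD PM x; rewrite -(arepK x).
elim: (arep x) => [[i|a]|c|u Pu v Pv|u Pu v Pv].
- exact: (Pe i).
- exact: (Pa a).
- exact: (Pk c).
- by rewrite aclD; exact: PD.
- by rewrite aclM; exact: PM.
Qed.

Section Coordinates.
Variables (R : comNzRingType) (N : lmodType R) (d : nat).
Variables (b : 'I_d -> N) (co : N -> 'rV[R]_d).
Hypothesis coK : forall x, x = \sum_i co x 0 i *: b i.
Hypothesis Kco : forall c : 'rV_d, co (\sum_i c 0 i *: b i) = c.
Variable op : Lam -> N -> N.
Hypothesis opD : forall l x y, op l (x + y) = op l x + op l y.
Hypothesis opZ : forall l c x, op l (c *: x) = c *: op l x.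
Hypothesis opDl : forall l m x, op (l + m) x = op l x + op m x.
Hypothesis opM : forall l m x, op (l * m) x = op l (op m x).
Hypothesis op1 : forall x, op 1 x = x.

Definition lcomb (v : 'rV[R]_d) : N := \sum_i v 0 i *: b i.
(** Matrices act on coordinate rows from the right, so products are reversed; hence the order of
    factors in [mxrep]. *)
Definition opmx l : 'M[R]_d := \matrix_(i, j) co (op l (b i)) 0 j.

Lemma lcomb_linear : linear lcomb.
Proof.
move=> c u v; rewrite /lcomb scaler_sumr -big_split; apply: eq_bigr => i _.
by rewrite !mxE scalerDl scalerA.
Qed.
HB.instance Definition _ := GRing.isLinear.Build R _ _ _ lcomb lcomb_linear.

Lemma lcomb_delta i : lcomb (delta_mx 0 i) = b i.
Proof.
rewrite /lcomb (bigD1 i) //= mxE !eqxx scale1r big1 ?addr0 // => j ji.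
by rewrite mxE (negPf ji) andbF scale0r.
Qed.

Lemma lcomb_inj : injective lcomb.
Proof. exact: can_inj Kco. Qed.

Lemma op_sum l (I : finType) (F : I -> N) : op l (\sum_i F i) = \sum_i op l (F i).
Proof.
have op0 : op l 0 = 0 by rewrite -(scale0r (0 : N)) opZ !scale0r.
exact: (big_morph _ (opD l) op0).
Qed.

Lemma op_lcomb l v : op l (lcomb v) = lcomb (v *m opmx l).
Proof.
rewrite op_sum /lcomb; under [RHS]eq_bigr do rewrite mxE scaler_suml.
rewrite exchange_big; apply: eq_bigr => i _; rewrite opZ [op l _]coK scaler_sumr.
by apply: eq_bigr => j _; rewrite scalerA mxE.
Qed.

Lemma opmx_unique l (X : 'M_d) :
  (forall v, op l (lcomb v) = lcomb (v *m X)) -> opmx l = X.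
Proof.
move=> lX; apply/row_matrixP => i; rewrite !rowE; apply: lcomb_inj.
by rewrite -op_lcomb lX.
Qed.

Lemma opmxM l m : opmx (l * m) = opmx m *m opmx l.
Proof. by apply: opmx_unique => v; rewrite opM !op_lcomb mulmxA. Qed.

Lemma opmxD l m : opmx (l + m) = opmx l + opmx m.
Proof. by apply: opmx_unique => v; rewrite opDl !op_lcomb mulmxDr linearD. Qed.

Lemma opmx1 : opmx 1 = 1%:M.
Proof. by apply: opmx_unique => v; rewrite op1 mulmx1. Qed.

Lemma opmx0 : opmx 0 = 0.
Proof. by apply: (addrI (opmx 0)); rewrite -opmxD !addr0. Qed.

Lemma opmx_mxrep : mxrep (fun i => opmx (pe i)) (fun a => opmx (pa a)).
Proof.
split.
- move=> i j; rewrite -opmxM pe_pe eq_sym; case: eqP => [->//|_]; exact: opmx0.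
- by rewrite -opmx1 -pe_sum (big_morph _ opmxD opmx0).
- by move=> a; rewrite -opmxM pe_pa.
- by move=> a; rewrite -opmxM pa_pe.
Qed.
End Coordinates.
End PathAlgebra.

Section MatrixModule.
Variables (k : fieldType) (Q : quiver) (d : nat).
Variables (E : vertex Q -> 'M[k]_d) (A : arrow Q -> 'M[k]_d).
Hypothesis rE : mxrep E A.

Let opE (X : 'M[k]_d) x : linfun (mulmxr X) x = x *m X :> 'rV_d.
Proof. by rewrite lfunE. Qed.

Definition mxmod : qmod k Q.
Proof.
refine (@QMod k Q 'rV[k]_d (fun i => linfun (mulmxr (E i)))
  (fun a => linfun (mulmxr (A a))) _ _ _ _); have [EE E1 At As] := rE.
- move=> i j x; rewrite !opE -mulmxA EE eq_sym.
  by case: eqP => // _; rewrite mulmx0.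
- move=> x; under eq_bigr do rewrite opE.
  by rewrite -mulmx_sumr E1 mulmx1.
- by move=> a x; rewrite !opE -mulmxA At.
- by move=> a x; rewrite !opE -mulmxA As.
Defined.

Lemma mxmod_ext0 : ext0 mxmod mxmod -> mxext0 E A.
Proof.
move=> ext g gP; have [a x|u ue ua] := ext (fun a => linfun (mulmxr (g a))).
  have [gs gt] := gP a.
  by rewrite !opE -!mulmxA gs gt.
exists (lin1_mx u) => [i|a]; apply/row_matrixP => i'; rewrite !rowE.
  rewrite !mulmxA !mul_rV_lin1.
  by have := ue i (delta_mx 0 i'); rewrite !opE.
rewrite mulmxBr !mulmxA !mul_rV_lin1.
by have := ua a (delta_mx 0 i'); rewrite !opE.
Qed.
End MatrixModule.

(** * Finite dimension of finitely generated modules *)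

Section FiniteDimension.
Variables (k : fieldType) (Q : quiver) (M : lmodType (path_alg k Q)).
Local Notation Lam := (path_alg k Q).
Local Notation Mk := (restr (kscal Lam) M).

Fixpoint path_images (G : seq M) l : seq M :=
  if l is m.+1 then [seq pa k a *: x | a <- enum (arrow Q), x <- path_images G m]
  else [seq pe k i *: g | i <- enum (vertex Q), g <- G].

Lemma path_images_vertex G l x : x \in path_images G l ->
  exists i, pe k i *: x = x.
Proof.
case: l => [|l] /allpairsP[[i y] /= [_ _ ->]].
  by exists i; rewrite scalerA pe_pe eqxx.
by exists (target i); rewrite scalerA pe_pa.
Qed.

(** An arrow kills every vector supported at a vertex other than its source, so a nonzero image
    forces consecutive arrows to compose. The last clause carries the induction; options are used
    because [Q] may have no arrow. *)
Lemma path_images_walk G l x : x \in path_images G l -> x != 0 ->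
  exists w : nat -> option (arrow Q),
  [/\ forall j, (j < l)%N -> w j != None, 
      forall j a a', (j.+1 < l)%N -> w j = Some a -> w j.+1 = Some a' ->
        source a' = target a &
      forall j a, l = j.+1 -> w j = Some a -> pe k (target a) *: x = x].
Proof.
elim: l x => [|l IHl] x /allpairsP[[a y] /= [_ yl ->]] x0.
  by exists (fun=> None).
have y0 : y != 0 by apply: contraNneq x0 => ->; rewrite scaler0.
have [w [w1 w2 w3]] := IHl y yl y0.
exists (fun j => if j == l then Some a else w j); split.
- by move=> j; rewrite ltnS leq_eqVlt; case: eqP => //= _; exact: w1.
- move=> j b b' jl; rewrite (ltn_eqF (jl : (j < l)%N)) => wj.
  case: eqP => [jE [<-]|/eqP ne]; last first.
    by apply: w2 wj; rewrite ltn_neqAle ne.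
  have yE := w3 j b (esym jE) wj.
  apply: contrapT => ne; case/eqP: x0.
  rewrite -yE scalerA -(pa_pe k a) -mulrA pe_pe.
  by case: eqP => // _; rewrite mulr0 scale0r.
- by move=> j b [<-]; rewrite eqxx => -[<-]; rewrite scalerA pe_pa.
Qed.

Lemma path_images_long D G l : 
  (forall V : qmod k Q, qindec V -> (\dim {:V} <= D)%N) -> (D < l)%N ->
  forall x, x \in path_images G l -> x = 0.
Proof.
move=> bd Dl x xl; apply: contrapT => /eqP x0.
have [w [w1 w2 _]] := path_images_walk xl x0.
case: l => // l in xl w1 w2 Dl *.
case w0 : (w 0) (w1 0 isT) => [a|//] _.
pose w' j := odflt a (w j).
have ww j : (j < l.+1)%N -> w j = Some (w' j).
  by rewrite /w' => /w1; case: (w j).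
have wP j : (j.+1 < l.+1)%N -> source (w' j.+1) = target (w' j).
  by move=> jl; apply: (w2 j) => //; apply: ww => //; exact: ltnW.
by have := bd _ (walk_indec k wP); rewrite walk_dim leqNgt ltnW.
Qed.

Lemma fin_gen_spans D : (forall V : qmod k Q, qindec V -> (\dim {:V} <= D)%N) ->
  fin_gen M -> exists r (f : 'I_r -> Mk), spans f.
Proof.
move=> bd [G GP].
(* Lengths up to [D] suffice: an arrow applied to an image of length [D] gives 0 by
   [path_images_long], so the span of [W] is a submodule. *)
pose W := undup (flatten [seq path_images G l | l <- iota 0 D.+1]).
have memW l x : (l <= D)%N -> x \in path_images G l -> x \in W.
  move=> lD xl; rewrite mem_undup; apply/flattenP; exists (path_images G l) => //.
  by apply: map_f; rewrite mem_iota.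
have Wmem x : x \in W -> exists2 l, (l <= D)%N & x \in path_images G l.
  rewrite mem_undup => /flattenP[s /mapP[l lD ->] xl]; exists l => //.
  by move: lD; rewrite mem_iota.
pose sp (x : Mk) := exists c : Mk -> k, x = \sum_(y <- W) c y *: (y : Mk).
have sp0 : sp 0.
  by exists (fun=> 0); rewrite big1 // => y _; rewrite scale0r.
have spD x y : sp x -> sp y -> sp (x + y).
  move=> [c ->] [e ->]; exists (fun z => c z + e z); rewrite -big_split.
  by apply: eq_bigr => z _; rewrite /= scalerDl.
have spZ a x : sp x -> sp (a *: x).
  move=> [c ->]; exists (fun z => a * c z); rewrite scaler_sumr.
  by apply: eq_bigr => z _; rewrite scalerA.
have spW x : x \in W -> sp x.
  move=> xW; exists (fun z => (z == x)%:R); rewrite (bigD1_seq x) ?undup_uniq //=.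
  rewrite eqxx scale1r big1 ?addr0 // => z /negPf->; exact: scale0r.
have spS (I : Type) (s : seq I) (F : I -> Mk) : (forall i, sp (F i)) ->
    sp (\sum_(i <- s) F i).
  by move=> FP; elim/big_ind: _.
have spop (l : Lam) : (forall y, y \in W -> sp (l *: (y : M) : M)) ->
    forall x, sp x -> sp (l *: (x : M) : M).
  move=> lW x [c ->].
  have -> : l *: ((\sum_(y <- W) c y *: (y : Mk)) : M) =
      \sum_(y <- W) c y *: (l *: (y : M) : Mk).
    rewrite (scaler_sumr l : forall I r P F, l *: (\sum_(i <- r | P i) F i : M) = _).
    apply: eq_bigr => y _.
    rewrite [in LHS](_ : c y *: (y : Mk) = kscal Lam (c y) *: (y : M)) //.
    by rewrite scalerA -kscalC -scalerA.
  rewrite big_seq; elim/big_ind: _ => // y yW; exact/spZ/lW.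
have spL (l : Lam) : forall x, sp x -> sp (l *: (x : M) : M).
  elim/path_alg_ind: l => [i|a|c|l m IHl IHm|l m IHl IHm].
  - apply: spop => y yW; have [l _ yl] := Wmem y yW.
    have [j jE] := path_images_vertex yl; rewrite -jE scalerA pe_pe.
    by case: eqP => [->|_]; rewrite ?jE ?scale0r //; exact: spW.
  - apply: spop => y yW; have [l lD yl] := Wmem y yW.
    have al : pa k a *: y \in path_images G l.+1.
      by apply: allpairs_f; rewrite ?mem_enum.
    have [lD'|] := ltnP l D; first by apply: spW; exact: memW al.
    by move=> Dl; rewrite (path_images_long bd _ al).
  - by move=> x spx; exact: spZ.
  - by move=> x spx; rewrite scalerDl; apply: spD; [exact: IHl|exact: IHm].
  - by move=> x spx; rewrite -scalerA; apply: IHl; exact: IHm.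
have spG g : g \in G -> sp (g : M).
  move=> gG; rewrite -[g : M]scale1r -pe_sum scaler_suml.
  apply: spS => i; apply: spW; apply: (@memW 0) => //.
  by apply: allpairs_f; rewrite ?mem_enum.
have spM (x : M) : sp x.
  have [c ->] := GP x; rewrite big_seq; elim/big_ind: _ => // g gG.
  exact/spL/spG.
exists (size W), (fun i => nth 0 W i) => x; have [c ->] := spM x.
exists (\row_i c (nth 0 W i)); rewrite (big_nth 0) big_mkord.
by apply: eq_bigr => i _; rewrite mxE.
Qed.
End FiniteDimension.

(** An idempotent on coordinates is carried to [M] by the basis; commuting with vertices, arrows and
    scalars, it commutes with the whole path algebra. *)
Lemma mxmod_indec (k : fieldType) (Q : quiver) (M : lmodType (path_alg k Q))
    (N := restr (kscal (path_alg k Q)) M) (d : nat)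
    (b : 'I_d -> N) (co : N -> 'rV[k]_d)
    (op := fun (l : path_alg k Q) (x : N) => (l *: (x : M) : N))
    (rE : mxrep (fun i => opmx b co op (pe k i)) (fun a => opmx b co op (pa k a))) :
  (forall x, x = \sum_i co x 0 i *: b i) ->
  (forall c : 'rV_d, co (\sum_i c 0 i *: b i) = c) ->
  indecomposable M -> qindec (mxmod rE).
Proof.
move=> coK Kco Mid.
have opD l x y : op l (x + y) = op l x + op l y by exact: (scalerDr l (x : M) y).
have opZ l c x : op l (c *: x) = c *: op l x.
  rewrite /op [in LHS](_ : c *: x = kscal (path_alg k Q) c *: (x : M)) //.
  by rewrite scalerA -kscalC -scalerA.
have opL l v : op l (lcomb b v) = lcomb b (v *m opmx b co op l).
  exact: op_lcomb.
have coL v : co (lcomb b v) = v by exact: Kco.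
split.
  have [x x0] := Mid.1; exists (co x).
  apply: contra_notN x0 => /eqP E; rewrite [x]coK E big1 // => i _.
  by rewrite mxE scale0r.
move=> e [ee ea] idem.
pose p (x : N) : N := lcomb b (e (co x)).
have pL v : p (lcomb b v) = lcomb b (e v) by rewrite /p coL.
have Lco x : lcomb b (co x) = x by rewrite /lcomb -coK.
have pD x y : p (x + y) = p x + p y.
  by rewrite -[x]Lco -[y]Lco -linearD !pL !linearD.
have pop l x : p (op l x) = op l (p x).
  elim/path_alg_ind: l x => [i|a|c|l m IHl IHm|l m IHl IHm] x.
  - rewrite -[x]Lco opL !pL opL; congr lcomb.
    by have := ee i (co x); rewrite /= !lfunE.
  - rewrite -[x]Lco opL !pL opL; congr lcomb.
    by have := ea a (co x); rewrite /= !lfunE.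
  - rewrite [op _ x](_ : _ = c *: x) // [RHS](_ : _ = c *: p x) //.
    by rewrite -[x]Lco -linearZ /= !pL !linearZ.
  - by rewrite /op !scalerDl pD -/(op l x) -/(op m x) IHl IHm.
  - by rewrite /op -!scalerA -/(op m x) -/(op l _) IHl IHm.
have p_lin : linear (p : M -> M).
  by move=> l x y; rewrite [LHS]pD; congr (_ + _); exact: pop.
pose p' : {linear M -> M} := HB.pack (p : M -> M) (GRing.isLinear.Build _ _ _ _ _ p_lin).
have [x|p0|p1] := indecomposable_idem Mid (p := p').
- by rewrite /= /p coL idem.
- left; apply/lfunP => v; rewrite zero_lfunE; apply: (lcomb_inj Kco).
  by rewrite -pL linear0; exact: p0.
- right; apply/lfunP => v; rewrite id_lfunE; apply: (lcomb_inj Kco).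
  by rewrite -pL; exact: p1.
Qed.

(** All that the deformation argument takes from the representation theory of [Q]. *)
Lemma module_mxext0 (k : fieldType) (Q : quiver) (M : lmodType (path_alg k Q))
    (N := restr (kscal (path_alg k Q)) M)
    (op := fun (l : path_alg k Q) (x : N) => (l *: (x : M) : N)) :
  finite_rep_type k Q -> fin_gen M -> indecomposable M ->
  exists (d : nat) (b : 'I_d -> N) (co : N -> 'rV[k]_d),
    [/\ forall x, x = \sum_i co x 0 i *: b i,
        forall c : 'rV_d, co (\sum_i c 0 i *: b i) = c &
        mxext0 (fun i => opmx b co op (pe k i)) (fun a => opmx b co op (pa k a))].
Proof.
move=> /finite_type_bounded[D bd] Mfg Mid.
have [r [f fs]] := fin_gen_spans bd Mfg.
have [d [b [co [coK Kco]]]] := finite_basis fs.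
exists d, b, co; split=> //.
have rE : mxrep (fun i => opmx b co op (pe k i)) (fun a => opmx b co op (pa k a)).
  apply: opmx_mxrep => //.
  - by move=> l x y; exact: (scalerDr l (x : M) y).
  - move=> l c x; rewrite /op [in LHS](_ : c *: x = kscal (path_alg k Q) c *: (x : M)) //.
    by rewrite scalerA -kscalC -scalerA.
  - by move=> l m x; exact: (scalerDl (x : M) l m).
  - by move=> l m x; rewrite /op scalerA.
  - by move=> x; exact: scale1r.
by apply: (@mxmod_ext0 _ _ _ _ _ rE); apply: bounded_ext0 bd _ _; apply: mxmod_indec.
Qed.

(** * Bases of lifts *)

Lemma sum_widen (V : nmodType) (I : eqType) (s t : seq I) (F : I -> V) :
  uniq s -> uniq t -> {subset s <= t} -> (forall i, i \notin s -> F i = 0) ->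
  \sum_(i <- s) F i = \sum_(i <- t) F i.
Proof.
move=> us ut st F0; rewrite [RHS](bigID (mem s)) /= [X in _ + X]big1 ?addr0 //.
rewrite -[RHS]big_filter; apply/perm_big/uniq_perm; rewrite ?filter_uniq //.
by move=> i; rewrite mem_filter /=; case: (boolP (i \in s)) => // /st->.
Qed.

Section FreeCoordinates.
Variables (R : comNzRingType) (N : lmodType R).
Local Open Scope classical_set_scope.
Variable B : set N.
Hypothesis BP : is_basis B.

Lemma basis_coords : exists c : N -> N -> R,
  [/\ forall a x y b, B b -> c (a *: x + y) b = a * c x b + c y b,
      forall b b', B b -> B b' -> c b b' = (b == b')%:R &
      forall x, exists s : seq N, [/\ uniq s, {in s, forall b, B b},
        forall b, b \notin s -> c x b = 0 & x = \sum_(b <- s) c x b *: b]].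
Proof.
have [gen ind] := BP.
pose P x (p : seq N * (N -> R)) := [/\ uniq p.1, {in p.1, forall b, B b},
   forall b, b \notin p.1 -> p.2 b = 0 & x = \sum_(b <- p.1) p.2 b *: b].
have /choice[f fP] : forall x, exists p, P x p.
  move=> x; have [s sB [c ->]] := gen x.
  (* The sequence [s] may repeat an element, whose coefficient is then multiplied by its
     multiplicity. *)
  exists (undup s, fun b => if b \in s then c b *+ count_mem b s else 0).
  split=> /=; rewrite ?undup_uniq //.
  - by move=> b; rewrite mem_undup; exact: sB.
  - by move=> b; rewrite mem_undup => /negPf->.
  rewrite -big_undup_iterop_count big_seq [RHS]big_seq; apply: eq_bigr => b.
  by rewrite mem_undup => ->; rewrite -scalerMnl.
have f1 x : uniq (f x).1 by case: (fP x).
have f2 x : {in (f x).1, forall b, B b} by case: (fP x).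
have f3 x b : b \notin (f x).1 -> (f x).2 b = 0 by case: (fP x) => _ _ H _ /H.
have f4 x : x = \sum_(b <- (f x).1) (f x).2 b *: b by case: (fP x).
have widen z (s t : seq N) (c : N -> R) : uniq s -> uniq t ->
    {subset s <= t} -> (forall b, b \notin s -> c b = 0) ->
    z = \sum_(b <- s) c b *: b -> \sum_(b <- t) c b *: b = z.
  move=> us ut st c0 ->; symmetry; apply: sum_widen => // b bs.
  by rewrite c0 ?scale0r.
have uniqueness x (s : seq N) (c : N -> R) : uniq s -> {in s, forall b, B b} ->
    (forall b, b \notin s -> c b = 0) -> x = \sum_(b <- s) c b *: b ->
    forall b, c b = (f x).2 b.
  move=> us sB c0 xE b; pose t := undup (s ++ (f x).1).
  have tP b' : (b' \in t) = (b' \in s) || (b' \in (f x).1).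
    by rewrite mem_undup mem_cat.
  have [bt|] := boolP (b \in t); last first.
    by rewrite tP negb_or => /andP[/c0-> /f3->].
  apply/eqP; rewrite -subr_eq0; apply/eqP.
  apply: (ind t _ _ (fun b => c b - (f x).2 b)) => //; rewrite ?undup_uniq //.
    by move=> b'; rewrite tP => /orP[/sB|/f2].
  under eq_bigr do rewrite scalerBl.
  rewrite sumrB (widen x s) ?undup_uniq //; last first.
    by move=> b' b's; rewrite tP b's.
  rewrite (widen x (f x).1) ?undup_uniq ?subrr // => [b' b's|]; last exact: f3.
  by rewrite tP b's orbT.
exists (fun x => (f x).2); split.
- move=> a x y b Bb; pose t := undup ((f x).1 ++ (f y).1).
  have tP b' : (b' \in t) = (b' \in (f x).1) || (b' \in (f y).1).
    by rewrite mem_undup mem_cat.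
  rewrite -(uniqueness _ t (fun b => a * (f x).2 b + (f y).2 b)) ?undup_uniq //.
  + by move=> b'; rewrite tP => /orP[/f2|/f2].
  + by move=> b'; rewrite tP negb_or => /andP[/f3-> /f3->]; rewrite mulr0 addr0.
  under eq_bigr do rewrite scalerDl -scalerA.
  rewrite big_split -scaler_sumr /= (widen x (f x).1) ?undup_uniq //; first last.
  + exact: f3.
  + by move=> b' b's; rewrite tP b's.
  rewrite (widen y (f y).1) ?undup_uniq // => [b' b's|]; last exact: f3.
  by rewrite tP b's orbT.
- move=> b b' Bb Bb'; rewrite -(uniqueness b [:: b] (fun z => (b == z)%:R)) //.
  + by move=> z; rewrite inE => /eqP->.
  + by move=> z; rewrite inE eq_sym => /negPf->.
  by rewrite big_seq1 eqxx scale1r.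
by move=> x; exists (f x).1; exact: (fP x).
Qed.
End FreeCoordinates.

Section FreeReduction.
Variables (k : fieldType) (S : comNzRingType).
Variables (aug : {rmorphism S -> k}) (iota : {rmorphism k -> S}).
Hypothesis augK : cancel iota aug.
Hypothesis aug_unit : forall x, aug x = 1 -> exists y, y * x = 1.
Variables (N : lmodType S) (V : lmodType k) (d : nat).
Variables (v : 'I_d -> V) (co : V -> 'rV[k]_d).
Hypothesis coK : forall x, x = \sum_i co x 0 i *: v i.
Hypothesis Kco : forall c : 'rV_d, co (\sum_i c 0 i *: v i) = c.
Variable psi : N -> V.
Hypothesis psiD : forall x y, psi (x + y) = psi x + psi y.
Hypothesis psiZ : forall c x, psi (c *: x) = aug c *: psi x.
Hypothesis psi_surj : forall y, exists x, psi x = y.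
(** A stand-in for the statement that the kernel of [psi] is the maximal ideal times [N], tested on
    linear forms. *)
Hypothesis psi_ker : forall l : N -> S,
  (forall c x y, l (c *: x + y) = c * l x + l y) ->
  forall x, psi x = 0 -> aug (l x) = 0.

Lemma psi_sum (I : Type) (s : seq I) (F : I -> N) :
  psi (\sum_(i <- s) F i) = \sum_(i <- s) psi (F i).
Proof.
have psi0 : psi 0 = 0 by rewrite -(scale0r (0 : N)) psiZ rmorph0 scale0r.
exact: (big_morph _ psiD psi0).
Qed.

Lemma psi_lcomb r (f : 'I_r -> N) c :
  psi (lcomb f c) = lcomb (psi \o f) (map_mx aug c).
Proof.
by rewrite /lcomb psi_sum; apply: eq_bigr => i _; rewrite psiZ mxE.
Qed.

Lemma map_augK m n (A : 'M[k]_(m, n)) : map_mx aug (map_mx iota A) = A.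
Proof. by apply/matrixP => i j; rewrite !mxE augK. Qed.

Lemma unitmx_aug (F : 'M[S]_d) (G : 'M[k]_d) : map_mx aug F *m G = 1%:M ->
  exists2 K, K *m F = 1%:M & F *m K = 1%:M.
Proof.
move=> FG; have [|y yF] := @aug_unit (\det F * iota (\det G)).
  (* Since [aug_unit] only inverts elements of augmentation 1, the determinant of [F] is first
     rescaled by a lift of that of [G]. *)
  by rewrite rmorphM augK /= -det_map_mx -det_mulmx FG det1.
have E : y * iota (\det G) * \det F = 1 by rewrite -mulrA [iota _ * _]mulrC.
exists ((y * iota (\det G)) *: \adj F).
  by rewrite -scalemxAl mul_adj_mx scale_scalar_mx E.
by rewrite -scalemxAr mul_mx_adj scale_scalar_mx E.
Qed.

Lemma free_reduction_basis : is_free N ->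
  exists (x : 'I_d -> N) (coN : N -> 'rV[S]_d),
    [/\ forall z, z = \sum_i coN z 0 i *: x i,
        forall c : 'rV_d, coN (\sum_i c 0 i *: x i) = c &
        forall i, psi (x i) = v i].
Proof.
move=> [B BP]; have [cB [cBlin cBB cBs]] := basis_coords BP.
have /choice[x xE] : forall i, exists x, psi x = v i by move=> i; exact: psi_surj.
have /choice[s sP] := cBs.
have s1 z : uniq (s z) by case: (sP z).
have s2 z : {in s z, forall b, B b} by case: (sP z).
have s3 z b : b \notin s z -> cB z b = 0 by case: (sP z) => _ _ H _ /H.
have s4 z : z = \sum_(b <- s z) cB z b *: b by case: (sP z).
pose T := undup (flatten [seq s (x i) | i <- enum 'I_d]).
have TB b : b \in T -> B b.
  by rewrite mem_undup => /flattenP[t /mapP[i _ ->]]; exact: s2.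
have xT i b : b \in s (x i) -> b \in T.
  rewrite mem_undup => bs; apply/flattenP; exists (s (x i)) => //.
  by apply: map_f; rewrite mem_enum.
pose lift (c : 'rV[k]_d) : N := lcomb x (map_mx iota c).
have psi_lift c : psi (lift c) = \sum_i c 0 i *: v i.
  rewrite psi_lcomb map_augK; apply: eq_bigr => i _; by rewrite /= xE.
(* Modulo the maximal ideal the coordinate along [b] factors through [psi], so its values on the
   [x i] determine it. *)
have key z b : B b -> aug (cB z b) = \sum_i co (psi z) 0 i * aug (cB (x i) b).
  move=> Bb; have l_lin c y y' : cB (c *: y + y') b = c * cB y b + cB y' b.
    exact: cBlin.
  have c0 : cB 0 b = 0.
    by have := l_lin (-1) 0 0; rewrite scaler0 addr0 mulN1r addNr.
  have y0 : psi (-1 *: lift (co (psi z)) + z) = 0.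
    by rewrite psiD psiZ rmorphN1 scaleN1r psi_lift -coK addNr.
  have := psi_ker l_lin y0.
  rewrite l_lin rmorphD rmorphM rmorphN1 mulN1r addrC => /eqP.
  rewrite subr_eq0 => /eqP ->.
  have lsum (F : 'I_d -> N) : cB (\sum_i F i) b = \sum_i cB (F i) b.
    apply: (big_morph (fun y => cB y b)) => // y y'.
    by rewrite -[y in LHS]scale1r l_lin mul1r.
  rewrite lsum rmorph_sum; apply: eq_bigr => i _.
  by rewrite -[_ *: _]addr0 l_lin c0 addr0 rmorphM mxE augK.
(* If no [x i] involved [b], then [key] would make the coordinate of [b] along itself vanish in [k],
   but it is 1. So the basis is finite. *)
have Bsub b : B b -> b \in T.
  move=> Bb; apply: contrapT => /negP bT.
  have := key b b Bb; rewrite cBB // eqxx rmorph1 big1 => [/eqP|i _].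
    by rewrite oner_eq0.
  by rewrite s3 ?rmorph0 ?mulr0 //; apply: contra bT; exact: xT.
pose r := size T; pose f (j : 'I_r) : N := nth 0 T j.
have fB j : B (f j) by apply/TB/mem_nth.
have ff j j' : (f j == f j') = (j == j') by rewrite nth_uniq // undup_uniq.
pose coF (z : N) : 'rV[S]_r := \row_j cB z (f j).
have coFK z : lcomb f (coF z) = z.
  rewrite [RHS]s4 /lcomb /f.
  under eq_bigr do rewrite mxE.
  rewrite -(big_mkord xpredT (fun j => cB z (nth 0 T j) *: nth 0 T j)).
  rewrite -(big_nth 0 xpredT (fun b => cB z b *: b)); symmetry.
  apply: sum_widen; rewrite ?undup_uniq // => b; first by move=> /s2/Bsub.
  by move=> bs; rewrite s3 ?scale0r.
have KcoF c : coF (lcomb f c) = c.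
  apply/rowP => j; rewrite mxE /lcomb.
  have c0 : cB 0 (f j) = 0.
    by have := cBlin (-1) 0 0 _ (fB j); rewrite scaler0 addr0 mulN1r addNr.
  have -> : cB (\sum_i c 0 i *: f i) (f j) = \sum_i cB (c 0 i *: f i) (f j).
    apply: (big_morph (fun y => cB y (f j))) => // y y'.
    by rewrite -[y in LHS]scale1r cBlin // mul1r.
  rewrite (bigD1 j) //= big1 => [|i ij]; rewrite -[_ *: _]addr0 cBlin // c0 addr0 cBB //.
    by rewrite eqxx mulr1 addr0.
  by rewrite ff (negPf ij) mulr0.
(* [H] writes the [x i] in the basis [f], and [G] writes the reductions of [f] in [v]. They are
   inverse to each other over [k], so [r = d] and [H] is invertible over [S]. *)
pose H : 'M[S]_(d, r) := \matrix_i coF (x i).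
pose G : 'M[k]_(r, d) := \matrix_j co (psi (f j)).
have GH : G *m map_mx aug H = 1%:M.
  apply/matrixP => j l; rewrite !mxE -ff -[RHS](rmorph_nat aug) -cBB // key //.
  by apply: eq_bigr => i _; rewrite !mxE.
have xH i : x i = lcomb f (row i H).
  by rewrite -[LHS]coFK; congr lcomb; apply/rowP => j; rewrite !mxE.
have psi_f (c : 'rV[k]_r) : lcomb (psi \o f) c = lcomb v (c *m G).
  rewrite /lcomb; under [RHS]eq_bigr do rewrite mxE scaler_suml.
  rewrite exchange_big; apply: eq_bigr => j _ /=.
  rewrite [psi (f j)]coK scaler_sumr; apply: eq_bigr => i _.
  by rewrite scalerA mxE.
have HG : map_mx aug H *m G = 1%:M.
  apply/row_matrixP => i; apply: (can_inj Kco : injective (lcomb v)).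
  by rewrite row_mul -map_row -psi_f -psi_lcomb -xH xE rowE mulmx1 lcomb_delta.
have rd : r = d by apply/eqP; rewrite eqn_leq (mulmx1_min GH) (mulmx1_min HG).
clearbody r; subst r.
have [K KH HK] := unitmx_aug HG.
have lcombx (c : 'rV_d) : lcomb x c = lcomb f (c *m H).
  rewrite /lcomb; under [RHS]eq_bigr do rewrite mxE scaler_suml.
  rewrite exchange_big; apply: eq_bigr => i _ /=.
  rewrite xH scaler_sumr; apply: eq_bigr => j _.
  by rewrite scalerA mxE.
exists x, (fun z => coF z *m K); split=> // [z|c].
  by rewrite -/(lcomb x _) lcombx -mulmxA KH mulmx1 coFK.
by rewrite -/(lcomb x _) lcombx KcoF -mulmxA HK mulmx1.
Qed.
End FreeReduction.

(** * Complete local algebras *)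

Section IdealPowers.
Local Open Scope classical_set_scope.
Variables (R : comPzRingType) (I : set R).

Lemma ideal_powD n x y :
  ideal_pow I n x -> ideal_pow I n y -> ideal_pow I n (x + y).
Proof.
case: n => // n [s sP ->] [t tP ->]; exists (s ++ t); last by rewrite big_cat.
by move=> p; rewrite mem_cat => /orP[/sP|/tP].
Qed.

Lemma ideal_powMl n a x : ideal_pow I n x -> ideal_pow I n (a * x).
Proof.
elim: n a x => // n IHn a x [s sP ->].
exists [seq (p.1, a * p.2) | p <- s].
  by move=> _ /mapP[p /sP[p1 p2] ->]; split=> //; exact: IHn.
by rewrite big_map mulr_sumr; apply: eq_bigr => p _; rewrite mulrCA.
Qed.

Lemma ideal_powX n x : I x -> ideal_pow I n (x ^+ n).
Proof.
move=> Ix; elim: n => // n IHn; exists [:: (x, x ^+ n)].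
  by move=> p; rewrite inE => /eqP->.
by rewrite big_seq1 exprS.
Qed.

Lemma ideal_pow0 n : ideal_pow I n 0.
Proof. by case: n => // n; exists [::]; rewrite ?big_nil. Qed.

Lemma ideal_pow1 x : (forall a y, I y -> I (y * a)) ->
  (forall y z, I y -> I z -> I (y + z)) -> I 0 -> ideal_pow I 1 x -> I x.
Proof.
move=> IM ID I0 [s sP ->]; rewrite big_seq; elim/big_ind: _ => //.
by move=> p /sP[p1 _]; exact: IM.
Qed.
End IdealPowers.

Section CompleteLocal.
Variables (k : fieldType).

(** The inverse is the limit of the geometric series in [y = 1 - x]; the error lies in every power
    of the maximal ideal, hence is 0. *)
Lemma chat_unit (S : chat k) (x : S) : chat_aug S x = 1 -> exists y, y * x = 1.
Proof.
move=> x1; pose y := 1 - x.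
have Iy : max_ideal (R := S) y by rewrite /max_ideal /= /y rmorphB rmorph1 /= x1 subrr.
have [sep compl] := chat_complete S.
pose u n := \sum_(i < n) y ^+ i.
have xu n : x * u n = 1 - y ^+ n.
  have {1}-> : x = - (y - 1) by rewrite opprB /y subKr.
  by rewrite mulNr -subrX1 opprB.
have [n|z zP] := compl u.
  by rewrite /u big_ord_recr /= [X in X - _]addrC addrK; exact: ideal_powX.
exists z; apply/eqP; rewrite -subr_eq0; apply/eqP/sep => n.
have -> : z * x - 1 = x * (z - u n) + (-1) * y ^+ n.
  by rewrite mulrBr xu mulN1r opprB mulrC addrA addrAC addrK.
by apply: ideal_powD; apply: ideal_powMl; [exact: zP|exact: ideal_powX].
Qed.

Lemma ideal_pow1_aug (S : chat k) (x : S) :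
  ideal_pow (max_ideal (R := S)) 1 x -> chat_aug S x = 0.
Proof.
apply: ideal_pow1; rewrite /max_ideal /=; last exact: rmorph0.
  by move=> a y y0; rewrite rmorphM /= y0 mul0r.
by move=> y z y0 z0; rewrite rmorphD /= y0 z0 addr0.
Qed.

Lemma lrmorphism_ext (A B : lalgType k) (f g : {lrmorphism A -> B}) :
  f =1 g -> f = g.
Proof.
case: f g => [f [f1 f2 f3]] [g [g1 g2 g3]] /= /funext fg; subst g.
have -> : f1 = g1.
  by case: f1 g1 => ? [?]; congr Algebra.isNmodMorphism.Axioms_; exact: Prop_irrelevance.
have -> : f2 = g2.
  by case: f2 g2 => ? [?]; congr GRing.isMonoidMorphism.Axioms_; exact: Prop_irrelevance.
have -> : f3 = g3.
  by case: f3 g3 => ? [?]; congr GRing.isScalable.Axioms_; exact: Prop_irrelevance.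
by [].
Qed.

Lemma chat_hom_ext (R S : chat k) (f g : chat_hom R S) : f =1 g -> f = g.
Proof.
case: f g => [f fa fc] [g ga gc] /= /lrmorphism_ext fg; subst g.
by congr ChatHom; exact: Prop_irrelevance.
Qed.

Lemma chat_aug_cont (S : chat k) :
  adic_continuous (S := chat_field k) (chat_aug S).
Proof.
move=> x n; exists 1%N => y /ideal_pow1_aug; rewrite rmorphB => ->.
exact: ideal_pow0.
Qed.

Definition chat_to_field (S : chat k) : chat_hom S (chat_field k) :=
  @ChatHom k S (chat_field k) (chat_aug S) (fun=> erefl) (@chat_aug_cont S).

Definition chat_in_alg (S : chat k) (c : k^o) : S := c%:A.

Fact chat_in_alg_zmod (S : chat k) : zmod_morphism (@chat_in_alg S).
Proof. by move=> a b; rewrite /chat_in_alg scalerBl. Qed.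
Fact chat_in_alg_monoid (S : chat k) : monoid_morphism (@chat_in_alg S).
Proof.
split=> [|a b]; rewrite /chat_in_alg ?scale1r //.
by rewrite -scalerAl mul1r scalerA.
Qed.
Fact chat_in_alg_scalable (S : chat k) : scalable (@chat_in_alg S).
Proof. by move=> a b; rewrite /chat_in_alg scalerA. Qed.
HB.instance Definition _ (S : chat k) :=
  GRing.isZmodMorphism.Build k^o S (@chat_in_alg S) (@chat_in_alg_zmod S).
HB.instance Definition _ (S : chat k) :=
  GRing.isMonoidMorphism.Build k^o S (@chat_in_alg S) (@chat_in_alg_monoid S).
HB.instance Definition _ (S : chat k) :=
  GRing.isScalable.Build k k^o S _ (@chat_in_alg S) (@chat_in_alg_scalable S).


Fact chat_in_alg_aug (S : chat k) c : chat_aug S (@chat_in_alg S c) = c.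
Proof. by rewrite linearZ /= rmorph1 [LHS]mulr1. Qed.

Fact chat_in_alg_cont (S : chat k) :
  adic_continuous (R := chat_field k) (@chat_in_alg S).
Proof.
move=> x n; exists 1%N => y /ideal_pow1_aug E; rewrite -rmorphB.
have -> : (y - x : k^o) = 0 by exact: E.
by rewrite rmorph0; exact: ideal_pow0.
Qed.

Definition chat_of_field (S : chat k) : chat_hom (chat_field k) S :=
  @ChatHom k (chat_field k) S (@chat_in_alg S) (@chat_in_alg_aug S)
    (@chat_in_alg_cont S).

(** Linearity and the image of 1 leave no choice, so the Hom sets out of [k] match a deformation
    functor that is a point. *)
Lemma chat_hom_of_field (S : chat k) (f g : chat_hom (chat_field k) S) : f = g.
Proof.
apply: chat_hom_ext => c.
have fE (h : chat_hom (chat_field k) S) : h c = c%:A.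
  have -> : c = c *: (1 : chat_field k) by rewrite [RHS]mulr1.
  by rewrite linearZ rmorph1 [c *: 1]mulr1.
by rewrite !fE.
Qed.
End CompleteLocal.

(** * Lifts over a fixed ring are isomorphic *)

Section Lifts.
Variables (k : fieldType) (Q : quiver) (M : lmodType (path_alg k Q)).
Local Notation Lam := (path_alg k Q).
Local Notation Mk := (restr (kscal Lam) M).
Variable S : chat k.

Definition augr : {rmorphism S -> k} := chat_aug S.
Definition iotar : {rmorphism k -> S} := in_alg S.

Lemma iotarK : cancel iotar augr.
Proof. by move=> c; exact: (@chat_in_alg_aug k S c). Qed.

Section OneLift.
Variable L : prelift M S.
Local Notation N := (lift_mod L).
Definition lift_base : lmodType S := restr (tens_inl (alg_of S) Lam) N.

Definition lift_op (l : Lam) (x : lift_base) : lift_base :=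
  (tens (1 : alg_of S) l *: (x : N) : N).

(** The map sending [n] to [phi(1 (x) n)], semilinear along the augmentation; it takes the place of
    the tensor product in what follows. *)
Definition lift_red (x : lift_base) : Mk :=
  lift_map L (bpure (chat_aug S) 1 (x : N)).

Lemma lift_redD x y : lift_red (x + y) = lift_red x + lift_red y.
Proof. by rewrite /lift_red bpureDr raddfD. Qed.

Lemma lift_red_op l x : lift_red (lift_op l x) = (l *: (lift_red x : M) : M).
Proof.
rewrite /lift_red /lift_op -[RHS]linearZ; congr (lift_map L _).
by rewrite [RHS]bscale_pure mulr1.
Qed.

Lemma bpure_scal c (n : N) :
  bpure (chat_aug S) c n = bpure (chat_aug S) 1 (tens (c%:A : alg_of S) 1 *: n).
Proof.
by rewrite -bpureZ [X in bpure _ (X * _)](@chat_in_alg_aug k S c) mulr1.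
Qed.

Lemma tens_kscal c : tens (1 : alg_of S) (kscal Lam c) = tens (c%:A : alg_of S) 1.
Proof. by rewrite -[kscal Lam c]mulr1 tens_scalr -tens_scall mulr1. Qed.

Lemma lift_redZ c x : lift_red (c *: x) = augr c *: lift_red x.
Proof.
rewrite [RHS](_ : _ = kscal Lam (augr c) *: (lift_red x : M)) //.
rewrite -lift_red_op /lift_red /lift_op tens_kscal -bpure_scal.
suff -> : bpure (chat_aug S) (augr c : k^o) x =
    bpure (chat_aug S) 1 (tens (c : alg_of S) 1 *: (x : N)) by [].
by rewrite -bpureZ mulr1.
Qed.

(** The scalars [k] lift to [S], so they can be moved across the tensor sign. *)
Lemma reduction_pure (z : reduction N) :
  exists n : N, z = bpure (chat_aug S) 1 n :> bchange (chat_aug S) N.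
Proof.
elim/bpure_ind: (z : bchange (chat_aug S) N) => [c n|_ _ [n ->] [n' ->]].
  by exists (tens (c%:A : alg_of S) 1 *: n); exact: bpure_scal.
by exists (n + n'); rewrite bpureDr.
Qed.

Hypothesis Llift : is_lift L.

Lemma lift_red_surj y : exists x, lift_red x = y.
Proof.
have [_ _ [g _ gK]] := Llift; rewrite -[y]gK.
by have [n ->] := reduction_pure (g y); exists n.
Qed.

(** The form [l] induces a map on [k (x) N], sending [a (x) n] to [a] times the augmentation of
    [l n]. By injectivity of [phi], [1 (x) x] is 0 there. *)
Lemma lift_red_ker (l : lift_base -> S) :
  (forall c x y, l (c *: x + y) = c * l x + l y) ->
  forall x, lift_red x = 0 -> augr (l x) = 0.
Proof.
move=> l_lin x x0.
have l0 : l 0 = 0 by have := l_lin (-1) 0 0; rewrite scaler0 addr0 mulN1r addNr.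
have lD y z : l (y + z) = l y + l z by rewrite -[y in LHS]scale1r l_lin mul1r.
have lZ c y : l (c *: y) = c * l y by rewrite -[_ *: _]addr0 l_lin l0 addr0.
pose h (a : restr (chat_aug S) (k^o : comAlgType k)^o)
  (n : restr (tens_inl (alg_of S) Lam) N) : k := (a : k) * augr (l n).
have bal : balanced h.
  split=> [a a' n|a n n'|r a n]; rewrite /h.
  - exact: mulrDl.
  - by rewrite lD rmorphD mulrDr.
  - have -> : ((r *: a : restr (chat_aug S) (k^o : comAlgType k)^o) : k) =
      augr r * (a : k) by [].
    by rewrite [l (_ *: _)]lZ rmorphM mulrCA mulrA.
have [_ _ /bij_inj finj] := Llift.
have {}x0 : bpure (chat_aug S) 1 (x : N) = 0.
  by apply: (finj _ 0); rewrite [RHS]raddf0.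
have := tlift_pure bal 1 x; rewrite [tpure _ _]x0 /h mul1r => <-.
by apply: (addrI (tlift h 0)); rewrite -(tliftD bal) !addr0.
Qed.
End OneLift.

Variables (d : nat) (b : 'I_d -> Mk) (co : Mk -> 'rV[k]_d).
Hypothesis coK : forall x, x = \sum_i co x 0 i *: b i.
Hypothesis Kco : forall c : 'rV_d, co (\sum_i c 0 i *: b i) = c.
Let op (l : Lam) (x : Mk) : Mk := (l *: (x : M) : M).

Lemma augr_unit x : augr x = 1 -> exists y, y * x = 1.
Proof. exact: chat_unit. Qed.

Lemma lift_basis (L : prelift M S) : is_lift L ->
  exists (x : 'I_d -> lift_base L) (coN : lift_base L -> 'rV[S]_d),
    [/\ forall z, z = \sum_i coN z 0 i *: x i,
        forall c : 'rV_d, coN (\sum_i c 0 i *: x i) = c &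
        forall i, lift_red (x i) = b i].
Proof.
move=> Llift; have [_ Lfree _] := Llift.
apply: (free_reduction_basis iotarK augr_unit coK Kco) => //.
- exact: lift_redD.
- exact: lift_redZ.
- exact: lift_red_surj.
- exact: lift_red_ker.
Qed.

Section LiftOperators.
Variable L : prelift M S.

Lemma lift_opD l x y : lift_op (L := L) l (x + y) = lift_op l x + lift_op l y.
Proof. exact: (scalerDr _ (x : lift_mod L) y). Qed.

Lemma lift_scale c (x : lift_base L) :
  c *: x = (tens (c : alg_of S) (1 : Lam) *: (x : lift_mod L) : lift_mod L).
Proof. by []. Qed.

Lemma lift_opZ l c x : lift_op (L := L) l (c *: x) = c *: lift_op l x.
Proof.
by rewrite !lift_scale /lift_op !scalerA !tensM !mulr1 !mul1r.
Qed.

Lemma lift_opDl l m x : lift_op (L := L) (l + m) x = lift_op l x + lift_op m x.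
Proof. by rewrite /lift_op tensDr scalerDl. Qed.

Lemma lift_opM l m x : lift_op (L := L) (l * m) x = lift_op l (lift_op m x).
Proof. by rewrite /lift_op scalerA tensM mulr1. Qed.

Lemma lift_op1 x : lift_op (L := L) 1 x = x.
Proof. by rewrite /lift_op tens1 scale1r. Qed.

Lemma lift_op_kscal c x : lift_op (L := L) (kscal Lam c) x = c%:A *: x.
Proof. by rewrite /lift_op tens_kscal. Qed.

Lemma lift_tens a l (x : lift_mod L) :
  tens (a : alg_of S) l *: x = a *: lift_op l (x : lift_base L) :> lift_base L.
Proof. by rewrite lift_scale /lift_op scalerA tensM mulr1 mul1r. Qed.
End LiftOperators.

Section LiftMatrices.
Variables (L : prelift M S) (x : 'I_d -> lift_base L) (coN : lift_base L -> 'rV[S]_d).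
Hypothesis coNK : forall z, z = \sum_i coN z 0 i *: x i.
Hypothesis KcoN : forall c : 'rV_d, coN (\sum_i c 0 i *: x i) = c.
Hypothesis xb : forall i, lift_red (x i) = b i.

Lemma lift_red_lcomb v : lift_red (lcomb x v) = lcomb b (map_mx augr v).
Proof.
rewrite (psi_lcomb (@lift_redD L) (@lift_redZ L)) /lcomb.
by apply: eq_bigr => i _; rewrite /= xb.
Qed.

Lemma red_opmx l : map_mx augr (opmx x coN (@lift_op L) l) = opmx b co op l.
Proof.
apply/row_matrixP => i; apply: (lcomb_inj Kco).
rewrite -map_row -lift_red_lcomb rowE.
rewrite -(op_lcomb coNK (@lift_opD L) (@lift_opZ L)) lift_red_op.
rewrite lcomb_delta xb [LHS]coK; apply: eq_bigr => j _.
by rewrite !mxE.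
Qed.
End LiftMatrices.

Hypothesis ext :
  mxext0 (fun i => opmx b co op (pe k i)) (fun a => opmx b co op (pa k a)).

Lemma lifts_iso (L L' : prelift M S) : is_lift L -> is_lift L' -> lift_iso L L'.
Proof.
move=> LL LL'; have [x [coN [coNK KcoN xb]]] := lift_basis LL.
have [x' [coN' [coNK' KcoN' xb']]] := lift_basis LL'.
have rE := opmx_mxrep coNK KcoN (@lift_opD L) (@lift_opZ L) (@lift_opDl L)
  (@lift_opM L) (@lift_op1 L).
have rE' := opmx_mxrep coNK' KcoN' (@lift_opD L') (@lift_opZ L') (@lift_opDl L')
  (@lift_opM L') (@lift_op1 L').
have redE := red_opmx coNK xb; have redE' := red_opmx coNK' xb'.
have [|||F [F1 FE FA]] := intertwiner iotarK augr_unit rE rE'.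
- by move=> i; rewrite redE redE'.
- by move=> a; rewrite redE redE'.
- rewrite (_ : (fun i => _) = fun i => opmx b co op (pe k i)); last first.
    by apply/funext => i; exact: redE.
  rewrite (_ : (fun a => map_mx _ _) = fun a => opmx b co op (pa k a)) //.
  by apply/funext => a; exact: redE.
(* The reduction 1 of [F] serves twice: it makes [F] invertible, and it makes the isomorphism
   compatible with the maps to [M], as both bases reduce to [b]. *)
have [K KF FK] : exists2 K, K *m F = 1%:M & F *m K = 1%:M.
  apply: (unitmx_aug iotarK augr_unit (G := 1%:M)).
  by rewrite F1 mulmx1.
have xK z : lcomb x (coN z) = z by rewrite [RHS]coNK.
pose f (z : lift_base L) : lift_base L' := lcomb x' (coN z *m F).
have fE v : f (lcomb x v) = lcomb x' (v *m F) by rewrite /f [coN _]KcoN.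
have fD y z : f (y + z) = f y + f z.
  by rewrite -[y]xK -[z]xK -linearD !fE mulmxDl linearD.
have fZ c z : f (c *: z) = c *: f z.
  by rewrite -[z]xK -linearZ !fE -scalemxAl linearZ.
have opL l v : lift_op l (lcomb x v) = lcomb x (v *m opmx x coN (@lift_op L) l).
  exact: (op_lcomb coNK (@lift_opD L) (@lift_opZ L)).
have opL' l v :
    lift_op l (lcomb x' v) = lcomb x' (v *m opmx x' coN' (@lift_op L') l).
  exact: (op_lcomb coNK' (@lift_opD L') (@lift_opZ L')).
have fop l z : f (lift_op l z) = lift_op l (f z).
  elim/path_alg_ind: l z => [i|a|c|l m IHl IHm|l m IHl IHm] z.
  - by rewrite -[z]xK opL !fE opL' -!mulmxA FE.
  - by rewrite -[z]xK opL !fE opL' -!mulmxA FA.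
  - by rewrite !lift_op_kscal fZ.
  - by rewrite !lift_opDl fD IHl IHm.
  - by rewrite !lift_opM IHl IHm.
pose g : lift_mod L -> lift_mod L' := f.
have g_zmod : zmod_morphism g by exact: (additive_zmod fD).
have g_scal : scalable g.
  apply: tens_scalable => [|a l z]; first exact: fD.
  by rewrite [RHS](lift_tens a l) /g -fop -fZ -lift_tens.
pose g' : {linear lift_mod L -> lift_mod L'} :=
  HB.pack g (GRing.isZmodMorphism.Build _ _ g g_zmod)
    (GRing.isScalable.Build _ _ _ _ g g_scal).
exists g'.
  exists (fun z : lift_base L' => lcomb x (coN' z *m K)) => z /=; rewrite /g /f.
    by rewrite [coN' _]KcoN' -mulmxA FK mulmx1 xK.
  by rewrite [coN _]KcoN -mulmxA KF mulmx1 [RHS]coNK'.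
move=> z; have [n ->] := reduction_pure z.
rewrite [reduction_map _ _](bmap_pure (chat_aug S) g' 1 n).
rewrite -[LHS]/(lift_red (f n)) -[RHS]/(lift_red (n : lift_base L)).
rewrite -[n]xK fE (lift_red_lcomb xb') (lift_red_lcomb xb).
by rewrite map_mxM F1 mulmx1.
Qed.
End Lifts.

(** * The trivial deformation *)

Lemma family_fin_gen (A : pzRingType) (N : lmodType A) d (x : 'I_d -> N) :
  (forall z, exists c : 'I_d -> A, z = \sum_i c i *: x i) -> fin_gen N.
Proof.
move=> H; exists (undup (codom x)) => z; have [c ->] := H z.
exists (fun y => \sum_(i | x i == y) c i).
under [RHS]eq_bigr do rewrite scaler_suml.
rewrite (exchange_big_dep predT) //=; apply: eq_bigr => i _.
rewrite -big_filter (_ : [seq _ <- _ | _] = [:: x i]) ?big_seq1 //.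
apply/perm_small_eq => //; apply: uniq_perm; rewrite ?filter_uniq ?undup_uniq // => y.
rewrite mem_filter [X in X && _](_ : _ = (x i == y)) // mem_undup inE eq_sym.
by case: eqP => // ->; rewrite codom_f.
Qed.

Lemma coords_is_free (R : comNzRingType) (N : lmodType R) d (x : 'I_d -> N)
    (co : N -> 'rV[R]_d) :
  (forall z, z = \sum_i co z 0 i *: x i) ->
  (forall c : 'rV_d, co (\sum_i c 0 i *: x i) = c) -> is_free N.
Proof.
move=> coK Kco.
have xinj : injective x.
  move=> i j; rewrite -!(lcomb_delta x) => /(lcomb_inj Kco)/rowP/(_ i)/eqP.
  by rewrite !mxE !eqxx /=; case: (i =P j) => // _; rewrite oner_eq0.
have ucodom : uniq (codom x) by apply/injectiveP.
have codomE (F : N -> N) : \sum_(y <- codom x) F y = \sum_i F (x i).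
  by rewrite big_map big_enum.
exists (range x); split=> [z|s us sx c c0 y ys].
  exists (codom x); first by move=> y /codomP[i ->]; exists i.
  exists (fun y => \sum_(i | x i == y) co z 0 i).
  rewrite codomE [LHS]coK; apply: eq_bigr => i _; congr (_ *: _).
  by rewrite (big_pred1 i) // => j; rewrite (inj_eq xinj).
pose v : 'rV[R]_d := \row_i (if x i \in s then c (x i) else 0).
have : lcomb x v = lcomb x 0.
  rewrite linear0 -[RHS]c0 /lcomb; under eq_bigr do rewrite mxE.
  rewrite -(codomE (fun y => (if y \in s then c y else 0) *: y)).
  rewrite -(@sum_widen _ _ s) //.
  - by rewrite big_seq [RHS]big_seq; apply: eq_bigr => z ->.
  - by move=> z /sx[i _ <-]; exact: codom_f.
  - by move=> z /negPf->; rewrite scale0r.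
move/(lcomb_inj Kco); have [i _ yE] := sx y ys.
by move/rowP/(_ i); rewrite !mxE yE ys.
Qed.

Section TrivialLift.
Variables (k : fieldType) (Lam : kalg k) (M : lmodType Lam).
Local Notation F := (chat_field k).
Local Notation T := (tensor_alg (alg_of F) Lam).

(** A copy of [M], made to carry a second module structure, in which [c (x) l] acts as [c l]. *)
Definition triv : Type := M.
HB.instance Definition _ := GRing.Zmodule.copy triv M.

Definition triv_s (c : k) (x : triv) : triv := kscal Lam c *: (x : M).
Definition triv_u (g : alg_of F * Lam) (x : triv) : triv :=
  (kscal Lam (g.1 : k) * g.2) *: (x : M).

Let sD c x y : triv_s c (x + y) = triv_s c x + triv_s c y.
Proof. exact: scalerDr. Qed.
Let uD g x y : triv_u g (x + y) = triv_u g x + triv_u g y.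
Proof. exact: scalerDr. Qed.
Let s1 x : triv_s 1 x = x.
Proof. by rewrite /triv_s rmorph1 scale1r. Qed.
Let sDl c e x : triv_s (c + e) x = triv_s c x + triv_s e x.
Proof. by rewrite /triv_s rmorphD scalerDl. Qed.
Let sM c e x : triv_s (c * e) x = triv_s c (triv_s e x).
Proof. by rewrite /triv_s rmorphM scalerA. Qed.
Let su c g x : triv_s c (triv_u g x) = triv_u g (triv_s c x).
Proof. by rewrite /triv_s /triv_u !scalerA kscalC. Qed.
Let relP t t' : tensor_alg_rel t t' ->
  aeval triv_s triv_u t =1 aeval triv_s triv_u t'.
Proof.
case=> [a a' l|a l l'|c a l|c a l|a a' l l'|] x;
  rewrite /= /triv_s /triv_u /= ?scalerA.
- by rewrite rmorphD mulrDl scalerDl.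
- by rewrite mulrDr scalerDl.
- rewrite [kscal Lam (_ * _)](_ : _ = kscal Lam c * kscal Lam (a : k)) ?mulrA //.
  by rewrite -rmorphM; congr (kscal Lam (_ * _)); exact: mulr1.
- by rewrite mulrA -(kscalC (_ : k)) -mulrA.
- by rewrite rmorphM !mulrA -[_ * l * _]mulrA -kscalC !mulrA.
- by rewrite rmorph1 mul1r !scale1r.
Qed.

HB.instance Definition _ := GRing.Zmodule_isLmodule.Build T triv
  (pactionA sD uD s1 sDl sM su relP) (paction1 sD uD s1 sDl sM su relP)
  (pactionDr sD uD s1 sDl sM su relP) (pactionDl sD uD s1 sDl sM su relP).

Lemma triv_tens (a : alg_of F) l (x : triv) :
  tens a l *: x = (kscal Lam (a : k) * l) *: (x : M) :> M.
Proof.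
rewrite -[LHS]/(paction _ _ _ _).
by rewrite (pactionE sD uD s1 sDl sM su relP).
Qed.

Definition triv_map : reduction (triv : lmodType T) -> M :=
  tlift (fun (a : restr (chat_aug F) (k^o : comAlgType k)^o)
    (n : restr (tens_inl (alg_of F) Lam) (triv : lmodType T)) =>
      kscal Lam (a : k) *: (n : M)).

Let bal : balanced
  (fun (a : restr (chat_aug F) (k^o : comAlgType k)^o)
    (n : restr (tens_inl (alg_of F) Lam) (triv : lmodType T)) =>
      kscal Lam (a : k) *: (n : M)).
Proof.
split=> [a a' n|a n n'|r a n].
- by rewrite rmorphD scalerDl.
- exact: scalerDr.
- have -> : ((r *: n : restr (tens_inl (alg_of F) Lam) (triv : lmodType T)) : M) =
    kscal Lam (r : k) *: (n : M).
    by rewrite -[LHS]/(tens (r : alg_of F) 1 *: (n : triv)) triv_tens mulr1.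
  have -> : ((r *: a : restr (chat_aug F) (k^o : comAlgType k)^o) : k) =
    (r : k) * (a : k) by [].
  by rewrite rmorphM scalerA kscalC.
Qed.

Lemma triv_map_pure a (n : triv) :
  triv_map (bpure (chat_aug F) a n) = kscal Lam (a : k) *: (n : M).
Proof. exact: tlift_pure bal _ _. Qed.

Let triv_mapD x y : triv_map (x + y) = triv_map x + triv_map y.
Proof. exact: tliftD bal _ _. Qed.
HB.instance Definition _ :=
  GRing.isZmodMorphism.Build _ _ triv_map (additive_zmod triv_mapD).

Fact triv_map_scalable : scalable triv_map.
Proof.
move=> l x; elim/bpure_ind: (x : bchange (chat_aug F) (triv : lmodType T)) => [a n|y z IHy IHz].
  rewrite -[l *: _]/(tens (1 : alg_of (k^o : comAlgType k)) l *:
    (bpure (chat_aug F) a n : bchange (chat_aug F) (triv : lmodType T))).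
  rewrite bscale_pure !triv_map_pure [tens _ _ *: _]triv_tens mul1r rmorph1 mul1r.
  by rewrite !scalerA kscalC.
by rewrite scalerDr !triv_mapD IHy IHz scalerDr.
Qed.
HB.instance Definition _ :=
  GRing.isScalable.Build _ _ _ _ triv_map triv_map_scalable.

Definition triv_lift : prelift M F := @Prelift k Lam M F (triv : lmodType T) triv_map.

Lemma triv_map_bij : bijective triv_map.
Proof.
exists (fun m => bpure (chat_aug F) 1 (m : triv)) => [x|m].
  elim/bpure_ind: (x : bchange (chat_aug F) (triv : lmodType T)) => [a n|y z IHy IHz].
    rewrite triv_map_pure.
    have -> : kscal Lam (a : k) *: (n : M) = tens (a : alg_of F) 1 *: (n : triv).
      by rewrite triv_tens mulr1.
    by rewrite -bpureZ mulr1.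
  by rewrite triv_mapD bpureDr IHy IHz.
by rewrite triv_map_pure rmorph1 scale1r.
Qed.
End TrivialLift.

Section TrivialDeformation.
Variables (k : fieldType) (Q : quiver) (M : lmodType (path_alg k Q)).
Local Notation Lam := (path_alg k Q).
Local Notation Mk := (restr (kscal Lam) M).
Variables (d : nat) (b : 'I_d -> Mk) (co : Mk -> 'rV[k]_d).
Hypothesis coK : forall x, x = \sum_i co x 0 i *: b i.
Hypothesis Kco : forall c : 'rV_d, co (\sum_i c 0 i *: b i) = c.
Local Notation U := (triv_lift M).

Lemma coords_is_lift (S : chat k) (L : prelift M S) (x : 'I_d -> lift_base L)
    (coN : lift_base L -> 'rV[S]_d) :
  (forall z, z = \sum_i coN z 0 i *: x i) ->
  (forall c : 'rV_d, coN (\sum_i c 0 i *: x i) = c) ->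
  bijective (lift_map L) -> is_lift L.
Proof.
move=> coNK KcoN bij; split=> //; last exact: (coords_is_free coNK KcoN).
apply: (@family_fin_gen _ (lift_mod L) d x) => z.
exists (fun i => tens (coN z 0 i : alg_of S) 1).
exact: coNK.
Qed.

Lemma triv_is_lift : is_lift U.
Proof.
have E c (x : Mk) : (c *: (x : lift_base U) : Mk) = c *: x.
  by rewrite [LHS](triv_tens (c : alg_of (chat_field k)) 1 (x : triv M)) mulr1.
apply: (@coords_is_lift _ _ (b : 'I_d -> lift_base U) co) => [z|c|].
- by rewrite [LHS]coK; apply: eq_bigr => i _; rewrite [RHS]E.
- by rewrite -[RHS]Kco; congr co; apply: eq_bigr => i _; rewrite [LHS]E.
- exact: triv_map_bij.
Qed.

Variables (S : chat k) (alpha : chat_hom (chat_field k) S).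
Local Notation L := (lift_change alpha U).

Definition change_basis (i : 'I_d) : lift_base L := bpure alpha 1 (b i : triv M).

Let h (a : restr alpha S^o)
  (n : restr (tens_inl (alg_of (chat_field k)) Lam) (lift_mod U)) : 'rV[S]_d :=
  \row_i ((a : S) * alpha (co (n : M) 0 i)).

Let h_bal : balanced h.
Proof.
have coD x y : co (x + y) = co x + co y.
  rewrite [x in LHS]coK [y in LHS]coK -!/(lcomb b _) -linearD; exact: Kco.
have coZ c x : co (c *: x) = c *: co x.
  rewrite [x in LHS]coK -!/(lcomb b _) -linearZ; exact: Kco.
split=> [a a' n|a n n'|r a n]; apply/rowP => i; rewrite !mxE.
- exact: mulrDl.
- by rewrite [co _]coD mxE rmorphD mulrDr.
have -> : ((r *: n : restr (tens_inl (alg_of (chat_field k)) Lam) (lift_mod U)) : M)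
    = (r : k) *: (n : Mk).
  by rewrite [LHS](triv_tens (r : alg_of (chat_field k)) 1 (n : triv M)) mulr1.
have -> : ((r *: a : restr alpha S^o) : S) = alpha r * (a : S) by [].
by rewrite coZ mxE [alpha (_ * _)]rmorphM mulrCA mulrA.
Qed.

Definition change_coords : lift_base L -> 'rV[S]_d := tlift h.

Lemma change_coords_pure a n : change_coords (bpure alpha a n) =
  \row_i (a * alpha (co (n : M) 0 i)).
Proof. exact: tlift_pure h_bal _ _. Qed.

Lemma change_coordsD x y :
  change_coords (x + y) = change_coords x + change_coords y.
Proof. exact: tliftD h_bal _ _. Qed.

Lemma change_scale c a n :
  c *: (bpure alpha a n : lift_base L) = bpure alpha (c * a) n.
Proof.
by rewrite -[LHS]/(tens (c : alg_of S) (1 : Lam) *: bpure alpha a n)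
  bscale_pure tens1 scale1r.
Qed.

Lemma change_coordsK z : z = \sum_i change_coords z 0 i *: change_basis i.
Proof.
elim/bpure_ind: (z : bchange alpha (lift_mod U)) => [a n|x y IHx IHy].
  rewrite change_coords_pure.
  have nE : n = \sum_i (tens (co (n : M) 0 i : alg_of (chat_field k)) 1 *: (b i : triv M)).
    rewrite [LHS](coK (n : M)); apply: eq_bigr => i _.
    by rewrite [RHS]triv_tens mulr1.
  rewrite [n in LHS]nE.
  have bpure_sum (I : Type) (r : seq I) (G : I -> lift_mod U) :
      bpure alpha a (\sum_(i <- r) G i) = \sum_(i <- r) bpure alpha a (G i).
    apply: (big_morph (bpure alpha a)) => [x y|]; first exact: bpureDr.
    by apply: (addrI (bpure alpha a 0)); rewrite -bpureDr !addr0.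
  rewrite bpure_sum; apply: eq_bigr => i _.
  by rewrite mxE [RHS]change_scale mulr1 -bpureZ mulrC.
rewrite change_coordsD [LHS](congr2 +%R IHx IHy) -big_split.
by apply: eq_bigr => i _; rewrite /= mxE scalerDl.
Qed.

Lemma Kchange_coords (c : 'rV[S]_d) :
  change_coords (\sum_i c 0 i *: change_basis i) = c.
Proof.
have coords0 : change_coords 0 = 0.
  by apply: (addrI (change_coords 0)); rewrite -change_coordsD !addr0.
have cob i : co (b i) = delta_mx 0 i.
  by rewrite -[RHS]Kco -/(lcomb b _) lcomb_delta.
rewrite (big_morph _ change_coordsD coords0); apply/rowP => j.
have cE i : change_coords (c 0 i *: change_basis i) 0 j = c 0 i *+ (j == i).
  rewrite [_ *: _]change_scale change_coords_pure mxE mulr1 cob mxE eqxx /=.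
  case: eqP => _; first by rewrite [alpha _]rmorph1 mulr1.
  by rewrite [alpha _]rmorph0 mulr0.
rewrite summxE (bigD1 j) //= cE eqxx big1 ?addr0 // => i ij.
by rewrite cE eq_sym (negPf ij).
Qed.

Lemma change_map_pure (m : M) :
  lift_map L (bpure (chat_aug S) 1 (bpure alpha 1 (m : triv M))) = m.
Proof.
rewrite /= /restr_map [X in triv_map X](bcomp_pure (chat_hom_aug alpha)).
by rewrite triv_map_pure mul1r rmorph1 [kscal _ _]rmorph1 scale1r.
Qed.

(** Every element has the form [1 (x) (1 (x) m)]: a coefficient in [S] acts on the outer factor
    through its augmentation, a scalar that moves across both tensor signs onto [m]. *)
Lemma change_map_bij : bijective (lift_map L).
Proof.
suff zE (z : reduction (lift_mod L)) : exists m : M,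
    z = bpure (chat_aug S) 1 (bpure alpha 1 (m : triv M)) :> bchange _ _.
  exists (fun m => bpure (chat_aug S) 1 (bpure alpha 1 (m : triv M))).
    by move=> z; have [m ->] := zE z; rewrite change_map_pure.
  exact: change_map_pure.
have [n ->] := reduction_pure (L := L) z.
elim/bpure_ind: (n : bchange alpha (lift_mod U)) => [a m|x y [m E] [m' E']]; last first.
  by exists (m + m'); rewrite !bpureDr E E'.
have aE (s : S) : bpure alpha s m = tens (s : alg_of S) 1 *: bpure alpha 1 m.
  by rewrite bscale_pure mulr1 tens1 scale1r.
exists (tens (chat_aug S a : alg_of (chat_field k)) 1 *: m).
rewrite -bpureZ mulr1 aE -bpureZ [X in _ = bpure _ _ X]aE -bpureZ.
congr (bpure _ (_ * 1) _); exact: (esym (chat_hom_aug alpha _)).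
Qed.

Lemma change_is_lift : is_lift L.
Proof.
exact: coords_is_lift change_coordsK Kchange_coords change_map_bij.
Qed.
End TrivialDeformation.

Section ChatComp.
Variables (k : fieldType) (R S T : chat k).

Definition chat_id : chat_hom R R :=
  @ChatHom k R R idfun (fun=> erefl)
    (fun x n => ex_intro _ n (fun y (h : ideal_pow _ n (y - x)) => h)).

Variables (g : chat_hom S T) (f : chat_hom R S).
Fact chat_comp_aug r : chat_aug T (g (f r)) = chat_aug R r.
Proof. by rewrite !chat_hom_aug. Qed.
Fact chat_comp_cont : adic_continuous (g \o f).
Proof.
move=> x n; have [m gm] := chat_hom_cont g (f x) n.
have [l fl] := chat_hom_cont f x m.
by exists l => y /fl/gm.
Qed.
Definition chat_comp : chat_hom R T :=
  @ChatHom k R T (g \o f) chat_comp_aug chat_comp_cont.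
End ChatComp.

Theorem theorem1 (k : fieldType) (Q : quiver) (M : lmodType (path_alg k Q)) :
  finite_rep_type k Q -> fin_gen M -> indecomposable M ->
  (exists R : chat k, is_universal_deformation_ring M R) /\
  (forall R : chat k, is_universal_deformation_ring M R ->
     chat_iso R (chat_field k)).
Proof.
move=> Qft Mfg Mid.
have [d [b [co [coK Kco ext]]]] := module_mxext0 Qft Mfg Mid.
have iso (S : chat k) (L L' : prelift M S) : is_lift L -> is_lift L' -> lift_iso L L'.
  exact: lifts_iso coK Kco ext _ _.
(* As all lifts are isomorphic, the only class over [S] is the predicate [is_lift] itself. *)
have class (S : chat k) (L : prelift M S) : is_lift L -> deformation_class L = @is_lift _ _ M S.
  move=> LL; apply/funext => L'; apply/propext; split=> [[]//|LL'].
  by split=> //; exact: iso.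
have defE (S : chat k) (D : prelift M S -> Prop) : deformations D -> D = @is_lift _ _ M S.
  by move=> [L LL ->]; exact: class.
split=> [|R [U LU uR]].
  exists (chat_field k), (triv_lift M); first exact: triv_is_lift coK Kco.
  move=> S ev.
  have chL (alpha : chat_hom (chat_field k) S) : is_lift (lift_change alpha (triv_lift M)).
    exact: (change_is_lift coK Kco alpha).
  have evE alpha : ev alpha = @is_lift _ _ M S.
    apply/funext => L'; apply/propext; split=> [[L _ []//]|LL'].
    exists (triv_lift M); last by rewrite class.
    by rewrite class; exact: triv_is_lift coK Kco.
  split=> [alpha|alpha beta _|D /defE->].
  - by rewrite evE; exists (lift_change alpha (triv_lift M)); rewrite ?class.
  - exact: chat_hom_of_field.
  - by exists (chat_of_field S); exact: evE.
(* The composite [R -> k -> R] and the identity both send the universal class to the only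
   deformation over [R], so injectivity makes them equal. *)
have [evD ev_inj _] := uR R.
exists (chat_to_field R), (chat_of_field R); split=> x.
  have E : chat_comp (chat_of_field R) (chat_to_field R) = chat_id R.
    by apply: ev_inj; rewrite !(defE _ _ (evD _)).
  exact: (congr1 (fun f : chat_hom R R => f x) E).
exact: (@chat_in_alg_aug k R x).
Qed.
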